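(* (i) If $G$ is the Grigorchuk group, then the Nielsen graph $\Gamma_n(G)$ is connected for every $n\geq 4$. (ii) If $p$ is an odd prime and $G$ is the Gupta-Sidki $p$-group, then the Nielsen graph $\Gamma_n(G)$ is connected for every $n\geq 3$.
   Context: The Grigorchuk group is the group $\langle a,b,c,d\rangle$ of automorphisms of the rooted binary tree (bijections of the set of finite words over $\{0,1\}$) generated by $a,b,c,d$, all fixing the empty word and given recursively, for every finite word $w$, by $a(0w)=1w$, $a(1w)=0w$; $b(0w)=0\,a(w)$, $b(1w)=1\,c(w)$; $c(0w)=0\,a(w)$, $c(1w)=1\,d(w)$; $d(0w)=0w$, $d(1w)=1\,b(w)$. For an odd prime $p$, the Gupta-Sidki $p$-group is the group $\langle a,b\rangle$ of automorphisms of the rooted $p$-regular tree (bijections of the set of finite words over $\{0,1,\dots,p-1\}$) generated by $a,b$, both fixing the empty word and given recursively, for every finite word $w$, by: $a(xw)=x'w$ where $x'\equiv x+1 \pmod p$; $b(0w)=0\,a(w)$, $b(1w)=1\,a^{-1}(w)$, $b(xw)=xw$ for $2\le x\le p-2$, and $b((p-1)w)=(p-1)\,b(w)$. For a finitely generated group $G$ and $n\ge \operatorname{rank}(G)$ (the minimal number of generators), the Nielsen graph $\Gamma_n(G)$ has as vertices the generating $n$-tuples $(g_1,\dots,g_n)\in G^n$, $\langle g_1,\dots,g_n\rangle=G$; two vertices are joined by an edge if one is obtained from the other by an elementary Nielsen move, i.e. by replacing $x_i$ by $x_ix_j^{\pm1}$ or by $x_j^{\pm1}x_i$ for some $j\ne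 i$, or by replacing $x_j$ by $x_j^{-1}$, the other entries being unchanged. *)

(* Defs.v *)
From HB Require Import structures.
From Stdlib Require Export Relation_Operators.
From mathcomp Require Export all_boot.
From mathcomp Require Export boolp classical_sets.
Set Implicit Arguments.
Unset Strict Implicit.
Unset Printing Implicit Defensive.

Local Open Scope classical_set_scope.
Local Open Scope group_scope.

(* The vertices of the regular rooted tree are the finite words over X, the
   root is the empty word, and u lies on the path from the root to v iff u is a
   prefix of v; a rooted tree automorphism is thus a bijection of words that
   preserves and reflects the prefix order. *)
Record tree_aut (X : eqType) := TreeAut {
  taut :> seq X -> seq X;
  taut_inv : seq X -> seq X;
  tautK : cancel taut taut_inv;
  taut_invK : cancel taut_inv taut;
  taut_prefix : {mono taut : u v / prefix u v}
}.

Section TreeAutGroup.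
Variable X : eqType.
Implicit Types f g h : tree_aut X.

Lemma taut_ext f g : taut f =1 taut g -> f = g.
Proof.
case: f g => f f' fK f'K fp [g g' gK g'K gp] /= /funext fg.
move: fK f'K fp; rewrite fg => fK f'K fp.
have fg' : f' = g' by apply/funext => w; rewrite -[w in LHS]g'K fK.
move: fK f'K; rewrite fg' => fK f'K.
by congr TreeAut; apply: Prop_irrelevance.
Qed.

Definition taut_one := @TreeAut X id id (frefl id) (frefl id) (fun _ _ => erefl).

Fact taut_inv_prefix f : {mono taut_inv f : u v / prefix u v}.
Proof. by move=> u v; rewrite -(taut_prefix f) !taut_invK. Qed.

Definition taut_invg f :=
  TreeAut (@taut_invK X f) (@tautK X f) (@taut_inv_prefix f).

Fact taut_mul_prefix f g : {mono taut f \o taut g : u v / prefix u v}.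
Proof. by move=> u v; rewrite /= !taut_prefix. Qed.

Definition taut_mul f g :=
  TreeAut (can_comp (@tautK X f) (@tautK X g))
    (can_comp (@taut_invK X g) (@taut_invK X f)) (@taut_mul_prefix f g).

HB.instance Definition _ := gen_eqMixin (tree_aut X).
HB.instance Definition _ := gen_choiceMixin (tree_aut X).

Fact taut_mulA : associative taut_mul.
Proof. by move=> f g h; apply: taut_ext. Qed.
Fact taut_mul1g : left_id taut_one taut_mul.
Proof. by move=> f; apply: taut_ext. Qed.
Fact taut_mulg1 : right_id taut_one taut_mul.
Proof. by move=> f; apply: taut_ext. Qed.
Fact taut_mulVg : left_inverse taut_one taut_invg taut_mul.
Proof. by move=> f; apply: taut_ext => w /=; rewrite tautK. Qed.
Fact taut_mulgV : right_inverse taut_one taut_invg taut_mul.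
Proof. by move=> f; apply: taut_ext => w /=; rewrite taut_invK. Qed.

HB.instance Definition _ := isGroup.Build (tree_aut X)
  taut_mulA taut_mul1g taut_mulg1 taut_mulVg taut_mulgV.

End TreeAutGroup.

Definition generated (gT : groupType) (S : set gT) : set gT :=
  smallest (fun H : set gT => group_closed (mem H)) S.

(* Letter 0 is false and letter 1 is true. *)
Definition grig_a_fun (w : seq bool) : seq bool :=
  if w is x :: v then ~~ x :: v else [::].

Fact grig_a_funK : involutive grig_a_fun.
Proof. by case=> [|x v] //=; rewrite negbK. Qed.

Fact grig_a_prefix : {mono grig_a_fun : u v / prefix u v}.
Proof. by move=> [|x u] [|y v] //=; rewrite (inj_eq negb_inj). Qed.

Definition grig_a := TreeAut grig_a_funK grig_a_funK grig_a_prefix.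

Fixpoint grig_b_fun (w : seq bool) : seq bool :=
  match w with
  | [::] => [::]
  | false :: v => false :: grig_a v
  | true :: v => true :: grig_c_fun v
  end
with grig_c_fun (w : seq bool) : seq bool :=
  match w with
  | [::] => [::]
  | false :: v => false :: grig_a v
  | true :: v => true :: grig_d_fun v
  end
with grig_d_fun (w : seq bool) : seq bool :=
  match w with
  | [::] => [::]
  | false :: v => false :: v
  | true :: v => true :: grig_b_fun v
  end.

Fact grig_bcd_funK w : [/\ grig_b_fun (grig_b_fun w) = w,
  grig_c_fun (grig_c_fun w) = w & grig_d_fun (grig_d_fun w) = w].
Proof.
by elim: w => [|[] v [Hb Hc Hd]] //=; rewrite ?Hb ?Hc ?Hd ?grig_a_funK.
Qed.

Fact grig_b_funK : involutive grig_b_fun.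
Proof. by move=> w; case: (grig_bcd_funK w). Qed.
Fact grig_c_funK : involutive grig_c_fun.
Proof. by move=> w; case: (grig_bcd_funK w). Qed.
Fact grig_d_funK : involutive grig_d_fun.
Proof. by move=> w; case: (grig_bcd_funK w). Qed.

Fact grig_bcd_prefix u v :
  [/\ prefix (grig_b_fun u) (grig_b_fun v) = prefix u v,
      prefix (grig_c_fun u) (grig_c_fun v) = prefix u v
    & prefix (grig_d_fun u) (grig_d_fun v) = prefix u v].
Proof.
elim: u v => [|x u IHu] [|y v]; first by [].
- by case: y.
- by case: x.
by have [Hb Hc Hd] := IHu v; case: x y => [] [] //=;
  rewrite ?Hb ?Hc ?Hd ?grig_a_prefix.
Qed.

Fact grig_b_prefix : {mono grig_b_fun : u v / prefix u v}.
Proof. by move=> u v; case: (grig_bcd_prefix u v). Qed.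
Fact grig_c_prefix : {mono grig_c_fun : u v / prefix u v}.
Proof. by move=> u v; case: (grig_bcd_prefix u v). Qed.
Fact grig_d_prefix : {mono grig_d_fun : u v / prefix u v}.
Proof. by move=> u v; case: (grig_bcd_prefix u v). Qed.

Definition grig_b := TreeAut grig_b_funK grig_b_funK grig_b_prefix.
Definition grig_c := TreeAut grig_c_funK grig_c_funK grig_c_prefix.
Definition grig_d := TreeAut grig_d_funK grig_d_funK grig_d_prefix.

Definition grigorchuk_group : set (tree_aut bool) :=
  generated [set grig_a; grig_b; grig_c; grig_d].

Section GuptaSidki.
Variable p : nat.

Definition gs_a_fun (w : seq 'I_p) : seq 'I_p :=
  if w is x :: v then ordS x :: v else [::].

Definition gs_a_inv (w : seq 'I_p) : seq 'I_p :=
  if w is x :: v then ord_pred x :: v else [::].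

Fact gs_a_funK : cancel gs_a_fun gs_a_inv.
Proof. by case=> [|x v] //=; rewrite ordSK. Qed.

Fact gs_a_invK : cancel gs_a_inv gs_a_fun.
Proof. by case=> [|x v] //=; rewrite ord_predK. Qed.

Fact gs_a_prefix : {mono gs_a_fun : u v / prefix u v}.
Proof. by move=> [|x u] [|y v] //=; rewrite (inj_eq (@ordS_inj p)). Qed.

Definition gs_a := TreeAut gs_a_funK gs_a_invK gs_a_prefix.

(* The generator b is gs_b_fun gs_a. The parameter s makes the inverse an
   instance of the same recursion, namely gs_b_fun gs_a^-1. *)
Fixpoint gs_b_fun (s : tree_aut 'I_p) (w : seq 'I_p) : seq 'I_p :=
  if w is x :: v then
    x :: (if x == 0%N :> nat then s v
          else if x == 1%N :> nat then s^-1 v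
          else if x == p.-1 :> nat then gs_b_fun s v
          else v)
  else [::].

Fact gs_b_funK s : cancel (gs_b_fun s) (gs_b_fun s^-1).
Proof.
elim=> [|x v IHv] //=; congr cons.
case: (x == 0%N :> nat); first exact: tautK.
case: (x == 1%N :> nat); first exact: taut_invK.
by case: (x == p.-1 :> nat).
Qed.

Fact gs_b_invK s : cancel (gs_b_fun s^-1) (gs_b_fun s).
Proof. by move=> w; rewrite -[s in gs_b_fun s]invgK gs_b_funK. Qed.

Fact gs_b_prefix s : {mono gs_b_fun s : u v / prefix u v}.
Proof.
elim=> [|x u IHu] [|y v] //=; case: eqVneq => //= <-.
case: (x == 0%N :> nat); first exact: taut_prefix.
case: (x == 1%N :> nat); first exact: (@taut_prefix _ s^-1).
by case: (x == p.-1 :> nat).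
Qed.

Definition gs_b :=
  TreeAut (@gs_b_funK gs_a) (@gs_b_invK gs_a) (@gs_b_prefix gs_a).

Definition gupta_sidki_group : set (tree_aut 'I_p) :=
  generated [set gs_a; gs_b].

End GuptaSidki.
Arguments gupta_sidki_group p : clear implicits.

Section NielsenGraph.
Variables (gT : groupType) (n : nat).
Implicit Types x y : {ffun 'I_n -> gT}.

Definition set_entry x (i : 'I_n) (g : gT) : {ffun 'I_n -> gT} :=
  [ffun k => if k == i then g else x k].

Inductive nielsen_move x : {ffun 'I_n -> gT} -> Prop :=
| NielsenMulR i j of j != i : nielsen_move x (set_entry x i (x i * x j))
| NielsenMulRV i j of j != i : nielsen_move x (set_entry x i (x i * (x j)^-1))
| NielsenMulL i j of j != i : nielsen_move x (set_entry x i (x j * x i))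
| NielsenMulLV i j of j != i : nielsen_move x (set_entry x i ((x j)^-1 * x i))
| NielsenInv j : nielsen_move x (set_entry x j (x j)^-1).

Definition nielsen_vertex (G : set gT) : Type :=
  {x : {ffun 'I_n -> gT} | generated (range x) = G}.

Definition nielsen_edge (G : set gT) (u v : nielsen_vertex G) : Prop :=
  nielsen_move (sval u) (sval v) \/ nielsen_move (sval v) (sval u).

End NielsenGraph.
Arguments nielsen_edge {gT} n G u v.

Definition graph_connected (V : Type) (E : V -> V -> Prop) : Prop :=
  inhabited V /\ forall u v : V, clos_refl_trans V E u v.

(* Main.v *)
(* Let G be one of these groups and G' its commutator subgroup. Both parts
   follow from Pervova's theorem that G' lies in the Frattini subgroup: if M is
   dense, meaning M G' = G, then M = G. Given it, let d be the size of a
   generating set s_1, ..., s_d of elements of order p (d = 3 for the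
   Grigorchuk group, d = 2 for the Gupta-Sidki group) and let n > d. As G/G' is
   a vector space over F_p of dimension d, some entry of a generating n-tuple is
   redundant modulo G', hence redundant; it can be moved to s_{k+1} once
   s_1, ..., s_k are already entries, so every tuple is connected to
   (s_1, ..., s_d, 1, ..., 1).

   Pervova's theorem is proved on the tree. The sections at a letter x of the
   elements of a dense M fixing x form a dense subgroup M_x again. If M_x = G
   then M = G: by density and Goursat's lemma the elements of M supported on one
   subtree form a large normal subgroup of G, so M contains all elements of G
   fixing some level, and density modulo the stabiliser of a level finishes. It
   remains to reach G from M by iterating M -> M_x, which is a contraction
   argument on the length of conjugators x^f, y^g of generators lying in M. For
   the Grigorchuk group the weighted total length decreases except for
   finitely many configurations, which are settled by computation. *)

From Stdlib Require Import Operators_Properties.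
From mathcomp Require Import all_boot all_fingroup all_solvable all_algebra.
Require Import Defs.
From mathcomp Require Import ssralg zify.
Set Implicit Arguments.
Unset Strict Implicit.
Unset Printing Implicit Defensive.
Import GRing.Theory.
Local Open Scope classical_set_scope.
Local Open Scope group_scope.

(** * Subgroups and commutators *)

Section Subgroups.
Variable gT : groupType.
Implicit Types (H K N G : set gT) (S : set gT).

(** As [G] is infinite, G' does not lie in the Frattini subgroup for the general reason that applies
    to finite p-groups. That reason only acts on each level of the tree, where it shows that a dense
    M agrees with [G] modulo every level stabiliser. The real task is to show that M contains one of
    these stabilisers. The criterion for this is a branching subgroup, a copy of which has to be
    found in M at every vertex of some level: G' itself for the Gupta-Sidki groups, the normal
    closure K of [a, b] for the Grigorchuk group. In the descent the obstacle is that density yields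
    elements of M in prescribed classes modulo G', but no generator. Such an element is first
    shortened through sections and powers, while its class is kept away from the useless values,
    until it is conjugate to a power of a generator. Only then can the conjugators of several
    generators be shortened together. *)

Definition subgroup H :=
  [/\ H 1, forall x y, H x -> H y -> H (x * y) & forall x, H x -> H x^-1].

Lemma subgroup1 H : subgroup H -> H 1. Proof. by case. Qed.
Lemma subgroupM H x y : subgroup H -> H x -> H y -> H (x * y).
Proof. by case=> _ + _; apply. Qed.
Lemma subgroupV H x : subgroup H -> H x -> H x^-1.
Proof. by case=> _ _; apply. Qed.
Lemma subgroupJ H x y : subgroup H -> H x -> H y -> H (x ^ y).
Proof.
by move=> sH Hx Hy; apply: subgroupM (subgroupV sH Hy) (subgroupM sH Hx Hy).
Qed.
Lemma subgroupR H x y : subgroup H -> H x -> H y -> H [~ x, y].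
Proof.
by move=> sH Hx Hy; apply: subgroupM (subgroupV sH Hx) (subgroupJ sH Hx Hy).
Qed.
Lemma subgroupX H x n : subgroup H -> H x -> H (x ^+ n).
Proof.
move=> sH Hx; elim: n => [|n IHn]; first exact: subgroup1.
by rewrite expgS; apply: subgroupM.
Qed.
Lemma subgroupMl H x y : subgroup H -> H x -> H (x * y) -> H y.
Proof. by move=> sH Hx Hxy; rewrite -[y](mulKg x); apply: subgroupM (subgroupV sH Hx) Hxy. Qed.
Lemma subgroup_closed H : subgroup H -> group_closed (mem H).
Proof.
move=> sH; split; first by rewrite inE; apply: subgroup1.
by move=> x y; rewrite !inE => Hx Hy; apply: subgroupM (subgroupV sH Hy).
Qed.

Lemma generated_subgroup S : subgroup (generated S).
Proof.
split.
- by move=> H [[H1 _] _]; move: H1; rewrite inE.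
- move=> x y Sx Sy H clH; have Hx := Sx _ clH; have Hy := Sy _ clH.
  by have := group_closedM clH.1; move/(_ x y); rewrite !inE; apply.
- move=> x Sx H clH; have Hx := Sx _ clH.
  by have := group_closedV clH.1; move/(_ x); rewrite !inE; apply.
Qed.

Lemma sub_generated S : S `<=` generated S.
Proof. by move=> x Sx H [_]; apply. Qed.

Lemma generated_min S H : subgroup H -> S `<=` H -> generated S `<=` H.
Proof. by move=> sH SH x Sx; apply: (Sx H); split; [exact: subgroup_closed | ]. Qed.

Lemma generated_mono S T : S `<=` generated T -> generated S `<=` generated T.
Proof. by move=> ST; apply: generated_min => //; apply: generated_subgroup. Qed.

Definition normal_in G N :=
  [/\ subgroup N, N `<=` G & forall x g, N x -> G g -> N (x ^ g)].

Definition commutators H K : set gT := [set z | exists2 x, H x & exists2 y, K y & z = [~ x, y]].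
Definition commsub H K : set gT := generated (commutators H K).

Lemma commsub_subgroup H K : subgroup (commsub H K).
Proof. exact: generated_subgroup. Qed.

Lemma mem_commsub H K x y : H x -> K y -> commsub H K [~ x, y].
Proof. by move=> Hx Ky; apply: sub_generated; exists x => //; exists y. Qed.

Lemma commsub_min H K N : subgroup N -> (forall x y, H x -> K y -> N [~ x, y]) ->
  commsub H K `<=` N.
Proof.
by move=> sN HKN; apply: generated_min => // _ [x Hx [y Ky ->]]; apply: HKN.
Qed.

Lemma commsub_mono H K H' K' : H `<=` H' -> K `<=` K' -> commsub H K `<=` commsub H' K'.
Proof.
move=> HH KK; apply: commsub_min; first exact: commsub_subgroup.
by move=> x y /HH + /KK; apply: mem_commsub.
Qed.

Lemma commsub_normal G H K : subgroup G -> normal_in G H -> normal_in G K ->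
  normal_in G (commsub H K).
Proof.
move=> sG [sH HG nH] [sK KG nK]; split; first exact: commsub_subgroup.
  by apply: commsub_min => // x y /HG Gx /KG Gy; apply: subgroupR.
move=> x g Kx Gg.
suff /(_ x Kx) : commsub H K `<=` [set x | commsub H K (x ^ g)] by [].
apply: (@commsub_min H K) => [|y z Hy Kz /=]; last first.
  by rewrite conjRg; apply: mem_commsub; [apply: nH | apply: nK].
have sC := commsub_subgroup H K.
split=> [|y z|y] /=; first by rewrite conj1g; apply: subgroup1.
  by rewrite conjMg; apply: subgroupM.
by rewrite conjVg; apply: subgroupV.
Qed.

Lemma normal_refl G : subgroup G -> normal_in G G.
Proof. by move=> sG; split=> // x g Gx Gg; apply: subgroupJ. Qed.

Lemma subgroupRr G N x y : normal_in G N -> G x -> N y -> N [~ x, y].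
Proof.
move=> [sN NG nN] Gx Ny; rewrite commgEr; apply: subgroupM => //.
by apply: nN => //; apply: subgroupV.
Qed.

Lemma subgroupRl G N x y : normal_in G N -> N x -> G y -> N [~ x, y].
Proof.
move=> [sN NG nN] Nx Gy; rewrite commgEl; apply: subgroupM => //; last exact: nN.
exact: subgroupV.
Qed.

Lemma commutant_subgroup G N x : subgroup G -> normal_in G N -> G x ->
  subgroup [set y | G y /\ N [~ x, y]].
Proof.
move=> sG [sN NG nN] Gx; split=> /=.
- by rewrite commg1; split; apply: subgroup1.
- move=> y z [Gy Ny] [Gz Nz]; split; first exact: subgroupM.
  have -> : [~ x, y * z] = [~ x, z] * [~ x, y] ^ z by rewrite /commg /conjg !gnorm.
  by apply: subgroupM => //; apply: nN.
- move=> y [Gy Ny]; split; first exact: subgroupV.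
  have -> : [~ x, y^-1] = ([~ x, y]^-1) ^ y^-1 by rewrite /commg /conjg !gnorm.
  by apply: nN; apply: subgroupV.
Qed.

Lemma comm_generated G N S x : subgroup G -> normal_in G N -> G x -> S `<=` G ->
  (forall y, S y -> N [~ x, y]) -> forall y, generated S y -> N [~ x, y].
Proof.
move=> sG nN Gx SG SN y Sy.
have [] // : [set y | G y /\ N [~ x, y]] y.
move: Sy; apply: generated_min; first exact: commutant_subgroup.
by move=> z Sz; split; [apply: SG | apply: SN].
Qed.

Lemma commsub_generated G N S T : subgroup G -> normal_in G N -> S `<=` G -> T `<=` G ->
  (forall x y, S x -> T y -> N [~ x, y]) -> commsub (generated S) (generated T) `<=` N.
Proof.
move=> sG nN SG TG STN; have [sN NG _] := nN.
have gT_G z : generated T z -> G z by apply: generated_min.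
apply: commsub_min => // x y Sx Ty; rewrite -invgR; apply: subgroupV => //.
apply: (comm_generated sG nN (gT_G _ Ty) SG) Sx => z Sz.
rewrite -invgR; apply: subgroupV => //.
by apply: (comm_generated sG nN (SG _ Sz) TG) Ty => t; apply: STN.
Qed.

Definition dense G M :=
  [/\ subgroup M, M `<=` G &
      forall g, G g -> exists2 m, M m & commsub G G (m^-1 * g)].

End Subgroups.
Global Opaque generated commsub.

(** * Sections of tree automorphisms *)

Section Sections.
Variable X : eqType.
Implicit Types (f g h : tree_aut X) (x y : X) (v w : seq X).

Lemma tautM g h w : (g * h) w = g (h w). Proof. by []. Qed.
Lemma taut1 w : (1 : tree_aut X) w = w. Proof. by []. Qed.
Lemma tautVK g : cancel g g^-1. Proof. exact: tautK. Qed.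
Lemma tautKV g : cancel g^-1 g. Proof. exact: taut_invK. Qed.

(** Only the prefix order is given, so lengths are recovered by counting: the prefixes of [w] have
    distinct images, all of them prefixes of [g w]. *)
Fact size_taut_leq g w : size w <= size (g w).
Proof.
have s_le : {subset [seq g (take i w) | i <- iota 0 (size w).+1]
               <= [seq take i (g w) | i <- iota 0 (size (g w)).+1]}.
  move=> _ /mapP[i _ ->].
  have : prefix (g (take i w)) (g w) by rewrite taut_prefix prefix_take.
  rewrite prefixE => /eqP <-; set n := size _.
  apply/mapP; exists n => //; rewrite mem_iota add0n ltnS /=.
  have : prefix (g (take i w)) (g w) by rewrite taut_prefix prefix_take.
  exact: size_prefix.
suff u : uniq [seq g (take i w) | i <- iota 0 (size w).+1].
  by have := uniq_leq_size u s_le; rewrite !size_map !size_iota.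
rewrite map_inj_in_uniq ?iota_uniq // => i j; rewrite !mem_iota !add0n !ltnS /=.
move=> i_le j_le /(can_inj (tautVK g)) /(congr1 size).
by rewrite !size_takel.
Qed.

Lemma size_taut g w : size (g w) = size w.
Proof.
apply/eqP; rewrite eqn_leq size_taut_leq andbT.
by rewrite -{2}[w](tautVK g) size_taut_leq.
Qed.

Lemma taut_nil g : g [::] = [::].
Proof. by apply: size0nil; rewrite size_taut. Qed.

Definition rt g x : X := head x (g [:: x]).
Definition sec_fun g x v : seq X := behead (g (x :: v)).

Fact rt_seq1 g x : g [:: x] = [:: rt g x].
Proof. by rewrite /rt; case: (g _) (size_taut g [:: x]) => [|y []]. Qed.

Fact taut_cons g x v : g (x :: v) = rt g x :: sec_fun g x v.
Proof.
have : prefix (g [:: x]) (g (x :: v)) by rewrite taut_prefix /= eqxx prefix0s.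
by rewrite rt_seq1 /sec_fun; case: (g _) => //= y u /andP[/eqP <-].
Qed.

Lemma rtVK g : cancel (rt g) (rt g^-1).
Proof.
move=> x; have := tautVK g [:: x]; rewrite rt_seq1 rt_seq1.
by case.
Qed.

Lemma rtKV g : cancel (rt g^-1) (rt g).
Proof. by move=> x; rewrite -{1}(invgK g) rtVK. Qed.

Fact sec_funK g x : cancel (sec_fun g x) (sec_fun g^-1 (rt g x)).
Proof.
by move=> v; rewrite {1}/sec_fun -taut_cons tautVK.
Qed.

Fact sec_fun_invK g x : cancel (sec_fun g^-1 (rt g x)) (sec_fun g x).
Proof. by move=> v; have := @sec_funK g^-1 (rt g x) v; rewrite invgK rtVK. Qed.

Fact sec_prefix g x : {mono sec_fun g x : u v / prefix u v}.
Proof.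
move=> u v; have := taut_prefix g (x :: u) (x :: v).
by rewrite !taut_cons /= !eqxx.
Qed.

Definition sec g x := TreeAut (@sec_funK g x) (@sec_fun_invK g x) (@sec_prefix g x).

Lemma tautE g x v : g (x :: v) = rt g x :: sec g x v.
Proof. exact: taut_cons. Qed.

Lemma tree_aut_eq g h :
  (forall x, rt g x = rt h x) -> (forall x, sec g x = sec h x) -> g = h.
Proof.
move=> e_rt e_sec; apply: taut_ext => -[|x v]; first by rewrite !taut_nil.
by rewrite !tautE e_rt e_sec.
Qed.

Lemma rt1 x : rt 1 x = x. Proof. by []. Qed.
Lemma sec1 x : sec 1 x = 1. Proof. exact: taut_ext. Qed.
Lemma rtM g h x : rt (g * h) x = rt g (rt h x).
Proof. by have := rt_seq1 (g * h) x; rewrite tautM !rt_seq1 => -[]. Qed.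
Lemma secM g h x : sec (g * h) x = sec g (rt h x) * sec h x.
Proof.
apply: taut_ext => v; have := tautE (g * h) x v.
by rewrite tautM (tautE h) tautE => /(congr1 behead).
Qed.
Lemma secV g x : sec g^-1 x = (sec g (rt g^-1 x))^-1.
Proof.
apply: (@mulgI _ (sec g (rt g^-1 x))); rewrite mulgV.
by rewrite -secM mulgV sec1.
Qed.
Lemma rtJ g h x : rt (g ^ h) x = rt h^-1 (rt g (rt h x)).
Proof. by rewrite !rtM. Qed.

Lemma rtX_fix g x n : rt g x = x -> rt (g ^+ n) x = x.
Proof.
by move=> gx; elim: n => [|n IHn]; [exact: rt1 | rewrite expgS rtM IHn].
Qed.

Lemma rtV_fix g x : rt g x = x -> rt g^-1 x = x.
Proof. by move=> {1}<-; rewrite rtVK. Qed.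

Lemma secV_fix g x : rt g x = x -> sec g^-1 x = (sec g x)^-1.
Proof. by move=> gx; rewrite secV rtV_fix. Qed.

Lemma secX_fix g x n : rt g x = x -> sec (g ^+ n) x = sec g x ^+ n.
Proof.
move=> gx; elim: n => [|n IHn]; first exact: sec1.
by rewrite !expgS secM rtX_fix // IHn.
Qed.

Lemma secJ g h x : rt g (rt h x) = rt h x ->
  sec (g ^ h) x = sec g (rt h x) ^ sec h x.
Proof.
by move=> gx; rewrite /conjg !secM secV rtM gx rtVK.
Qed.

Lemma rtJ_fix g h x : rt g (rt h x) = rt h x -> rt (g ^ h) x = x.
Proof. by move=> gx; rewrite rtJ gx rtVK. Qed.

Lemma secR_fix g h x : rt g x = x -> rt h x = x ->
  sec [~ g, h] x = [~ sec g x, sec h x].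
Proof.
move=> gx hx; rewrite /commg secM secV_fix // ?secJ ?rtJ_fix ?hx ?gx //.
Qed.

Definition emb_fun x g w : seq X :=
  if w is y :: v then y :: (if y == x then g v else v) else [::].

Fact emb_funK x g : cancel (emb_fun x g) (emb_fun x g^-1).
Proof. by case=> [|y v] //=; case: eqP => // _; rewrite tautK. Qed.
Fact emb_invK x g : cancel (emb_fun x g^-1) (emb_fun x g).
Proof. by case=> [|y v] //=; case: eqP => // _; rewrite taut_invK. Qed.
Fact emb_prefix x g : {mono emb_fun x g : u v / prefix u v}.
Proof.
move=> [|y u] [|z v] //=; case: eqP => //= ->.
by case: eqP => // _; rewrite taut_prefix.
Qed.

Definition emb x g := TreeAut (@emb_funK x g) (@emb_invK x g) (@emb_prefix x g).

Lemma rt_emb x g y : rt (emb x g) y = y. Proof. by []. Qed.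
Lemma sec_emb x g y : sec (emb x g) y = if y == x then g else 1.
Proof. by apply: taut_ext => v; rewrite /= /sec_fun /=; case: eqP. Qed.
Lemma sec_embE x g : sec (emb x g) x = g. Proof. by rewrite sec_emb eqxx. Qed.

Lemma emb1 x : emb x 1 = 1.
Proof.
by apply: tree_aut_eq => y //; rewrite sec_emb sec1; case: eqP.
Qed.
Lemma embM x g h : emb x (g * h) = emb x g * emb x h.
Proof.
apply: tree_aut_eq => y //; rewrite secM rt_emb !sec_emb.
by case: eqP; rewrite ?mulg1.
Qed.
Lemma embV x g : emb x g^-1 = (emb x g)^-1.
Proof. by apply: (@mulgI _ (emb x g)); rewrite -embM !mulgV emb1. Qed.
Lemma embJ x g h : emb x g ^ h = emb (rt h^-1 x) (g ^ sec h (rt h^-1 x)).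
Proof.
apply: tree_aut_eq => y; first by rewrite rtJ rt_emb rtVK.
rewrite secJ ?rt_emb // !sec_emb.
have -> : (y == rt h^-1 x) = (rt h y == x) by apply/eqP/eqP => [->|<-]; rewrite ?rtKV ?rtVK.
by case: eqP => [<-|_]; rewrite ?rtVK ?conj1g.
Qed.
Lemma embJ_fix x g h : rt h x = x -> emb x g ^ h = emb x (g ^ sec h x).
Proof. by move=> hx; rewrite embJ rtV_fix. Qed.
Lemma embR_fix x g h : rt h x = x -> [~ emb x g, h] = emb x [~ g, sec h x].
Proof. by move=> hx; rewrite /commg embJ_fix // [RHS]embM embV. Qed.
(** The stabiliser of level [k], defined through sections to suit inductions on the tree; [stab_act]
    and [act_stab] relate it to the action on words. *)
Fixpoint stab k g : Prop :=
  if k is k'.+1 then forall x, rt g x = x /\ stab k' (sec g x) else True.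

Lemma stab1 k : stab k 1.
Proof. by elim: k => //= k IHk x; rewrite sec1. Qed.

Lemma stabM k g h : stab k g -> stab k h -> stab k (g * h).
Proof.
elim: k g h => //= k IHk g h sg sh x; have [hx sh'] := sh x.
by rewrite rtM secM hx; have [gx sg'] := sg x; split=> //; apply: IHk.
Qed.

Lemma stabV k g : stab k g -> stab k g^-1.
Proof.
elim: k g => //= k IHk g sg x; have [gx sg'] := sg x.
by rewrite secV_fix // rtV_fix //; split=> //; apply: IHk.
Qed.

Lemma stab_subgroup k : subgroup (stab k : set (tree_aut X)).
Proof. by split; [apply: stab1 | apply: stabM | apply: stabV]. Qed.

Lemma stabJ k g h : stab k g -> stab k (g ^ h).
Proof.
elim: k g h => //= k IHk g h sg x; have [gx sg'] := sg (rt h x).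
by rewrite secJ // rtJ_fix //; split=> //; apply: IHk.
Qed.

Lemma stab_leq k l g : k <= l -> stab l g -> stab k g.
Proof.
elim: k l g => //= k IHk [|l] //= g kl sg x; have [gx /IHk] := sg x.
by split=> //; auto.
Qed.

Lemma stab_act k g w : stab k g -> size w <= k -> g w = w.
Proof.
elim: k g w => [|k IHk] g [|x w] //=; rewrite ?taut_nil // => sg wk.
by have [gx sg'] := sg x; rewrite tautE gx IHk.
Qed.

Lemma act_stab k g : (forall w, size w = k -> g w = w) -> inhabited X -> stab k g.
Proof.
move=> + [x0]; elim: k g => //= k IHk g gk x.
have gx v : size v = k -> rt g x :: sec g x v = x :: v.
  by move=> sv; rewrite -tautE gk //= sv.
split; first by have /gx[] : size (nseq k x0) = k by rewrite size_nseq.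
by apply: IHk => v /gx[].
Qed.

End Sections.

(** * Density modulo level stabilisers *)

Section LevelAction.
Variables (X : finType) (k : nat).
Implicit Types g h : tree_aut X.

Definition level_fun g (u : k.-tuple X) : k.-tuple X :=
  Tuple (introT eqP (etrans (size_taut g^-1 u) (size_tuple u))).

Fact level_fun_inj g : injective (level_fun g).
Proof.
by move=> u v /(congr1 val) /= /(can_inj (tautVK g^-1)) /val_inj.
Qed.

(* [perm] composes from left to right, so [g] acts through its inverse. *)
Definition level_perm g : {perm k.-tuple X} := perm (@level_fun_inj g).

Lemma level_permM : {morph level_perm : g h / g * h}.
Proof.
move=> g h; apply/perm.permP => u; rewrite permM !permE; exact: val_inj.
Qed.

Lemma level_perm1 : level_perm 1 = 1.
Proof. by apply: (@mulgI _ (level_perm 1)); rewrite -level_permM !mulg1. Qed.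

Lemma level_permV g : level_perm g^-1 = (level_perm g)^-1.
Proof. by apply: (@mulgI _ (level_perm g)); rewrite -level_permM !mulgV level_perm1. Qed.

Lemma level_permX g n : level_perm (g ^+ n) = level_perm g ^+ n.
Proof.
elim: n => [|n IHn]; first exact: level_perm1.
by rewrite !expgS level_permM IHn.
Qed.

Lemma level_permR g h : level_perm [~ g, h] = [~ level_perm g, level_perm h].
Proof. by rewrite /commg /conjg !level_permM !level_permV. Qed.

Lemma stab_level_perm g : stab k g -> level_perm g = 1.
Proof.
move=> sg; apply/perm.permP => u; rewrite permE perm1; apply: val_inj.
by apply: (stab_act (stabV sg)); rewrite size_tuple.
Qed.

Lemma level_perm_stab g : inhabited X -> level_perm g = 1 -> stab k g.
Proof.
move=> X0 g1; apply: act_stab => // w wk; rewrite -{1}(_ : g^-1 w = w) ?tautKV //.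
have /perm.permP/(_ (Tuple (introT eqP wk))) := g1.
by rewrite permE perm1 => /(congr1 val).
Qed.

Section Image.
Local Open Scope classical_set_scope.
Variable H : set (tree_aut X).
Hypothesis sH : subgroup H.

Definition level_image := finset (fun s : {perm k.-tuple X} => `[< exists2 g, H g & level_perm g = s >]).

Lemma level_imageP s : reflect (exists2 g, H g & level_perm g = s) (s \in level_image).
Proof. by rewrite finset.inE; apply: asboolP. Qed.

Fact level_image_group : group_set level_image.
Proof.
apply/group_setP; split.
  by apply/level_imageP; exists 1; [apply: subgroup1 | apply: level_perm1].
move=> s t /level_imageP[g Hg <-] /level_imageP[h Hh <-]; apply/level_imageP.
by exists (g * h); [apply: subgroupM | rewrite level_permM].
Qed.
End Image.
End LevelAction.

Local Open Scope classical_set_scope.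

Section Density.
Variables (X : finType) (p k0 : nat) (G : set (tree_aut X)).
Hypothesis p_pr : prime p.
Hypothesis X0 : inhabited X.
Hypothesis sG : subgroup G.
Hypothesis Gsec : forall g x, G g -> G (sec g x).
Hypothesis Gpow : forall g x, G g -> rt (g ^+ p) x = x.

Lemma stab_powp k g : G g -> stab k (g ^+ (p ^ k)).
Proof.
elim: k g => //= k IHk g Gg x; rewrite expnS expgnA.
have gx := Gpow x Gg.
split; first exact: rtX_fix.
by rewrite secX_fix //; apply: IHk; apply: Gsec; apply: subgroupX.
Qed.

(** By [stab_powp] the group [Q] induced on level [k] is a finite p-group, so its derived subgroup
    lies in its Frattini subgroup. The image of a dense [M] generates [Q] together with the derived
    subgroup, hence is [Q]. *)
Lemma dense_stab M k g : dense G M -> G g -> exists2 m, M m & stab k (m^-1 * g).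
Proof.
move=> [sM MG dM] Gg.
pose Q := fingroup.Group (level_image_group k sG); pose H := fingroup.Group (level_image_group k sM).
have HQ : (H \subset Q)%g.
  apply/fintype.subsetP => s /level_imageP[m Mm <-]; apply/level_imageP.
  by exists m => //; apply: MG.
have pQ : p.-group Q.
  rewrite -pnat_exponent; apply: (@pnat_dvd _ (p ^ k)).
    apply/exponentP => _ /level_imageP[h Gh <-]; rewrite -level_permX.
    by apply: stab_level_perm; apply: stab_powp.
  by rewrite pnatX pnat_id.
have dQ h : commsub G G h -> level_perm k h \in Q^`(1)%g.
  suff /(_ h) : commsub G G `<=` [set h | level_perm k h \in Q^`(1)%g] by [].
  apply: commsub_min => [|x y Gx Gy /=].
    split=> [|x y|x] /=; first by rewrite level_perm1 group1.
      by rewrite level_permM; apply: groupM.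
    by rewrite level_permV; apply: groupVr.
  rewrite level_permR; apply: mem_commg; apply/level_imageP.
    by exists x.
  by exists y.
have QE : 'Phi(Q) <*> H = Q.
  apply/eqP; rewrite finset.eqEsubset join_subG Phi_sub HQ /=.
  apply/fintype.subsetP => _ /level_imageP[h Gh <-].
  have [m Mm] := dM h Gh => /dQ mh.
  rewrite -[h](mulVKg m) level_permM groupM //.
    by apply: (fintype.subsetP (joing_subr _ _)); apply/level_imageP; exists m.
  apply: (fintype.subsetP (joing_subl _ _)); rewrite (Phi_joing pQ).
  exact: (fintype.subsetP (joing_subl _ _)).
have := Phi_nongen QE; rewrite genGid => HQe.
have /level_imageP[m Mm e] : level_perm k g \in (H : {set _}).
  by rewrite HQe; apply/level_imageP; exists g.
exists m => //; apply: level_perm_stab => //.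
by rewrite level_permM level_permV e mulVg.
Qed.

End Density.

(** * Sections of dense subgroups *)

Section Secs.
Variable X : eqType.
Implicit Types (G M N : set (tree_aut X)) (g h m : tree_aut X) (x y : X).

Definition secs M x : set (tree_aut X) :=
  [set h | exists m, [/\ M m, rt m x = x & sec m x = h]].

Lemma mem_secs M m x : M m -> rt m x = x -> secs M x (sec m x).
Proof. by move=> Mm mx; exists m. Qed.

Lemma secs_subgroup M x : subgroup M -> subgroup (secs M x).
Proof.
move=> sM; split.
- by exists 1; rewrite rt1 sec1; split=> //; apply: subgroup1.
- move=> _ _ [g [Mg gx <-]] [h [Mh hx <-]]; exists (g * h).
  by rewrite rtM secM hx; split=> //; apply: subgroupM.
- move=> _ [g [Mg gx <-]]; exists g^-1.
  by rewrite rtV_fix // secV_fix //; split=> //; apply: subgroupV.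
Qed.

Lemma secs_transport M w x h : subgroup M -> M w ->
  secs M x h -> secs M (rt w x) (h ^ (sec w x)^-1).
Proof.
move=> sM Mw [m [Mm mx <-]].
have wx : rt w^-1 (rt w x) = x by apply: rtVK.
have -> : sec m x ^ (sec w x)^-1 = sec (m ^ w^-1) (rt w x).
  by rewrite secJ wx // secV wx.
by apply: mem_secs; [apply: subgroupJ => //; apply: subgroupV | apply: rtJ_fix; rewrite wx].
Qed.

(** A path in the tree along which the iterated sections of [M] become everything; [reach_full]
    climbs back along it. *)
Inductive reach G : set (tree_aut X) -> Prop :=
| Reach0 M : G `<=` M -> reach G M
| ReachS M x : reach G (secs M x) -> reach G M.

(** The rigid stabiliser of [x] in [M], read as a group acting on the subtree below [x]. *)
Definition rigid M x : set (tree_aut X) := [set h | M (emb x h)].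

Lemma rigid_subgroup M x : subgroup M -> subgroup (rigid M x).
Proof.
move=> sM; split; rewrite /rigid /=; first by rewrite emb1; apply: subgroup1.
  by move=> g h; rewrite embM; apply: subgroupM.
by move=> g; rewrite embV; apply: subgroupV.
Qed.

Lemma rigidJ M x m h : subgroup M -> M m -> rt m x = x -> rigid M x h ->
  rigid M x (h ^ sec m x).
Proof. by move=> sM Mm mx; rewrite /rigid /= -embJ_fix // => Mh; apply: subgroupJ. Qed.

Fixpoint embw (u : seq X) g := if u is x :: u' then emb x (embw u' g) else g.

Lemma embw_cat u v g : embw (u ++ v) g = embw u (embw v g).
Proof. by elim: u => //= x u ->. Qed.

Lemma embwM u g h : embw u (g * h) = embw u g * embw u h.
Proof. by elim: u => //= x u ->; rewrite embM. Qed.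
Lemma embwV u g : embw u g^-1 = (embw u g)^-1.
Proof. by elim: u => //= x u ->; rewrite embV. Qed.
Lemma embw1 u : embw u (1 : tree_aut X) = 1.
Proof. by elim: u => //= x u ->; rewrite emb1. Qed.
Lemma embwR u g h : embw u [~ g, h] = [~ embw u g, embw u h].
Proof. by rewrite /commg /conjg !embwM !embwV. Qed.

Lemma rigidw_subgroup N u : subgroup N -> subgroup [set g | N (embw u g)].
Proof.
move=> sN; split=> /= [|g h|g]; first by rewrite embw1; apply: subgroup1.
  by rewrite embwM; apply: subgroupM.
by rewrite embwV; apply: subgroupV.
Qed.

(** When [emb] preserves [C], this passes to all deeper levels, so that levels obtained separately
    can be replaced by their maximum. *)
Definition contains_level (C : set (tree_aut X)) n N :=
  forall u c, size u = n -> C c -> N (embw u c).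

Lemma contains_levelS C n N : (forall x c, C c -> C (emb x c)) ->
  contains_level C n N -> contains_level C n.+1 N.
Proof.
move=> Ce CN u c; case/lastP: u => // u x; rewrite size_rcons => -[un] Cc.
by rewrite -cats1 embw_cat; apply: CN => //; apply: Ce.
Qed.

Lemma contains_level_leq C k n N : (forall x c, C c -> C (emb x c)) -> k <= n ->
  contains_level C k N -> contains_level C n N.
Proof.
move=> Ce /subnK <-; elim: (n - k) => // i IHi /IHi.
by rewrite addSn; apply: contains_levelS.
Qed.

End Secs.

(** * Dense subgroups of self-replicating branch groups *)

Section Branching.
Variables (X : finType) (p k0 : nat) (G : set (tree_aut X)).
Hypothesis p_pr : prime p.
Hypothesis X0 : inhabited X.
Hypothesis sG : subgroup G.
Hypothesis Gsec : forall g x, G g -> G (sec g x).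
Hypothesis Gpow : forall g x, G g -> rt (g ^+ p) x = x.
Hypothesis Glift : forall g x, G g -> exists2 h, G h & stab 1 h /\ sec h x = g.
Hypothesis Gfree : forall g x, G g -> rt g x = x -> stab 1 g.
Hypothesis Gtrans : forall x y, exists2 g, G g & rt g x = y.
Hypothesis Gstab : forall g, G g -> stab k0 g -> commsub G G g.
Implicit Types M N : set (tree_aut X).

Let dstab := dense_stab p_pr X0 sG Gsec Gpow.

Lemma stab_rt1 (g : tree_aut X) x : stab 1 g -> rt g x = x.
Proof. by move/(_ x); case. Qed.

Lemma dense_approx M g : dense G M -> G g ->
  exists2 m, M m & (forall x, rt m x = rt g x) /\
    (forall x, commsub G G ((sec m x)^-1 * sec g x)).
Proof.
move=> dM Gg; have [_ MG _] := dM.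
(* Level [k0.+1], so that the sections agree modulo the stabiliser of level [k0], to which [Gstab]
   applies. *)
have [m Mm mg] := dstab k0.+1 dM Gg; exists m => //.
have mx x : rt m x = rt g x.
  by have [] := mg x; rewrite rtM => /(congr1 (rt m)); rewrite rtKV.
split=> // x; have [_] := mg x.
rewrite secM secV -mx rtVK.
by apply: Gstab; apply: subgroupM => //; [apply: subgroupV => //; apply: Gsec; apply: MG | apply: Gsec].
Qed.

Lemma dense_secs M x : dense G M -> dense G (secs M x).
Proof.
move=> dM; have [sM MG _] := dM; split; first exact: secs_subgroup.
  by move=> _ [m [Mm _ <-]]; apply: Gsec; apply: MG.
move=> g /(Glift x)[h Gh [h1 <-]].
have [m Mm [mh ms]] := dense_approx dM Gh; exists (sec m x) => //.
by apply: mem_secs => //; rewrite mh stab_rt1.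
Qed.

Lemma dense_trans M x y : dense G M -> exists2 m, M m & rt m x = y.
Proof.
move=> dM; have [g Gg <-] := Gtrans x y.
by have [m Mm [mh _]] := dense_approx dM Gg; exists m.
Qed.

Lemma secs_full M x y : dense G M -> G `<=` secs M x -> G `<=` secs M y.
Proof.
move=> dM fM h Gh; have [sM MG _] := dM; have [w Mw <-] := dense_trans x y dM.
rewrite -[h](conjgK (sec w x)); apply: secs_transport => //; apply: fM.
by apply: subgroupJ => //; apply: Gsec; apply: MG.
Qed.

Lemma rigid_normal M x : dense G M -> G `<=` secs M x -> normal_in G (rigid M x).
Proof.
move=> dM fM; have [sM MG _] := dM; split; first exact: rigid_subgroup.
  by move=> h /MG Gh; rewrite -[h](sec_embE x); apply: Gsec.
by move=> h _ Rh /fM[m [Mm mx <-]]; apply: rigidJ.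
Qed.

Lemma rigid_G_normal N x : normal_in G N -> normal_in G (rigid N x).
Proof.
move=> [sN NG nN]; split; first exact: rigid_subgroup.
  by move=> h /NG Gh; rewrite -[h](sec_embE x); apply: Gsec.
move=> h g Nh /(Glift x)[k Gk [k1 <-]].
by rewrite /rigid /= -embJ_fix ?stab_rt1 //; apply: nN.
Qed.

(* Goursat: a section lying in the commutator subgroup can be corrected to 1
   by a product of commutators of elements of [M]. *)
Lemma dense_kill M g x : dense G M -> G `<=` secs M x -> G g -> stab 1 g -> sec g x = 1 ->
  exists m, [/\ M m, stab 1 m, sec m x = 1 &
    forall y, commsub G G ((sec m y)^-1 * sec g y)].
Proof.
move=> dM fM Gg g1 gx; have [sM MG _] := dM.
have [m Mm [mg ms]] := dense_approx dM Gg.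
have m1 y : rt m y = y by rewrite mg stab_rt1.
(* [n] is built from commutators of elements of [M]: it has the same section at [x] as [m], and its
   other sections are trivial modulo the commutator subgroup, so [m * n^-1] is the desired
   element. *)
have [n [Mn n1 nx ny]] : exists n, [/\ M n, (forall y, rt n y = y),
    sec n x = sec m x & forall y, commsub G G (sec n y)].
  have : commsub G G (sec m x).
    have := subgroupV (commsub_subgroup G G) (ms x).
    by rewrite gx mulg1 invgK.
  suff : commsub G G `<=` [set h | exists n, [/\ M n, (forall y, rt n y = y),
    sec n x = h & forall y, commsub G G (sec n y)]] by apply.
  have sC := commsub_subgroup G G.
  apply: commsub_min => [|h k Gh Gk].
    split.
    - by exists 1; split=> //; [apply: subgroup1 | apply: sec1 | move=> y; rewrite sec1; apply: subgroup1].
    - move=> _ _ [h [Mh h1 <- hy]] [k [Mk k1 <- ky]]; exists (h * k).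
      split=> [||| y]; rewrite ?secM ?k1 //; first exact: subgroupM.
        by move=> y; rewrite rtM k1 h1.
      exact: (subgroupM sC).
    - move=> _ [h [Mh h1 <- hy]]; exists h^-1.
      split=> [|y|| y]; rewrite ?secV_fix //; first exact: subgroupV.
        by rewrite rtV_fix.
      exact: (subgroupV sC).
  have [m' [Mm' m'x e]] := fM _ Gh; have [n' [Mn' n'x e']] := fM _ Gk.
  have m'1 := Gfree (MG _ Mm') m'x; have n'1 := Gfree (MG _ Mn') n'x.
  have s1 := stab_subgroup X 1.
  exists [~ m', n']; split; first exact: subgroupR.
  - by move=> y; apply: stab_rt1; exact: (subgroupR s1).
  - by rewrite secR_fix ?stab_rt1 // e e'.
  - by move=> y; rewrite secR_fix ?stab_rt1 //; apply: mem_commsub; apply: Gsec; apply: MG.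
exists (m * n^-1); split.
- by apply: subgroupM => //; apply: subgroupV.
- by move=> y; rewrite rtM rtV_fix // m1; split.
- by rewrite secM secV_fix // rtV_fix // nx mulgV.
move=> y; rewrite secM secV_fix // rtV_fix // invgM invgK -mulgA.
exact: (subgroupM (commsub_subgroup G G)).
Qed.

Lemma stab1_prod g (s : seq X) : uniq s ->
  forall y, rt (\prod_(x <- s) emb x (sec g x)) y = y /\
  sec (\prod_(x <- s) emb x (sec g x)) y = if y \in s then sec g y else 1.
Proof.
elim: s => [|x s IHs] /=; first by move=> _ y; rewrite big_nil sec1.
case/andP=> xs /IHs{}IHs y; have [IH1 IH2] := IHs y.
rewrite big_cons rtM secM rt_emb IH1 IH2 sec_emb inE; split=> //.
by case: eqP => [->|_] /=; rewrite ?(negPf xs) ?mulg1 ?mul1g.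
Qed.

Lemma stab1_emb g : stab 1 g -> g = \prod_(x <- enum X) emb x (sec g x).
Proof.
move=> g1; have e := stab1_prod g (enum_uniq X).
apply: tree_aut_eq => y; have [e1 e2] := e y; first by rewrite e1 stab_rt1.
by rewrite e2 mem_enum.
Qed.

Lemma emb_all N g : subgroup N -> stab 1 g -> (forall x, N (emb x (sec g x))) -> N g.
Proof.
move=> sN g1 Ne; rewrite (stab1_emb g1).
elim: (enum X) => [|x s IHs]; first by rewrite big_nil; apply: subgroup1.
by rewrite big_cons; apply: subgroupM.
Qed.

Variables (C : set (tree_aut X)) (k1 : nat).
Hypothesis Cstab : forall g, G g -> stab k1 g -> C g.
Hypothesis Cemb : forall x c, C c -> C (emb x c).

(** An element fixing level [n + k1] splits into its sections at level [n]; these fix level [k1],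
    hence lie in [C]. *)
Lemma contains_level_stab n N g : subgroup N -> contains_level C n N ->
  G g -> stab (n + k1) g -> N g.
Proof.
elim: n N g => [|n IHn] N g sN CN Gg gn; first by apply: (CN [::]) => //; apply: Cstab.
apply: emb_all => // [x|x]; first by have [] := gn x.
apply: (IHn (rigid N x)); [exact: rigid_subgroup| |exact: Gsec|by have [] := gn x].
by move=> u c un Cc; apply: (CN (x :: u)) => //=; rewrite un.
Qed.

Lemma dense_full M : dense G M ->
  (forall x, exists n, contains_level C n (rigid M x)) -> G `<=` M.
Proof.
move=> dM /choice[n Cn] g Gg; have [sM MG _] := dM.
pose N := (\max_x n x)%N.
have [m Mm mg] := dstab (N.+1 + k1) dM Gg.
rewrite -[g](mulVKg m); apply: subgroupM => //.
apply: (@contains_level_stab N.+1) => //; last first.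
  by apply: subgroupM => //; apply: subgroupV => //; apply: MG.
move=> [|x u] //= c [un] Cc; apply: (contains_level_leq Cemb _ (Cn x) un Cc).
exact: leq_bigmax.
Qed.

Lemma reach_full M :
  (forall M' x, dense G M' -> G `<=` secs M' x -> G `<=` M') ->
  dense G M -> reach G M -> G `<=` M.
Proof.
move=> stepG dM r; elim: r dM => // {}M x _ IHr dM.
by apply: (stepG M x) => //; apply: IHr; apply: dense_secs.
Qed.

End Branching.

(** * Word length of sections *)

Section Spinal.
Variables (X : finType) (A B : set (tree_aut X)) (o : X).
Hypotheses (sA : subgroup A) (sB : subgroup B).
Hypothesis Asec : forall a x, A a -> sec a x = 1.
Hypothesis Bfix : forall b x, B b -> rt b x = x.
Hypothesis BsecA : forall b x, B b -> x != o -> A (sec b x).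
Hypothesis BsecB : forall b, B b -> B (sec b o).
Implicit Types (g h a b : tree_aut X) (x : X) (m n : nat).

(** Products a_0 b_1 a_1 ... b_m a_m with a_i in [A] and b_i in [B]. Letters of [A] are free because
    their sections are trivial; b_i may be 1, so the balls increase with [m]. *)
Inductive ball : nat -> tree_aut X -> Prop :=
| Ball0 a : A a -> ball 0 a
| BallS m g b a : ball m g -> B b -> A a -> ball m.+1 (g * b * a).

Lemma ballMA m g a : ball m g -> A a -> ball m (g * a).
Proof.
case=> [a' Aa'|{}m {}g b a' bg Bb Aa'] Aa.
  by apply: Ball0; apply: subgroupM.
by rewrite -mulgA; apply: BallS => //; apply: subgroupM.
Qed.

Lemma ballMB m g b : ball m g -> B b -> ball m.+1 (g * b).
Proof. by move=> bg Bb; rewrite -[g * b]mulg1; apply: BallS => //; apply: subgroup1. Qed.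

Lemma ballM m n g h : ball m g -> ball n h -> ball (m + n) (g * h).
Proof.
move=> bg; elim=> [a Aa|{}n {}h b a _ IHh Bb Aa].
  by rewrite addn0; apply: ballMA.
by rewrite addnS !mulgA; apply: BallS.
Qed.

Lemma ball1 : ball 0 1. Proof. by apply: Ball0; apply: subgroup1. Qed.

Lemma ballB b : B b -> ball 1 b.
Proof. by move=> Bb; rewrite -[b]mul1g; apply: ballMB => //; apply: ball1. Qed.

Lemma ballSn m g : ball m g -> ball m.+1 g.
Proof. by move=> bg; rewrite -[g]mulg1; apply: ballMB => //; apply: subgroup1. Qed.

Lemma ball_leq m n g : m <= n -> ball m g -> ball n g.
Proof. by move=> /subnK <- bg; elim: (n - m) => // i; rewrite addSn; apply: ballSn. Qed.

Lemma ballV m g : ball m g -> ball m g^-1.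
Proof.
elim=> [a Aa|{}m {}g b a _ IHg Bb Aa]; first by apply: Ball0; apply: subgroupV.
rewrite !invgM mulgA -add1n; apply: ballM => //; rewrite -(add0n 1%N).
by apply: ballM; [apply: Ball0; apply: subgroupV | apply: ballB; apply: subgroupV].
Qed.

Lemma ball_generated S g : S `<=` [set s | A s \/ B s] -> generated S g ->
  exists m, ball m g.
Proof.
move=> SAB Sg; suff /(_ g Sg) : generated S `<=` [set g | exists m, ball m g] by [].
apply: generated_min => [|s /SAB[As|Bs]]; last 2 first.
- by exists 0; apply: Ball0.
- by exists 1%N; apply: ballB.
split=> /=; first by exists 0; apply: ball1.
  by move=> x y [m bx] [n by_]; exists (m + n)%N; apply: ballM.
by move=> x [m bx]; exists m; apply: ballV.
Qed.

Lemma ball_sub G m g : subgroup G -> A `<=` G -> B `<=` G -> ball m g -> G g.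
Proof.
move=> sG AG BG; elim=> [a /AG //|{}m {}g b a _ Gg /BG Gb /AG Ga].
by apply: subgroupM => //; apply: subgroupM.
Qed.

Lemma ball_secB b x : B b -> ball 1 (sec b x).
Proof.
move=> Bb; have [->|xo] := eqVneq x o; first by apply: ballB; apply: BsecB.
by apply: ballSn; apply: Ball0; apply: BsecA.
Qed.

Lemma secAM g a x : A a -> sec (g * a) x = sec g (rt a x).
Proof. by move=> Aa; rewrite secM (Asec _ Aa) mulg1. Qed.

(* Two letters of [B] separated by a nontrivial element of [A] contribute to
   different sections, so at most one syllable survives in each section. *)
Lemma ball_sec_double m g x : ball m.*2 g -> ball m (sec g x).
Proof.
elim: m g x => [|m IHm] g x.
  move E: (0.*2) => n bg; case: bg E => // a Aa _.
  by rewrite Asec //; apply: ball1.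
rewrite doubleS; move E: (_.+2) => n bg.
case: bg E => // {}n {}g b a bg Bb Aa [E].
case: bg E => // {}n {}g b' a' bg Bb' Aa' [E].
rewrite secAM // secM (Bfix _ Bb) secAM // secM (Bfix _ Bb').
set y := rt a x; set z := rt a' y; rewrite -mulgA -(addn1 m).
apply: ballM; first by apply: IHm; rewrite E.
have [yo|yo] := eqVneq y o; last first.
  by rewrite -(addn0 1%N); apply: ballM; [apply: ball_secB | apply: Ball0; apply: BsecA].
have [zo|zo] := eqVneq z o; last first.
  by rewrite -(add0n 1%N); apply: ballM; [apply: Ball0; apply: BsecA | apply: ball_secB].
by rewrite yo zo; apply: ballB; apply: subgroupM => //; apply: BsecB.
Qed.

Lemma ball_sec_half m g x : ball m g -> ball (uphalf m) (sec g x).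
Proof.
move=> bg; apply: ball_sec_double; apply: ball_leq bg.
by rewrite uphalf_half doubleD -{1}(odd_double_half m) leq_add2r; case: odd.
Qed.

(** Only the section at [o] of a letter of [B] costs a letter of [B], the others being in [A]; each
    letter is thus charged to a single section. *)
Lemma ball_sec_sum m g : ball m g -> exists n : X -> nat,
  (\sum_x n x <= m)%N /\ forall x, ball (n x) (sec g x).
Proof.
elim=> [a Aa|{}m {}g b a _ [n [nm bn]] Bb Aa].
  exists (fun=> 0); split=> [|x]; first by rewrite big1.
  by rewrite Asec //; apply: ball1.
pose s x : nat := x == o.
exists (fun x => n (rt a x) + s (rt a x)); split=> [|x]; last first.
  rewrite secAM // secM (Bfix _ Bb); apply: ballM => //.
  rewrite /s; case: eqVneq => [->|xo]; first by apply: ballB; apply: BsecB.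
  by apply: Ball0; apply: BsecA.
have <- := reindex_inj (F := fun x => (n x + s x)%N) (P := xpredT) (can_inj (rtVK a)).
rewrite big_split /= -addn1 leq_add // (bigD1 o) //= /s eqxx big1 ?addn0 //.
by move=> x /negPf->.
Qed.

(** The section of [g ^+ k] is a product of sections of [g] along the orbit of [x]. As these sit at
    distinct letters, [ball_sec_sum] bounds their total length. *)
Lemma ball_secX m g k x : ball m g -> {in iota 0 k &, injective (fun i => rt (g ^+ i) x)} ->
  ball m (sec (g ^+ k) x).
Proof.
move=> /ball_sec_sum[n [nm bn]] inj.
apply: (@ball_leq (\sum_(i <- iota 0 k) n (rt (g ^+ i) x))%N).
  apply: leq_trans nm; rewrite -(big_map (fun i => rt (g ^+ i) x) xpredT n).
  have u : uniq [seq rt (g ^+ i) x | i <- iota 0 k] by rewrite map_inj_in_uniq ?iota_uniq.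
  rewrite big_uniq //= [leqRHS](bigID [in [seq rt (g ^+ i) x | i <- iota 0 k]]) /=.
  exact: leq_addr.
elim: k {inj} => [|k IHk]; first by rewrite big_nil sec1; apply: ball1.
rewrite -[k.+1]addn1 iotaD big_cat big_seq1 add0n addn1 expgS secM [X in ball X]addnC.
exact: ballM.
Qed.

End Spinal.

Lemma ltn_uphalf m : 1 < m -> uphalf m < m.
Proof.
by case: m => [|[|m]] // _; rewrite ltnS leq_uphalf_double doubleS !ltnS -addnn leq_addr.
Qed.

(** * Nielsen moves *)

Section NielsenMoves.
Variables (gT : groupType) (n : nat).
Implicit Types (x y : {ffun 'I_n -> gT}) (i j : 'I_n) (g h : gT).

Lemma set_entryE x i g k : set_entry x i g k = if k == i then g else x k.
Proof. by rewrite ffunE. Qed.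

Lemma set_entryK x i : set_entry x i (x i) = x.
Proof. by apply/ffunP => k; rewrite ffunE; case: eqP => [->|]. Qed.

Lemma set_entry2 x i g h : set_entry (set_entry x i g) i h = set_entry x i h.
Proof. by apply/ffunP => k; rewrite !ffunE; case: eqP. Qed.

Lemma range_sub x y : (forall i, generated (range x) (y i)) ->
  generated (range y) `<=` generated (range x).
Proof.
by move=> xy; apply: generated_min => [|_ [i _ <-] //]; apply: generated_subgroup.
Qed.

Lemma nielsen_move_sub x y : nielsen_move x y ->
  generated (range y) `<=` generated (range x).
Proof.
have sx := generated_subgroup (range x).
have gx k : generated (range x) (x k) by apply: sub_generated; exists k.
case=> [i j _|i j _|i j _|i j _|j]; apply: range_sub => k; rewrite ffunE;
  case: eqP => // _.
- exact: (subgroupM sx).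
- exact: (subgroupM sx _ (subgroupV sx _)).
- exact: (subgroupM sx).
- exact: (subgroupM sx (subgroupV sx _)).
- exact: (subgroupV sx).
Qed.

Lemma nielsen_move_sym x y : nielsen_move x y -> nielsen_move y x.
Proof.
case=> [i j ji|i j ji|i j ji|i j ji|j].
- have := NielsenMulRV (set_entry x i (x i * x j)) ji.
  by rewrite set_entry2 !set_entryE eqxx (negPf ji) mulgK set_entryK.
- have := NielsenMulR (set_entry x i (x i * (x j)^-1)) ji.
  by rewrite set_entry2 !set_entryE eqxx (negPf ji) mulgVK set_entryK.
- have := NielsenMulLV (set_entry x i (x j * x i)) ji.
  by rewrite set_entry2 !set_entryE eqxx (negPf ji) mulKg set_entryK.
- have := NielsenMulL (set_entry x i ((x j)^-1 * x i)) ji.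
  by rewrite set_entry2 !set_entryE eqxx (negPf ji) mulVKg set_entryK.
- have := NielsenInv (set_entry x j (x j)^-1) j.
  by rewrite set_entry2 !set_entryE eqxx invgK set_entryK.
Qed.

Definition nielsen_conn x y := clos_refl_trans _ (@nielsen_move gT n) x y.

Lemma nielsen_conn_sym x y : nielsen_conn x y -> nielsen_conn y x.
Proof.
elim=> [{}x {}y /nielsen_move_sym|{}x|{}x z {}y _ IH1 _ IH2].
- exact: rt_step.
- exact: rt_refl.
- exact: rt_trans IH2 IH1.
Qed.

Lemma nielsen_conn_generated x y : nielsen_conn x y ->
  generated (range x) = generated (range y).
Proof.
elim=> [{}x {}y xy|//|{}x z {}y _ -> _ -> //].
by apply/seteqP; split; apply: nielsen_move_sub => //; apply: nielsen_move_sym.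
Qed.

Definition others x i : set gT := generated [set g | exists2 j, j != i & x j = g].

(** The multipliers that moves can realise at entry [i] form a subgroup, inverses coming from the
    reversibility of moves. *)
Lemma nielsen_conn_others x i g h : others x i h ->
  nielsen_conn (set_entry x i g) (set_entry x i (g * h)).
Proof.
move=> oh; move: g; suff S : others x i `<=`
  [set h | forall g, nielsen_conn (set_entry x i g) (set_entry x i (g * h))] by move=> g; apply: S.
apply: generated_min => [|_ [j ji <-] g /=].
  split=> /= [g|k l IHk IHl g|k IHk g].
  - by rewrite mulg1; apply: rt_refl.
  - by rewrite mulgA; exact: rt_trans (IHk g) (IHl _).
  - by apply: nielsen_conn_sym; rewrite -{2}[g](mulgVK k).
apply: rt_step; have := NielsenMulR (set_entry x i g) ji.
by rewrite set_entry2 !set_entryE eqxx (negPf ji).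
Qed.

Lemma nielsen_conn_replace x i g : others x i ((x i)^-1 * g) ->
  nielsen_conn x (set_entry x i g).
Proof. by move/(nielsen_conn_others (x i)); rewrite set_entryK mulVKg. Qed.

Lemma nielsen_conn_edge (G : set gT) (u v : nielsen_vertex n G) :
  nielsen_conn (sval u) (sval v) -> clos_refl_trans _ (nielsen_edge n G) u v.
Proof.
case: u v => x gx [y gy] /=.
move=> xy; have {}xy := clos_rt_rt1n _ _ _ _ xy; elim: xy gx gy => [{}x|{}x z {}y xz _ IHz] gx gy.
  by rewrite (Prop_irrelevance gx gy); apply: rt_refl.
have gz : generated (range z) = G.
  by rewrite -gx; symmetry; apply: nielsen_conn_generated; apply: rt_step.
by apply: rt_trans (IHz gz gy); apply: rt_step; left.
Qed.

End NielsenMoves.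

(** * From the Frattini property to connectedness *)

Section Frattini.
Import GRing.Theory.
Variables (gT : groupType) (G : set gT) (p d n : nat) (s : 'I_d -> gT).
Hypothesis p_pr : prime p.
Hypothesis sG : subgroup G.
Hypothesis Gs : G = generated (range s).
Hypothesis s_p : forall l, s l ^+ p = 1.
Hypothesis frattini : forall M, dense G M -> G `<=` M.
Hypothesis dn : d < n.
Implicit Types (x y : {ffun 'I_n -> gT}).

Let C := commsub G G.
Let nC : normal_in G C. Proof. by apply: commsub_normal => //; apply: normal_refl. Qed.
Let sC : subgroup C. Proof. by case: nC. Qed.
Let CG : C `<=` G. Proof. by case: nC. Qed.

Definition congC (g h : gT) := C (g^-1 * h).

Let congC_refl g : congC g g.
Proof. by rewrite /congC mulVg; apply: subgroup1. Qed.

Let congC_sym g h : congC g h -> congC h g.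
Proof. by move=> /(subgroupV sC); rewrite invgM invgK. Qed.

Let congC_trans h g k : congC g h -> congC h k -> congC g k.
Proof. by move=> gh hk; have := subgroupM sC gh hk; rewrite mulgA mulgK. Qed.

Let congCM g h g' h' : G g' -> congC g h -> congC g' h' -> congC (g * g') (h * h').
Proof.
move=> Gg' gh gh'; have [_ _ /(_ _ _ gh Gg')/(subgroupM sC)/(_ gh')] := nC.
by rewrite /congC /conjg invgM !mulgA mulgK.
Qed.

Let congCC g h : G g -> G h -> congC (g * h) (h * g).
Proof.
move=> Gg Gh; rewrite /congC invgM -mulgA (mulgA g^-1).
have -> : h^-1 * (g^-1 * h * g) = [~ h, g] by rewrite /commg /conjg !mulgA.
exact: mem_commsub.
Qed.

Let Gsl l : G (s l). Proof. by rewrite Gs; apply: sub_generated; exists l. Qed.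

Definition expvec (a : 'rV['F_p]_d) : gT := \prod_(l < d) s l ^+ (a ord0 l : nat).

Let G_expvec a : G (expvec a).
Proof. by apply: big_ind => [|g h|l _]; [exact: subgroup1|exact: subgroupM|exact: subgroupX]. Qed.

Let s_mod l m : s l ^+ (m %% p) = s l ^+ m.
Proof.
by rewrite [in RHS](divn_eq m p) expgnDr mulnC expgnA s_p expg1n mul1g.
Qed.

Let Fp_valD (a b : 'F_p) : ((a + b)%R : nat) = (a + b) %% p.
Proof. exact: congr2 (erefl (a + b)%N) (Fp_cast p_pr). Qed.

Let expvecD a b : congC (expvec a * expvec b) (expvec (a + b)%R).
Proof.
rewrite /expvec; elim: (index_enum 'I_d) => [|l r IHr].
  by rewrite !big_nil mulg1.
rewrite !big_cons mxE Fp_valD s_mod expgnDr; set A := \prod_(j <- r) _; set B := \prod_(j <- r) _.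
have GA : G A by apply: big_ind => [|g h|i _]; [exact: subgroup1|exact: subgroupM|exact: subgroupX].
have GB : G B by apply: big_ind => [|g h|i _]; [exact: subgroup1|exact: subgroupM|exact: subgroupX].
have Gl k : G (s l ^+ k) by apply: subgroupX.
apply: (@congC_trans (s l ^+ a ord0 l * s l ^+ b ord0 l * (A * B))); last first.
  by apply: congCM IHr => //; apply: subgroupM.
move: (s l ^+ a ord0 l) (s l ^+ b ord0 l) (Gl (a ord0 l)) (Gl (b ord0 l)) => u v Gu Gv.
have -> : u * A * (v * B) = u * ((A * v) * B) by rewrite !mulgA.
have -> : u * v * (A * B) = u * ((v * A) * B) by rewrite !mulgA.
apply: congCM => //; first by apply: subgroupM => //; apply: subgroupM.
by apply: congCM => //; apply: congCC.
Qed.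

Let expvec0 : expvec 0%R = 1.
Proof. by rewrite /expvec big1 // => l _; rewrite mxE. Qed.

Lemma expvec_delta l : expvec (delta_mx ord0 l) = s l.
Proof.
rewrite /expvec; elim: (index_enum 'I_d) (mem_index_enum l) (index_enum_uniq 'I_d) => //= i r IHr.
rewrite big_cons mxE eqxx /= inE => /orP[/eqP <-|lr] /andP[ir ur].
  rewrite eqxx big1_seq => [|j /andP[_ jr]]; first by rewrite mulg1.
  by rewrite mxE eqxx /=; case: eqP => // jl; rewrite -jl jr in ir.
rewrite IHr //; case: eqP => [il|_]; last by rewrite mul1g.
by rewrite il lr in ir.
Qed.

Lemma expvec_surj g : G g -> exists a, congC (expvec a) g.
Proof.
move=> Gg; suff S : G `<=` [set g | exists a, congC (expvec a) g] by apply: S.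
rewrite [X in X `<=` _]Gs; apply: generated_min => [|_ [l _ <-]]; last first.
  by exists (delta_mx ord0 l); rewrite expvec_delta.
split=> /=; first by exists 0%R; rewrite expvec0.
  move=> x y [a ax] [b by_]; exists (a + b)%R.
  apply: congC_trans (congCM _ ax by_) => //.
  by apply: congC_sym; apply: expvecD.
move=> x [a ax]; exists (- a)%R.
have e : congC (expvec (- a) * expvec a) 1 by have := expvecD (- a) a; rewrite addNr expvec0.
have Gx : G x^-1.
  apply: subgroupV => //; rewrite -[x](mulVKg (expvec a)).
  by apply: subgroupM => //; apply: CG.
have h1 : congC (expvec (- a) * expvec a * x^-1) (1 * x^-1) by apply: congCM.
have h2 : congC (expvec (- a) * (expvec a * x^-1)) (expvec (- a) * (x * x^-1)).
  by apply: congCM => //; [apply: subgroupM | apply: congCM].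
rewrite mulgV mulg1 mulgA in h2; rewrite mul1g in h1.
exact: congC_trans (congC_sym h2) h1.
Qed.

(** Modulo [C], [g] is [expvec a] for some [a], and the homomorphisms [e], dual to the generators,
    read off the coordinates of [a]. This is the test for membership in the commutator subgroup used
    for both groups. *)
Lemma comm_of_trivial (e : 'I_d -> gT -> 'F_p) g :
  (forall l (u v : gT), G u -> G v -> e l (u * v) = (e l u + e l v)%R) ->
  (forall l m, e l (s m) = ((l == m)%:R : 'F_p)%R) ->
  G g -> (forall l, e l g = 0%R) -> commsub G G g.
Proof.
move=> eM es Gg eg; have [a ag] := expvec_surj Gg.
have e1 l : e l 1 = 0%R.
  by apply: (addrI (e l 1)); rewrite addr0 -eM ?mulg1 //; apply: subgroup1.
have eV l (x : gT) : G x -> e l x^-1 = (- e l x)%R.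
  move=> Gx; apply/eqP; rewrite -addr_eq0 -eM ?mulVg ?e1 //; exact: subgroupV.
have eX l (x : gT) n' : G x -> e l (x ^+ n') = (e l x *+ n')%R.
  move=> Gx; elim: n' => [|n' IHn]; first by rewrite e1.
  by rewrite expgS eM ?IHn ?mulrS //; apply: subgroupX.
have eC l (x : gT) : C x -> e l x = 0%R.
  move=> Cx; suff S : C `<=` [set x | G x /\ e l x = 0%R] by have [] := S _ Cx.
  apply: commsub_min => [|x' y Gx Gy].
    split=> /=; first by split; [exact: subgroup1 | exact: e1].
      by move=> u v [Gu eu] [Gv ev]; rewrite eM // eu ev addr0; split=> //; apply: subgroupM.
    by move=> u [Gu eu]; rewrite eV // eu oppr0; split=> //; apply: subgroupV.
  split; first exact: subgroupR.
  have GV (z : gT) : G z -> G z^-1 by apply: subgroupV.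
  have GM (z t : gT) : G z -> G t -> G (z * t) by apply: subgroupM.
  by rewrite /commg /conjg !eM ?eV; auto; rewrite (addrC (e l x')) addKr addNr.
have a0 : a = 0%R.
  apply/rowP => l; rewrite mxE -[RHS](eg l) -[g](mulVKg (expvec a)) eM //; last exact: CG.
  rewrite (eC _ _ ag) addr0 /expvec.
  have -> : e l (\prod_(m < d) s m ^+ a ord0 m) = (\sum_(m < d) ((l == m)%:R : 'F_p) *+ a ord0 m)%R.
    suff H r : G (\prod_(m <- r) s m ^+ a ord0 m) /\ e l (\prod_(m <- r) s m ^+ a ord0 m) =
       (\sum_(m <- r) ((l == m)%:R : 'F_p) *+ a ord0 m)%R by have [] := H (index_enum 'I_d).
    elim: r => [|m r [Gr IHr]]; first by rewrite !big_nil; split; [exact: subgroup1 | exact: e1].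
    have Gm : G (s m ^+ a ord0 m) by apply: subgroupX.
    by rewrite !big_cons; split; [exact: subgroupM | rewrite eM // eX // es IHr].
  rewrite (bigD1 l) //= eqxx big1 ?addr0 ?natr_Zp // => m ml.
  by rewrite eq_sym (negPf ml) mul0rn.
by move: ag; rewrite a0 expvec0 /congC invg1 mul1g.
Qed.

(* Since [d < n], the exponent vectors of the [n] entries satisfy a linear
   relation; it involves an entry beyond the first [k] ones, whose exponent
   vectors are linearly independent, and this entry is redundant modulo [C]. *)
Lemma redundant_entry x k : generated (range x) = G -> (k <= d)%N ->
  (forall (i : 'I_n) (l : 'I_d), i < k -> i = l :> nat -> x i = s l) ->
  exists2 j : 'I_n, k <= j & forall g, G g -> others x j g.
Proof.
move=> gx kd xs.
have Gxi i : G (x i) by rewrite -gx; apply: sub_generated; exists i.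
pose good (i : 'I_n) (a : 'rV['F_p]_d) := congC (expvec a) (x i) /\
  forall l : 'I_d, i < k -> i = l :> nat -> a = delta_mx ord0 l.
have /choice[A HA] : forall i, exists a, good i a.
  move=> i; case: (ltnP i k) => ik.
    have id : i < d by apply: leq_trans kd.
    exists (delta_mx ord0 (Ordinal id)); split=> [|l _ il].
      by rewrite expvec_delta -(xs i (Ordinal id)) //.
    by congr delta_mx; apply: val_inj.
  by have [a ax] := expvec_surj (Gxi i); exists a; split=> // l; rewrite ltnNge ik.
have HA1 i : congC (expvec (A i)) (x i) by case: (HA i).
have HA2 (i : 'I_n) (l : 'I_d) : i < k -> i = l :> nat -> A i = delta_mx ord0 l by case: (HA i) => _; apply.
pose M := (\matrix_(i < n) A i)%R.
have : kermx M != 0%R.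
  rewrite -mxrank_eq0 mxrank_ker subn_eq0 -ltnNge.
  exact: leq_ltn_trans (rank_leq_col M) dn.
case/rowV0Pn => c /sub_kermxP cM c0.
have [j kj cj] : exists2 j : 'I_n, k <= j & c ord0 j != 0%R.
  apply: contrapT => no; case/eqP: c0; apply/rowP => i; rewrite [RHS]mxE.
  have c0j (j : 'I_n) : k <= j -> c ord0 j = 0%R.
    by move=> kj; apply/eqP; apply: contrapT => /negP cj; apply: no; exists j.
  case: (ltnP i k) => [ik|/c0j //].
  have id : i < d by apply: leq_trans kd.
  have /rowP/(_ (Ordinal id)) := cM; rewrite mxE [RHS]mxE => <-.
  rewrite (bigD1 i) //= mxE (HA2 i (Ordinal id)) // !mxE !eqxx mulr1 big1 ?addr0 // => j ji.
  case: (ltnP j k) => [jk|/c0j ->]; last by rewrite mul0r.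
  have jd : j < d by apply: leq_trans kd.
  rewrite mxE (HA2 j (Ordinal jd)) // mxE eqxx /=; case: eqP => [/(congr1 val) /= e|_].
    by case/eqP: ji; apply: val_inj.
  by rewrite mulr0.
exists j => //.
pose H := others x j; have sH : subgroup H by apply: generated_subgroup.
have HG : H `<=` G by apply: generated_min => // _ [i _ <-].
(* The exponent vectors of elements of [H]; they form a subspace, and the relation [cM] puts the
   vector of the discarded entry into it. *)
pose near (a : 'rV['F_p]_d) := exists2 h, H h & congC h (expvec a).
have near0 : near 0%R by exists 1; [exact: (subgroup1 sH) | rewrite expvec0].
have nearD a b : near a -> near b -> near (a + b)%R.
  move=> [g Hg ga] [h Hh hb]; exists (g * h); first exact: (subgroupM sH).
  by apply: congC_trans (expvecD a b); apply: congCM => //; apply: HG.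
have nearZ t a : near a -> near (t *: a)%R.
  move=> na; rewrite -[t]natr_Zp scaler_nat.
  by elim: (nat_of_ord t) => [|i IHi]; rewrite ?mulr0n // mulrS; apply: nearD.
have near_j : near (A j).
  have -> : A j = (\sum_(i < n | i != j) (- c ord0 i / c ord0 j) *: A i)%R.
    have /rowP cM0 := cM; apply/rowP => l.
    have := cM0 l; rewrite mxE [RHS]mxE (bigD1 j) //= mxE => e.
    rewrite summxE; apply: (mulfI cj); rewrite mulr_sumr.
    apply/eqP; rewrite -subr_eq0 -sumrN; apply/eqP.
    rewrite -[RHS]e; congr (_ + _)%R; apply: eq_bigr => i _.
    by rewrite !mxE mulrA (mulrC (c ord0 j)) divfK // mulNr opprK.
  apply: big_ind => // i ij; apply: nearZ; exists (x i); last by apply: congC_sym.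
  by apply: sub_generated; exists i.
suff dH : dense G H by move=> g; apply: frattini.
split=> // g; rewrite -{1}gx => gxg.
suff S : generated (range x) `<=` [set g | exists2 h, H h & congC h g] by apply: S.
apply: generated_min => [|_ [i _ <-]] /=.
  split=> /=; first by exists 1; first exact: (subgroup1 sH).
    move=> a b [h Hh ha] [h' Hh' h'b]; exists (h * h'); first exact: (subgroupM sH).
    by apply: congCM => //; apply: HG.
  move=> a [h Hh ha]; exists h^-1; first exact: (subgroupV sH).
  have Ga : G a by rewrite -[a](mulVKg h); apply: subgroupM; [|apply: HG|apply: CG].
  have Gh := HG _ Hh.
  have h1 : congC (h^-1 * (h * a^-1)) (h^-1 * (a * a^-1)).
    by apply: congCM => //; [apply: subgroupM => //; apply: subgroupV | apply: congCM => //; apply: subgroupV].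
  by rewrite mulKg mulgV mulg1 in h1; apply: congC_sym.
have [->|ij] := eqVneq i j; last by exists (x i) => //; apply: sub_generated; exists i.
by have [h Hh hA] := near_j; exists h => //; apply: congC_trans hA (HA1 j).
Qed.

Definition std_tuple : {ffun 'I_n -> gT} :=
  [ffun i : 'I_n => if insub (i : nat) is Some l then s l else (1 : gT)].

Let agree k x := forall (i : 'I_n) (l : 'I_d), i < k -> i = l :> nat -> x i = s l.

Let std_tuple_lt (i : 'I_n) (l : 'I_d) : i = l :> nat -> std_tuple i = s l.
Proof. by move=> il; rewrite ffunE il valK. Qed.

Lemma std_tuple_generated : generated (range std_tuple) = G.
Proof.
apply/seteqP; split.
  apply: generated_min => // _ [i _ <-]; rewrite ffunE.
  by case: insubP => // _; apply: subgroup1.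
rewrite [X in X `<=` _]Gs; apply: generated_mono => _ [l _ <-].
have ln : l < n by apply: ltn_trans dn.
by rewrite -(@std_tuple_lt (Ordinal ln) l) //; apply: sub_generated; exists (Ordinal ln).
Qed.

Let agree_step x k : generated (range x) = G -> k < d -> agree k x ->
  exists2 y, nielsen_conn x y & agree k.+1 y.
Proof.
move=> gx kd xs; have [j kj oj] := redundant_entry gx (ltnW kd) xs.
have Gxi i : G (x i) by rewrite -gx; apply: sub_generated; exists i.
pose ik : 'I_n := Ordinal (ltn_trans kd dn); pose g := s (Ordinal kd).
have Gg : G g by apply: Gsl.
have GgV h : G h -> G (h^-1 * g) by move=> Gh; apply: subgroupM => //; apply: subgroupV.
have [jk|jk] := eqVneq j ik.
  exists (set_entry x j g).
    by apply: nielsen_conn_replace; apply: oj; apply: GgV.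
  move=> i l ik1 il; rewrite set_entryE; case: eqP => [e|/eqP ij].
    by congr s; apply: val_inj; rewrite /= -il e jk.
  apply: xs => //; move: ik1; rewrite ltnS leq_eqVlt => /orP[/eqP e|//].
  by case/eqP: ij; rewrite jk; apply: val_inj.
(* Entry [j] can be set to anything; this choice turns entry [k] into [g] by one multiplication. *)
pose y := set_entry x j ((x ik)^-1 * g).
have yj : y j = (x ik)^-1 * g by rewrite set_entryE eqxx.
have yk : y ik = x ik by rewrite set_entryE eq_sym (negPf jk).
exists (set_entry y ik g).
  apply: (@rt_trans _ _ _ y).
    apply: nielsen_conn_replace; apply: oj; apply: subgroupM => //; last exact: GgV.
    exact: subgroupV.
  by apply: nielsen_conn_replace; rewrite yk -yj; apply: sub_generated; exists j.
move=> i l ik1 il; rewrite set_entryE; case: eqP => [e|/eqP i_k].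
  by congr s; apply: val_inj; rewrite /= -il e.
have lt_ik : i < k.
  move: ik1; rewrite ltnS leq_eqVlt => /orP[/eqP e|//].
  by case/eqP: i_k; apply: val_inj.
rewrite set_entryE; case: eqP => [e|_]; last exact: xs.
by move: lt_ik; rewrite e ltnNge kj.
Qed.

Let conn_std x : generated (range x) = G -> nielsen_conn x std_tuple.
Proof.
move=> gx.
have [y xy ys] : exists2 y, nielsen_conn x y & agree d y.
  suff H k : (k <= d)%N -> exists2 y, nielsen_conn x y & agree k y by apply: H.
  elim: k => [|k IHk] kd; first by exists x => //; apply: rt_refl.
  have [y xy ys] := IHk (ltnW kd).
  have gy : generated (range y) = G by rewrite -(nielsen_conn_generated xy).
  have [z yz zs] := agree_step gy kd ys; exists z => //.
  exact: rt_trans yz.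
(* The first [d] entries already generate [G], so the remaining ones can be replaced by 1 one at a
   time. *)
pose fill m := [ffun i : 'I_n => if i < m then std_tuple i else y i].
have fillx m : nielsen_conn x (fill m).
  elim: m => [|m IHm].
    by rewrite (_ : fill 0 = y) //; apply/ffunP => i; rewrite ffunE.
  have [mn|nm] := ltnP m n; last first.
    rewrite (_ : fill m.+1 = fill m) //; apply/ffunP => i; rewrite !ffunE.
    by rewrite !(leq_trans (ltn_ord i)) // leqW.
  pose im := Ordinal mn.
  rewrite (_ : fill m.+1 = set_entry (fill m) im (std_tuple im)); last first.
    apply/ffunP => i; rewrite set_entryE /fill !(ffunE (fun i : 'I_n => if _ then _ else _)).
    rewrite ltnS leq_eqVlt -val_eqE /=; case: eqVneq => //= e.
    by rewrite (_ : i = im) //; apply: val_inj.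
  have gm : generated (range (fill m)) = G by rewrite -(nielsen_conn_generated IHm).
  apply: rt_trans IHm _.
  have Gm i : G (fill m i) by rewrite -gm; apply: sub_generated; exists i.
  have Gst : G (std_tuple im) by rewrite -std_tuple_generated; apply: sub_generated; exists im.
  have fill_s (i : 'I_n) (l : 'I_d) : i = l :> nat -> fill m i = s l.
    move=> il; rewrite ffunE; case: ifP => _; first exact: std_tuple_lt.
    by apply: ys => //; rewrite il.
  case: (ltnP m d) => [md|dm].
    rewrite (_ : std_tuple im = fill m im) ?set_entryK; first exact: rt_refl.
    by rewrite (std_tuple_lt (l := Ordinal md)) // (fill_s _ (Ordinal md)).
  apply: nielsen_conn_replace.
  suff S : G `<=` others (fill m) im.
    by apply: S; apply: subgroupM => //; apply: subgroupV.
  rewrite [X in X `<=` _]Gs; apply: generated_mono => _ [l _ <-].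
  have ln : l < n by apply: ltn_trans dn.
  rewrite -(fill_s (Ordinal ln) l) //; apply: sub_generated; exists (Ordinal ln) => //.
  by apply/eqP => /(congr1 val) /= e; move: (ltn_ord l); rewrite e ltnNge dm.
have := fillx n; rewrite (_ : fill n = std_tuple) //.
by apply/ffunP => i; rewrite ffunE ltn_ord.
Qed.

Lemma nielsen_connected : graph_connected (nielsen_edge n G).
Proof.
split; first by apply: inhabits; exists std_tuple; apply: std_tuple_generated.
move=> [x gx] [y gy]; apply: nielsen_conn_edge => /=.
by apply: rt_trans (conn_std gx) _; apply: nielsen_conn_sym; apply: conn_std.
Qed.

End Frattini.

(** * The Gupta-Sidki groups *)

Module GuptaSidki.

Section GuptaSidkiFrattini.
Variable p : nat.
Hypotheses (p_pr : prime p) (p_odd : odd p).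
Local Notation T := (tree_aut 'I_p).
Local Notation G := (gupta_sidki_group p).
Local Notation a := (gs_a p).
Local Notation b := (gs_b p).
Implicit Types (g h : T) (x y : 'I_p) (t u : 'F_p).

Let p_gt2 : 2 < p. Proof. by rewrite odd_prime_gt2. Qed.

(* Letters as elements of the field, where [rt a] becomes [t |-> t + 1]. *)
Definition lv x : 'F_p := ((x : nat)%:R)%R.

Lemma lv_inj : injective lv.
Proof.
move=> x y /(congr1 (@nat_of_ord _)); rewrite !val_Fp_nat // !modn_small //.
exact: val_inj.
Qed.

Lemma F_ltp t : t < p. Proof. by rewrite -[X in _ < X](Fp_cast p_pr). Qed.
Definition letter t : 'I_p := Ordinal (F_ltp t).
Lemma letterK : cancel letter lv.
Proof. by move=> t; rewrite /lv /= natr_Zp. Qed.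
Lemma lvK : cancel lv letter.
Proof. by move=> x; apply: lv_inj; rewrite letterK. Qed.
Lemma letter_inj : injective letter. Proof. exact: can_inj letterK. Qed.

Lemma lv_ordS x : lv (ordS x) = (lv x + 1)%R.
Proof. by rewrite /lv /= Fp_nat_mod // -natr1. Qed.

Lemma natF_neq0 n : 0 < n < p -> (n%:R != 0 :> 'F_p)%R.
Proof.
case/andP=> n0 np; apply/eqP => /(congr1 (@nat_of_ord _)).
by rewrite val_Fp_nat // modn_small //= => e; rewrite e in n0.
Qed.

Lemma F2_neq0 : (2%:R != 0 :> 'F_p)%R. Proof. by apply: natF_neq0; rewrite p_gt2. Qed.
Lemma F1_neqN1 : (1 != -1 :> 'F_p)%R.
Proof. by rewrite -subr_eq0 opprK -(natrD _ 1 1) F2_neq0. Qed.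

Lemma sec_a x : sec a x = 1.
Proof. by apply: taut_ext => v. Qed.
Lemma lv_rt_a x : lv (rt a x) = (lv x + 1)%R. Proof. exact: lv_ordS. Qed.
Lemma rt_b x : rt b x = x. Proof. by []. Qed.

Lemma lv0 x : (x == 0%N :> nat) = (lv x == 0)%R.
Proof.
apply/eqP/eqP => [x0|/(congr1 (@nat_of_ord _))]; first by rewrite /lv x0.
by rewrite val_Fp_nat // modn_small.
Qed.
Lemma lv1 x : (x == 1%N :> nat) = (lv x == 1)%R.
Proof.
apply/eqP/eqP => [x0|]; first by rewrite /lv x0.
rewrite -[1%R]/(1%:R)%R => /(congr1 (@nat_of_ord _)).
by rewrite !val_Fp_nat // !modn_small // (ltn_trans _ p_gt2).
Qed.
Lemma lvN1 x : (x == p.-1 :> nat) = (lv x == -1)%R.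
Proof.
have pE : p = p.-1.+1 by rewrite prednK // prime_gt0.
rewrite -addr_eq0 -lv_ordS -lv0 /=; apply/eqP/eqP => [->|].
  by rewrite -pE modnn.
move: (ltn_ord x); rewrite leq_eqVlt => /orP[/eqP e _|xp].
  by rewrite -[in RHS]e.
by rewrite modn_small.
Qed.

Lemma sec_b x : sec b x =
  if (lv x == 0)%R then a else if (lv x == 1)%R then a^-1
  else if (lv x == -1)%R then b else 1.
Proof.
apply: taut_ext => v; rewrite -lv0 -lv1 -lvN1 /=.
rewrite [LHS]/sec_fun /=.
by case: (x == 0%N :> nat) => //; case: (x == 1%N :> nat) => //; case: (x == p.-1 :> nat).
Qed.

Lemma sec_b0 x : lv x = 0%R -> sec b x = a.
Proof. by rewrite sec_b => ->; rewrite eqxx. Qed.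
Lemma sec_b1 x : lv x = 1%R -> sec b x = a^-1.
Proof. by rewrite sec_b => ->; rewrite oner_eq0 eqxx. Qed.
Lemma sec_bN1 x : lv x = (-1)%R -> sec b x = b.
Proof. by rewrite sec_b => ->; rewrite oppr_eq0 oner_eq0 eq_sym (negPf F1_neqN1) eqxx. Qed.
Lemma sec_b_other x : lv x != 0%R -> lv x != 1%R -> lv x != (-1)%R -> sec b x = 1.
Proof. by rewrite sec_b => /negPf-> /negPf-> /negPf->. Qed.

Lemma sec_aX n x : sec (a ^+ n) x = 1.
Proof.
elim: n x => [|n IHn] x; first exact: sec1.
by rewrite expgS secM sec_a mul1g.
Qed.

Lemma lv_rt_aX n x : lv (rt (a ^+ n) x) = (lv x + n%:R)%R.
Proof.
elim: n x => [|n IHn] x; first by rewrite addr0.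
by rewrite expgS rtM lv_rt_a IHn -addrA natr1.
Qed.

Lemma a_p : a ^+ p = 1.
Proof.
apply: tree_aut_eq => x; last by rewrite sec_aX sec1.
apply: lv_inj; rewrite lv_rt_aX rt1 -[p in (p%:R)%R]add0n.
by rewrite -Fp_nat_mod // add0n modnn addr0.
Qed.

Lemma b_p : b ^+ p = 1.
Proof.
apply: taut_ext => w; elim: w => [|x v IHv]; first by rewrite taut_nil.
rewrite tautE rtX_fix ?rt_b // secX_fix ?rt_b // taut1 sec_b; congr cons.
case: eqP => _; first by rewrite a_p.
case: eqP => _; first by rewrite expVgn a_p invg1.
by case: eqP => _; [exact: IHv | rewrite expg1n].
Qed.

Lemma sG : subgroup G. Proof. exact: generated_subgroup. Qed.
Lemma Ga : G a. Proof. by apply: sub_generated; left. Qed.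
Lemma Gb : G b. Proof. by apply: sub_generated; right. Qed.

Lemma G_min (H : set T) : subgroup H -> H a -> H b -> G `<=` H.
Proof. by move=> sH Ha Hb; apply: generated_min => // _ [->|->]. Qed.

Lemma Gsec g x : G g -> G (sec g x).
Proof.
move=> Gg; suff S : G `<=` [set g | forall x, G (sec g x)] by apply: S.
apply: G_min => [|y|y] /=; last 2 first.
- by rewrite sec_a; apply: subgroup1 sG.
- rewrite sec_b; do 3?case: eqP => _; [exact: Ga| |exact: Gb|exact: (subgroup1 sG)].
  exact: (subgroupV sG Ga).
split=> /= [y|u v Gu Gv y|u Gu y]; first by rewrite sec1; apply: (subgroup1 sG).
  by rewrite secM; apply: (subgroupM sG).
by rewrite secV; apply: (subgroupV sG).
Qed.

Definition x0 : 'I_p := letter 0%R.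
(** The exponent sum of [a]: elements of [G] translate the letters, and this is the amount. *)
Definition ea g : 'F_p := lv (rt g x0).

Lemma ea_spec g x : G g -> lv (rt g x) = (lv x + ea g)%R.
Proof.
move=> Gg; suff S : G `<=` [set g | forall x, lv (rt g x) = (lv x + ea g)%R] by apply: S.
have lx0 : lv x0 = 0%R by rewrite letterK.
apply: G_min => [|y|y] /=; last 2 first.
- by rewrite /ea !lv_rt_a lx0 add0r.
- by rewrite /ea !rt_b lx0 addr0.
split=> /= [y|u v Hu Hv y|u Hu y]; first by rewrite /ea !rt1 lx0 addr0.
  by rewrite [ea (_ * _)]/ea !rtM !Hu !Hv lx0 add0r addrA.
have e z : lv (rt u^-1 z) = (lv z - ea u)%R by rewrite -[z in RHS](rtKV u) Hu addrK.
by rewrite [ea u^-1]/ea !e lx0 add0r.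
Qed.

Lemma eaM g h : G g -> G h -> ea (g * h) = (ea g + ea h)%R.
Proof. by move=> Gg Gh; rewrite {1}/ea rtM ea_spec // addrC. Qed.
Lemma ea1 : ea 1 = 0%R. Proof. by rewrite /ea rt1 letterK. Qed.
Lemma eaV g : G g -> ea g^-1 = (- ea g)%R.
Proof.
move=> Gg; apply/eqP; rewrite -addr_eq0 -eaM ?mulVg ?ea1 //; exact: (subgroupV sG Gg).
Qed.
Lemma ea_a : ea a = 1%R. Proof. by rewrite /ea lv_rt_a letterK add0r. Qed.
Lemma ea_b : ea b = 0%R. Proof. by rewrite /ea rt_b letterK. Qed.

Lemma ea_stab g : G g -> ea g = 0%R -> stab 1 g.
Proof. by move=> Gg e x; split=> //; apply: lv_inj; rewrite ea_spec // e addr0. Qed.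
Lemma stab_ea g : stab 1 g -> ea g = 0%R.
Proof. by move=> /(_ x0)[]; rewrite /ea => ->; rewrite letterK. Qed.

Lemma Gpow g x : G g -> rt (g ^+ p) x = x.
Proof.
move=> Gg; apply: lv_inj; suff -> n : lv (rt (g ^+ n) x) = (lv x + ea g *+ n)%R.
  by rewrite -mulr_natr -Fp_nat_mod // modnn mulr0 addr0.
elim: n => [|n IHn]; first by rewrite addr0.
by rewrite expgS rtM ea_spec // IHn mulrSr addrA.
Qed.

Lemma Gfree g x : G g -> rt g x = x -> stab 1 g.
Proof.
move=> Gg gx; apply: ea_stab => //; apply: (addrI (lv x)).
by rewrite -ea_spec // gx addr0.
Qed.

Lemma Gtrans x y : exists2 g, G g & rt g x = y.
Proof.
exists (a ^+ (lv y - lv x)%R); first exact: (subgroupX _ sG Ga).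
by apply: lv_inj; rewrite lv_rt_aX natr_Zp addrC subrK.
Qed.

(** Its sections are [b] at t - 1, [a] at t, the inverse of [a] at t + 1, and 1 at all other
    letters. *)
Definition bb t := b ^ (a ^- t).

Lemma G_bb t : G (bb t).
Proof. by apply: (subgroupJ sG Gb); apply: (subgroupV sG); apply: (subgroupX _ sG Ga). Qed.
Lemma rt_bb t x : rt (bb t) x = x. Proof. by apply: rtJ_fix. Qed.
Lemma lv_rt_aXV (n : nat) x : lv (rt (a ^- n) x) = (lv x - n%:R)%R.
Proof. by rewrite -[x in RHS](rtKV (a ^+ n)) lv_rt_aX addrK. Qed.
Lemma sec_aXV (n : nat) x : sec (a ^- n) x = 1.
Proof. by rewrite secV sec_aX invg1. Qed.
Lemma sec_bb t x : sec (bb t) x = sec b (letter (lv x - t)%R).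
Proof.
rewrite /bb secJ // sec_aXV conjg1; congr (sec b _).
by apply: lv_inj; rewrite lv_rt_aXV natr_Zp letterK.
Qed.
Lemma stab_bb t : stab 1 (bb t). Proof. by move=> x; rewrite rt_bb. Qed.

Lemma Glift g x : G g -> exists2 h, G h & stab 1 h /\ sec h x = g.
Proof.
move=> Gg; suff S : G `<=` [set g | exists2 h, G h & stab 1 h /\ sec h x = g] by apply: S.
apply: G_min => /= [|| ]; last 2 first.
- exists (bb (lv x)); first exact: G_bb.
  by split; [exact: stab_bb | rewrite sec_bb subrr sec_b0 ?letterK].
- exists (bb (lv x + 1)%R); first exact: G_bb.
  by split; [exact: stab_bb | rewrite sec_bb sec_bN1 // letterK opprD addrA subrr sub0r].
have s1 := stab_subgroup 'I_p 1.
split=> /=.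
- by exists 1; [exact: (subgroup1 sG) | split; [exact: (subgroup1 s1) | exact: sec1]].
- move=> _ _ [h Gh [h1 <-]] [k Gk [k1 <-]]; exists (h * k); first exact: (subgroupM sG).
  by split; [exact: (subgroupM s1) | rewrite secM stab_rt1].
- move=> _ [h Gh [h1 <-]]; exists h^-1; first exact: (subgroupV sG).
  by split; [exact: (subgroupV s1) | rewrite secV_fix // stab_rt1].
Qed.

(** The exponent sum of [b], recovered as a first moment: [b] has sections [a] at 0 and its inverse
    at 1, which the sign turns into 1. Translating the letters does not change the moment because
    the exponents [ea] of the sections add up to 0 ([sum_ea]). *)
Definition eb g : 'F_p := (- \sum_(x : 'I_p) lv x * ea (sec g x))%R.

Lemma reindex_rt g (F : 'I_p -> 'F_p) :
  (\sum_x F (rt g x))%R = (\sum_x F x)%R.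
Proof. by rewrite [RHS](reindex_inj (can_inj (rtVK g))). Qed.

Lemma ea_secM g h x : G g -> G h ->
  ea (sec (g * h) x) = (ea (sec g (rt h x)) + ea (sec h x))%R.
Proof. by move=> Gg Gh; rewrite secM eaM //; apply: Gsec. Qed.

Lemma ea_sec_b x : ea (sec b x) = ((lv x == 0)%:R - (lv x == 1)%:R)%R.
Proof.
rewrite sec_b; case: eqP => [->|_]; first by rewrite ea_a eq_sym oner_eq0 subr0.
case: eqP => _; first by rewrite eaV ?ea_a ?sub0r //; exact: Ga.
by case: eqP => _; rewrite ?ea_b ?ea1 subr0.
Qed.

Lemma sum_pick (F : 'I_p -> 'F_p) t :
  (\sum_x F x * (lv x == t)%:R)%R = F (letter t).
Proof.
rewrite (bigD1 (letter t)) //= letterK eqxx mulr1 big1 ?addr0 // => x xt.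
case: eqP => [e|_]; last by rewrite mulr0.
by case/eqP: xt; rewrite -e lvK.
Qed.

Lemma sum_ea_sec_b (F : 'I_p -> 'F_p) :
  (\sum_x F x * ea (sec b x))%R = (F (letter 0) - F (letter 1))%R.
Proof.
by under eq_bigr do rewrite ea_sec_b mulrBr; rewrite sumrB !sum_pick.
Qed.

Lemma sum_ea g : G g -> (\sum_x ea (sec g x))%R = 0%R.
Proof.
move=> Gg; suff S : G `<=` [set g | G g /\ (\sum_x ea (sec g x))%R = 0%R] by have [] := S _ Gg.
apply: G_min => /=; last 2 first.
- by split; [exact: Ga | rewrite big1 // => x _; rewrite sec_a ea1].
- split; first exact: Gb.
  have := sum_ea_sec_b (fun=> 1%R); rewrite subrr => e.
  by rewrite -[RHS]e; apply: eq_bigr => x _; rewrite mul1r.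
split=> /=.
- by split; [exact: (subgroup1 sG) | rewrite big1 // => x _; rewrite sec1 ea1].
- move=> u v [Gu Hu] [Gv Hv]; split; first exact: (subgroupM sG).
  under eq_bigr do rewrite ea_secM //.
  by rewrite big_split /= Hv addr0 (reindex_rt v (fun x => ea (sec u x))).
- move=> u [Gu Hu]; split; first exact: (subgroupV sG).
  under eq_bigr => x _ do rewrite secV (eaV (Gsec _ Gu)).
  by rewrite sumrN (reindex_rt u^-1 (fun x => ea (sec u x))) Hu oppr0.
Qed.

Lemma ebM g h : G g -> G h -> eb (g * h) = (eb g + eb h)%R.
Proof.
move=> Gg Gh; rewrite /eb -opprD; congr (- _)%R.
under eq_bigr do rewrite ea_secM // mulrDr; rewrite big_split /=; congr (_ + _)%R.
have := reindex_rt h (fun x => (lv x * ea (sec g x))%R) => <-.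
under [in RHS]eq_bigr do rewrite ea_spec // mulrDl.
rewrite big_split /= -mulr_sumr (reindex_rt h (fun x => ea (sec g x))) sum_ea //.
by rewrite mulr0 addr0.
Qed.

Lemma eb1 : eb 1 = 0%R.
Proof. by rewrite /eb big1 ?oppr0 // => x _; rewrite sec1 ea1 mulr0. Qed.
Lemma ebV g : G g -> eb g^-1 = (- eb g)%R.
Proof.
move=> Gg; apply/eqP; rewrite -addr_eq0 -ebM ?mulVg ?eb1 //; exact: (subgroupV sG Gg).
Qed.
Lemma ebJ g h : G g -> G h -> eb (g ^ h) = eb g.
Proof.
move=> Gg Gh; have GhV := subgroupV sG Gh; have Ggh := subgroupM sG Gg Gh.
by rewrite /conjg !ebM // ebV // addrC addrK.
Qed.
Lemma eb_a : eb a = 0%R.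
Proof. by rewrite /eb big1 ?oppr0 // => x _; rewrite sec_a ea1 mulr0. Qed.
Lemma eb_b : eb b = 1%R.
Proof. by rewrite /eb sum_ea_sec_b !letterK sub0r opprK. Qed.

Lemma eb_sec_b x : eb (sec b x) = ((lv x == -1)%:R)%R.
Proof.
rewrite sec_b; case: eqP => [->|_].
  by rewrite eb_a eq_sym oppr_eq0 oner_eq0.
case: eqP => [->|_]; first by rewrite ebV ?eb_a ?oppr0 ?(negPf F1_neqN1) //; exact: Ga.
by case: eqP => _; rewrite ?eb_b ?eb1.
Qed.

Lemma eb_secM g h x : G g -> G h ->
  eb (sec (g * h) x) = (eb (sec g (rt h x)) + eb (sec h x))%R.
Proof. by move=> Gg Gh; rewrite secM ebM //; apply: Gsec. Qed.

(** Just one section of [b] has an exponent of [b]. In the descent this ensures that a nonzero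
    exponent survives in some section. *)
Lemma sum_eb g : G g -> (\sum_x eb (sec g x))%R = eb g.
Proof.
move=> Gg; suff S : G `<=` [set g | G g /\ (\sum_x eb (sec g x))%R = eb g] by have [] := S _ Gg.
apply: G_min => /=; last 2 first.
- by split; [exact: Ga | rewrite eb_a big1 // => x _; rewrite sec_a eb1].
- split; first exact: Gb.
  rewrite eb_b -(sum_pick (fun=> 1%R) (-1)%R).
  by apply: eq_bigr => x _; rewrite mul1r eb_sec_b.
split=> /=.
- by split; [exact: (subgroup1 sG) | rewrite eb1 big1 // => x _; rewrite sec1 eb1].
- move=> u v [Gu Hu] [Gv Hv]; split; first exact: (subgroupM sG).
  under eq_bigr do rewrite eb_secM //.
  by rewrite big_split /= Hv (reindex_rt v (fun x => eb (sec u x))) Hu ebM.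
- move=> u [Gu Hu]; split; first exact: (subgroupV sG).
  under eq_bigr => x _ do rewrite secV (ebV (Gsec _ Gu)).
  by rewrite sumrN (reindex_rt u^-1 (fun x => eb (sec u x))) Hu ebV.
Qed.

Definition gens (l : 'I_2) : T := if l == ord0 then a else b.
Lemma gens_generated : G = generated (range gens).
Proof.
congr generated; apply/seteqP; split=> [_ [->|->]|_ [l _ <-]].
- by exists ord0.
- by exists ord_max.
- by rewrite /gens; case: ifP => _; [left | right].
Qed.
Lemma gens_p l : gens l ^+ p = 1.
Proof. by rewrite /gens; case: ifP => _; [exact: a_p | exact: b_p]. Qed.

Local Notation C := (commsub G G).

Lemma mem_C g : G g -> ea g = 0%R -> eb g = 0%R -> C g.
Proof.
move=> Gg ag bg.
apply: (comm_of_trivial (e := fun l : 'I_2 => if l == ord0 then ea else eb)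
  p_pr sG gens_generated gens_p) => //.
- by move=> l u v Gu Gv; case: eqP => _; [apply: eaM | apply: ebM].
- by move=> [[|[|]]] // li [[|[|]]] // mi; rewrite /gens /= ?(ea_a, ea_b, eb_a, eb_b).
- by move=> l; case: eqP.
Qed.

Lemma nC : normal_in G C.
Proof. by apply: commsub_normal; [exact: sG|apply: normal_refl; exact: sG|apply: normal_refl; exact: sG]. Qed.
Lemma sC : subgroup C. Proof. exact: commsub_subgroup. Qed.
Lemma CG : C `<=` G. Proof. by case: nC. Qed.

Lemma C_ea_eb g : C g -> ea g = 0%R /\ eb g = 0%R.
Proof.
move=> Cg; suff S : C `<=` [set g | G g /\ (ea g = 0%R /\ eb g = 0%R)] by have [] := S _ Cg.
apply: commsub_min => [|u v Gu Gv].
  split=> /=; first by rewrite ea1 eb1; split; [exact: (subgroup1 sG) | ].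
    move=> u v [Gu [au bu]] [Gv [av bv]]; rewrite eaM // ebM // au av bu bv addr0.
    by split=> //; apply: (subgroupM sG).
  move=> u [Gu [au bu]]; rewrite eaV // ebV // au bu oppr0.
  by split=> //; apply: (subgroupV sG).
have GV z : G z -> G z^-1 by apply: (subgroupV sG).
have GM (z w : T) : G z -> G w -> G (z * w) by apply: (subgroupM sG).
split; first exact: (subgroupR sG).
rewrite /commg /conjg !eaM ?eaV; auto; rewrite (addrC (ea u)) addKr addNr.
by rewrite !ebM ?ebV; auto; rewrite (addrC (eb u)) addKr addNr.
Qed.

Lemma C_stab g : C g -> stab 1 g.
Proof. by move=> Cg; apply: ea_stab; [exact: CG | case: (C_ea_eb Cg)]. Qed.

(** The exponents are visible at finite depth: [ea] on the first level and [eb], computed from [ea]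
    of the sections, on the second. *)
Lemma Gstab g : G g -> stab 2 g -> C g.
Proof.
move=> Gg g2; apply: mem_C => //; first by apply: stab_ea; apply: stab_leq g2.
by rewrite /eb big1 ?oppr0 // => x _; rewrite stab_ea ?mulr0 //; case: (g2 x).
Qed.

Lemma X_inh : inhabited 'I_p. Proof. by apply: inhabits; exact: x0. Qed.

(** * Branching over the commutator subgroup *)

Lemma gen_a2 (H : set T) : subgroup H -> H (a ^+ 2) -> H a.
Proof.
have e : (2 * uphalf p = p.+1)%N.
  by rewrite uphalf_half p_odd mul2n doubleD -[in RHS](odd_double_half p) p_odd.
move=> sH H2; have -> : a = (a ^+ 2) ^+ (uphalf p).
  by rewrite -expgnA e expgSr a_p mul1g.
exact: (subgroupX _ sH).
Qed.

Lemma bb_cong t u : C ((bb t)^-1 * bb u).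
Proof.
have h w : C (b^-1 * bb w).
  by apply: mem_commsub; [exact: Gb | apply: (subgroupV sG); exact: (subgroupX _ sG Ga)].
have := subgroupM sC (subgroupV sC (h t)) (h u).
by rewrite invgM invgK mulgA mulgK.
Qed.

(** Quotients of two shifts of [b] lie in [C]; their sections at [x] include [a ^+ 2] and
    [a^-1 * b], which generate [G] because [a] has odd order. *)
Lemma C_lift g x : G g -> exists2 h, C h & sec h x = g.
Proof.
move=> Gg; suff S : G `<=` [set g | exists2 h, C h & sec h x = g] by apply: S.
have sH : subgroup [set g | exists2 h, C h & sec h x = g].
  have fixC h : C h -> rt h x = x by move/C_stab/stab_rt1.
  split=> /=.
  - by exists 1; [exact: (subgroup1 sC) | exact: sec1].
  - move=> _ _ [h Ch <-] [k Ck <-]; exists (h * k); first exact: (subgroupM sC).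
    by rewrite secM fixC.
  - by move=> _ [h Ch <-]; exists h^-1; [exact: (subgroupV sC) | rewrite secV_fix ?fixC].
have Sb t u : [set g | exists2 h, C h & sec h x = g] ((sec (bb t) x)^-1 * sec (bb u) x).
  exists ((bb t)^-1 * bb u); first exact: bb_cong.
  by rewrite secM rt_bb secV_fix ?rt_bb.
have Ha : [set g | exists2 h, C h & sec h x = g] a.
  apply: gen_a2 => //; have := Sb (lv x - 1)%R (lv x).
  by rewrite !sec_bb sec_b1 ?sec_b0 ?invgK ?letterK ?subrr // opprB addrC subrK.
apply: G_min => //; apply: (subgroupMl sH (subgroupV sH Ha)).
have := Sb (lv x) (lv x + 1)%R.
by rewrite !sec_bb sec_b0 ?sec_bN1 // letterK ?subrr // opprD addrA subrr sub0r.
Qed.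

Lemma sec_bbM t u x : sec (bb t * bb u) x = sec (bb t) x * sec (bb u) x.
Proof. by rewrite secM rt_bb. Qed.
Lemma sec_bbV t x : sec (bb t)^-1 x = (sec (bb t) x)^-1.
Proof. by rewrite secV_fix ?rt_bb. Qed.

Lemma emb_eq g x h : stab 1 g -> sec g x = h -> (forall y, y != x -> sec g y = 1) ->
  g = emb x h.
Proof.
move=> g1 gx gy; apply: tree_aut_eq => y; first by rewrite stab_rt1.
by rewrite sec_emb; case: eqVneq => [->|/gy].
Qed.

Lemma emb_nC : normal_in G (commsub C G).
Proof. by apply: commsub_normal; [exact: sG | exact: nC | apply: normal_refl; exact: sG]. Qed.

(* [g] and [h] are two sections generating the group, and all the other
   sections of the two elements whose commutator is taken commute. *)
Lemma emb_commutator : exists g h, [/\ G g, G h,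
    (forall H : set T, subgroup H -> H g -> H h -> G `<=` H) &
    commsub C G (emb (letter 1%R) [~ g, h])].
Proof.
have sx := stab_subgroup 'I_p 1.
pose X := bb 0%R * (bb 1%R)^-1.
have X1 : stab 1 X by apply: (subgroupM sx (stab_bb _)); apply: (subgroupV sx); apply: stab_bb.
have CX : C X.
  have [_ _ nCC] := nC; have e := bb_cong 0%R 1%R.
  have := subgroupV sC (nCC _ _ e (subgroupV sG (G_bb 0%R))).
  by rewrite /X /conjg !gnorm.
have secX x : sec X x = sec b x * (sec b (letter (lv x - 1)%R))^-1.
  by rewrite /X secM rtV_fix ?rt_bb // sec_bbV !sec_bb subr0 lvK.
have secX1 : sec X (letter 1%R) = a^-1 * a^-1.
  by rewrite secX sec_b1 ?sec_b0 ?letterK ?subrr.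
have GaV : G a^-1 by apply: (subgroupV sG Ga).
have Ga2 : G (a^-1 * a^-1) by apply: (subgroupM sG).
have Ha2 (H : set T) : subgroup H -> H (a^-1 * a^-1) -> H a.
  move=> sH Ha2; apply: gen_a2 => //; rewrite expg2 -[a * a]invgK invgM.
  exact: (subgroupV sH).
(* For p = 3 every shift of [b] involves all letters. The product [Y] of two shifts has section 1 at
   the letter 0 and, at the letter 2, the same section [b * a] as [X]. *)
have [p3|p3] := eqVneq p 3.
  pose Y := bb 0%R * bb 2%:R%R.
  have N3 : (2%:R = -1 :> 'F_p)%R.
    by apply/eqP; rewrite -addr_eq0 natr1 -[3]p3 -Fp_nat_mod // modnn.
  have secY x : sec Y x = sec b x * sec b (letter (lv x + 1)%R).
    by rewrite /Y sec_bbM !sec_bb subr0 lvK N3 opprK.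
  have Y1 : stab 1 Y by apply: (subgroupM sx); apply: stab_bb.
  have GY : G Y by apply: (subgroupM sG); apply: G_bb.
  exists (a^-1 * a^-1), (a^-1 * b); split=> //.
  - exact: (subgroupM sG GaV Gb).
  - move=> H sH /(Ha2 _ sH) Ha Hab; apply: G_min => //.
    exact: (subgroupMl sH (subgroupV sH Ha) Hab).
  - rewrite -(_ : [~ X, Y] = emb (letter 1%R) _); first exact: mem_commsub.
    apply: emb_eq => [| |y y1]; first exact: (subgroupR sx).
      rewrite secR_fix ?(stab_rt1 _ X1) ?(stab_rt1 _ Y1) // secX1 secY; congr [~ _, _ * _].
        by rewrite sec_b1 ?letterK.
      by rewrite sec_bN1 // letterK -N3 -natr1.
    rewrite secR_fix ?(stab_rt1 _ X1) ?(stab_rt1 _ Y1) // secX secY.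
    have [y0|y0] := eqVneq (lv y) 0%R.
      rewrite (sec_b0 y0) (_ : sec b (letter (lv y + 1)%R) = a^-1) ?mulgV ?commg1 //.
      by rewrite sec_b1 // letterK y0 add0r.
    have yN1 : lv y = (-1)%R.
      have : (lv y < p)%N by apply: F_ltp.
      move: y0 y1; rewrite -(inj_eq lv_inj) letterK -lv0 -lv1 => y0 y1 _.
      apply/eqP; rewrite -lvN1; move: (nat_of_ord y) (ltn_ord y) y0 y1; rewrite p3.
      by case=> [|[|[|]]].
    rewrite (sec_bN1 yN1) sec_b1 ?sec_b0 ?letterK ?yN1 ?addNr //.
      by rewrite invgK -[b * a](mulg1 _) commgg.
    by rewrite -opprD -(natrD _ 1 1) N3 opprK.
have p5 : 3 < p by rewrite ltn_neqAle eq_sym p3 p_gt2.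
have p6 : 4 < p.
  by rewrite ltn_neqAle p5 andbT; apply/eqP => e; move: p_odd; rewrite -e.
have nz n : 0 < n < 5 -> (n%:R != 0 :> 'F_p)%R.
  by case/andP=> n0 n5; apply: natF_neq0; rewrite n0 (leq_trans n5).
(* [Y] is supported on the letters 1, 2, 3; at 2 both sections are [a], and at 3 the section of [X]
   is trivial. *)
pose Y := bb 2%:R%R.
have secY x : sec Y x = sec b (letter (lv x - 2%:R)%R) by rewrite /Y sec_bb.
have Y1 : stab 1 Y by apply: stab_bb.
exists (a^-1 * a^-1), b; split=> //; first exact: Gb.
  by move=> H sH /(Ha2 _ sH) Ha Hb; apply: G_min.
rewrite -(_ : [~ X, Y] = emb (letter 1%R) _); first by apply: mem_commsub => //; apply: G_bb.
apply: emb_eq => [| |y y1]; first exact: (subgroupR sx).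
  rewrite secR_fix ?(stab_rt1 _ X1) ?(stab_rt1 _ Y1) // secX1 secY; congr [~ _, _].
  by rewrite sec_bN1 // letterK -[2%:R%R](natr1 1) opprD addrA subrr sub0r.
rewrite secR_fix ?(stab_rt1 _ X1) ?(stab_rt1 _ Y1) // secX secY.
move: y1; rewrite -(inj_eq lv_inj) letterK => y1.
have [y2|y2] := eqVneq (lv y) 2%:R%R.
  rewrite [sec b (letter (lv y - 2%:R)%R)]sec_b0 ?letterK ?y2 ?subrr //.
  rewrite [X in [~ _ * X^-1, _]]sec_b1; last by rewrite letterK -[2%:R%R](natr1 1) addrK.
  rewrite sec_b_other ?y2 ?nz //; last 2 first.
  - by rewrite -subr_eq0 -[2%:R%R](natr1 1) addrK oner_eq0.
  - by rewrite -subr_eq0 opprK natr1 nz.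
  by rewrite mul1g invgK commgg.
have [y3|y3] := eqVneq (lv y) 3%:R%R.
  rewrite sec_b_other ?y3 ?nz //; last 2 first.
  - by rewrite -subr_eq0 -[3%:R%R](natr1 2) addrK nz.
  - by rewrite -subr_eq0 opprK natr1 nz.
  rewrite sec_b_other ?invg1 ?mul1g ?comm1g // letterK -[3%:R%R](natr1 2) addrK ?nz //.
  - by rewrite -subr_eq0 -[2%:R%R](natr1 1) addrK oner_eq0.
  - by rewrite -subr_eq0 opprK natr1 nz.
rewrite [sec b (letter (lv y - 2%:R)%R)]sec_b_other ?commg1 // letterK.
- by rewrite subr_eq0.
- by rewrite subr_eq nat1r.
- by rewrite subr_eq -[2%:R%R](nat1r 1) addKr.
Qed.

(** As [g] and [h] generate [G], [C] is the normal closure of [[~ g, h]], so normality of the rigid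
    subgroup extends [emb_commutator] to all of [C]. Landing in [commsub C G], and not only in [C],
    is what lets commutators of copies of [C] contain copies of [C] further down. *)
Lemma emb_comm x c : C c -> commsub C G (emb x c).
Proof.
have [g [h [Gg Gh gen cgh]]] := emb_commutator.
have nR := rigid_G_normal Gsec Glift (letter 1%R) emb_nC.
have S1 : C `<=` rigid (commsub C G) (letter 1%R).
  have sub : [set g; h] `<=` G by move=> _ [->|->].
  have eG : G = generated [set g; h].
    apply/seteqP; split; last exact: (generated_min sG sub).
    by apply: gen; [exact: generated_subgroup | |]; apply: sub_generated; [left | right].
  have [sR _ _] := nR.
  have := commsub_generated sG nR sub sub; rewrite -eG; apply=> _ _ [->|->] [->|->]; rewrite ?commgg.
  - exact: (subgroup1 sR).
  - exact: cgh.
  - by rewrite -invgR; apply: (subgroupV sR).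
  - exact: (subgroup1 sR).
move=> /S1 Rc; have [sN _ nN] := emb_nC.
have [k Gk kx] := Gtrans x (letter 1%R).
rewrite -(_ : emb (letter 1%R) (c ^ (sec k x)^-1) ^ k = emb x c); last first.
  by rewrite embJ -kx rtVK conjgKV.
by apply: nN => //; have [_ _ nRR] := nR; apply: nRR => //; apply: (subgroupV sG); apply: Gsec.
Qed.

Lemma commCG_sub : commsub C G `<=` C.
Proof. by apply: commsub_mono => //; exact: CG. Qed.

Lemma C_emb x c : C c -> C (emb x c).
Proof. by move=> /(emb_comm x)/commCG_sub. Qed.

(** Conjugation by [g] moves [emb x h] to another letter, so the double commutator with [emb x k] is
    [emb x [~ h, k]]: a copy of [C, C] at each letter. By [C_emb] and [C_lift], [C, C] contains
    copies of [C, G] one level down, and that contains copies of [C] one further level down. *)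
Lemma moving_contains N g : normal_in G N -> N g -> ea g != 0%R -> contains_level C 3 N.
Proof.
move=> nN Ng ag; have [sN NG nNG] := nN.
have N1 x h k : C h -> C k -> rigid N x [~ h, k].
  move=> Ch Ck; have Gg := NG _ Ng.
  have Ge c : C c -> G (emb x c) by move=> /(C_emb x)/CG.
  have N2 : N [~ [~ g, emb x h], emb x k].
    by do 2 (apply: (subgroupRl nN); last exact: Ge).
  rewrite /rigid /=; suff <- : [~ [~ g, emb x h], emb x k] = emb x [~ h, k] by [].
  have fixe c y : rt (emb x c) y = y by [].
  have E1 : [~ g, emb x h] = emb (rt g^-1 x) (h^-1 ^ sec g (rt g^-1 x)) * emb x h.
    by rewrite commgEr -embV embJ.
  have fix1 y : rt [~ g, emb x h] y = y by rewrite E1 rtM.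
  have stab_e c : stab 1 (emb x c) by [].
  apply: emb_eq => [| |y yx].
  - by apply: (subgroupR (stab_subgroup _ 1)).
  - rewrite secR_fix // sec_embE; congr [~ _, _].
    rewrite E1 secM sec_embE sec_emb; case: eqP => [e|_]; last by rewrite mul1g.
    case/eqP: ag; apply: (addrI (lv x)); rewrite addr0 -ea_spec //.
    by rewrite fixe in e; rewrite {1}e rtKV.
  - by rewrite secR_fix // [sec (emb x k) y]sec_emb (negPf yx) commg1.
case=> [|x [|z [|w []]]] // c _ Cc /=; rewrite -/(rigid N x _).
have sNx := rigid_subgroup x sN; have sNz := rigid_subgroup z sNx.
suff /(_ _ (emb_comm w Cc)) : commsub C G `<=` rigid (rigid N x) z by [].
apply: commsub_min => // h k Ch /(C_lift z)[k' Ck' <-].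
rewrite /rigid /= -embR_fix; last by apply: stab_rt1; apply: C_stab.
by apply: N1 => //; apply: C_emb.
Qed.

Lemma comm_contains n A B N : contains_level C n A -> contains_level C n B ->
  subgroup N -> (forall g h, A g -> B h -> N [~ g, h]) -> contains_level C n.+2 N.
Proof.
move=> CA CB sN ABN u c; case/lastP: u => // u w; case/lastP: u => // u z.
rewrite !size_rcons => -[un] Cc.
rewrite -!cats1 !embw_cat /=.
have sNu := rigid_subgroup z (rigidw_subgroup u sN).
suff /(_ _ (emb_comm w Cc)) : commsub C G `<=` rigid [set g | N (embw u g)] z by [].
apply: commsub_min => // h k Ch /(C_lift z)[k' Ck' <-].
rewrite /rigid /= -embR_fix; last by apply: stab_rt1; apply: C_stab.
by rewrite embwR; apply: ABN; [apply: CA => //; apply: C_emb | apply: CB].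
Qed.

(** The shift [bb (lv x)] works unless [y] is a neighbour of [x]; then two shifts are chosen whose
    sections cancel at [y]. *)
Lemma separating x y : y != x -> exists g, [/\ G g, stab 1 g, sec g y = 1 & ea (sec g x) != 0%R].
Proof.
have sx := stab_subgroup 'I_p 1.
have shift t u : (t - (u + t))%R = (- u)%R :> 'F_p by rewrite opprD addrCA subrr addr0.
move=> yx; have yx' : (lv y - lv x != 0)%R by rewrite subr_eq0 (inj_eq lv_inj).
have [e|y1] := eqVneq (lv y - lv x)%R 1%R.
  exists (bb (lv x) * bb (1 + lv x)%R); split.
  - by apply: (subgroupM sG); apply: G_bb.
  - by apply: (subgroupM sx); apply: stab_bb.
  - by rewrite sec_bbM !sec_bb sec_b1 ?letterK // sec_b0 ?mulVg // letterK opprD addrCA e addNr.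
  - rewrite sec_bbM !sec_bb sec_b0 ?letterK ?subrr // sec_bN1 ?letterK ?shift //.
    by rewrite eaM ?ea_a ?ea_b ?addr0 ?oner_eq0 //; [exact: Ga | exact: Gb].
have [e|yN1] := eqVneq (lv y - lv x)%R (-1)%R.
  exists (bb (-1 + lv x)%R * bb (-2%:R + lv x)%R); split.
  - by apply: (subgroupM sG); apply: G_bb.
  - by apply: (subgroupM sx); apply: stab_bb.
  - rewrite sec_bbM !sec_bb sec_b0 ?letterK; last by rewrite opprD opprK addrCA e subrr.
    by rewrite sec_b1 ?mulgV // letterK opprD opprK addrCA e -[2%:R%R](natr1 1) addrK.
  - rewrite sec_bbM !sec_bb sec_b1 ?letterK ?shift ?opprK //.
    have e2 : ea (sec b (letter 2%:R%R)) = 0%R.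
      rewrite ea_sec_b letterK (negPf F2_neq0).
      by rewrite -subr_eq0 -[2%:R%R](natr1 1) addrK oner_eq0 subrr.
    rewrite eaM ?eaV ?ea_a ?e2 ?addr0 ?oppr_eq0 ?oner_eq0 //; first exact: Ga.
      exact: (subgroupV sG Ga).
    exact: (Gsec _ Gb).
exists (bb (lv x)); split; [exact: G_bb | exact: stab_bb | |].
  by rewrite sec_bb sec_b_other ?letterK.
by rewrite sec_bb sec_b0 ?letterK ?subrr // ea_a oner_eq0.
Qed.

Lemma secs_full_dense M x : dense G M -> G `<=` secs M x -> G `<=` M.
Proof.
move=> dM fMx; have [sM MG dMG] := dM.
apply: (dense_full p_pr X_inh sG Gsec Gpow Gstab C_emb dM) => z.
have fM y : G `<=` secs M y by apply: (secs_full p_pr X_inh sG Gsec Gpow Gtrans Gstab _ dM fMx).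
have sx := stab_subgroup 'I_p 1.
(* This becomes the rigid stabiliser once [s] lists all letters other than [z]. Letters are added
   one at a time: the commutator of an element trivial on [s] with one trivial at [y] is trivial on
   both. *)
pose R (s : seq 'I_p) : set T := [set h | exists m, [/\ M m, stab 1 m, sec m z = h &
   forall y, y \in s -> sec m y = 1]].
have sR s : subgroup (R s).
  split=> /=.
  - exists 1; split; [exact: (subgroup1 sM) | exact: stab1 | exact: sec1 |].
    by move=> y _; rewrite sec1.
  - move=> _ _ [h [Mh h1 <- hs]] [k [Mk k1 <- ks]]; exists (h * k); split.
    + exact: (subgroupM sM).
    + exact: (subgroupM sx).
    + by rewrite secM stab_rt1.
    + by move=> y ys; rewrite secM stab_rt1 // hs // ks // mulg1.
  - move=> _ [h [Mh h1 <- hs]]; exists h^-1; split.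
    + exact: (subgroupV sM).
    + exact: (subgroupV sx).
    + by rewrite secV_fix // stab_rt1.
    + by move=> y ys; rewrite secV_fix ?stab_rt1 // hs // invg1.
have RG s : R s `<=` G by move=> _ [h [Mh h1 <- hs]]; apply: Gsec; apply: MG.
have nR s : normal_in G (R s).
  split=> // _ g [h [Mh h1 <- hs]] /(fM z)[w [Mw wz <-]].
  have w1 := Gfree (MG _ Mw) wz.
  exists (h ^ w); split; [exact: (subgroupJ sM)|exact: stabJ| |].
    by rewrite secJ ?stab_rt1.
  by move=> y ys; rewrite secJ ?stab_rt1 // hs // conj1g.
have Rlevel s : z \notin s -> exists n, contains_level C n (R s).
  elim: s => [_|y s IHs].
    exists 0 => -[|//] c _ Cc /=; have [m [Mm mz <-]] := fM z _ (CG Cc).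
    by exists m; split=> //; apply: Gfree mz; apply: MG.
  rewrite inE negb_or => /andP[zy /IHs[n Rn]]; rewrite eq_sym in zy.
  have [g [Gg g1 gy gz]] := separating zy.
  have [m [Mm m1 my mg]] := dense_kill p_pr X_inh sG Gsec Gpow Gfree Gstab dM (fM y) Gg g1 gy.
  have Rm : R [:: y] (sec m z).
    by exists m; split=> // y'; rewrite inE => /eqP ->.
  have am : ea (sec m z) != 0%R.
    have Gm := Gsec z (MG _ Mm).
    have [] := C_ea_eb (mg z); rewrite eaM ?eaV //; last 2 first.
    - exact: (subgroupV sG).
    - exact: (Gsec _ Gg).
    by move/eqP; rewrite addrC subr_eq0 => /eqP <-.
  have R3 := moving_contains (nR [:: y]) Rm am.
  exists (maxn n 3).+2.
  apply: (comm_contains (contains_level_leq C_emb (leq_maxl n 3) Rn)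
    (contains_level_leq C_emb (leq_maxr n 3) R3)) => // _ _ [h [Mh h1 <- hs]] [k [Mk k1 <- ky]].
  exists [~ h, k]; split; [exact: (subgroupR sM)|exact: (subgroupR sx)| |].
    by rewrite secR_fix ?stab_rt1.
  move=> y'; rewrite inE secR_fix ?stab_rt1 // => /orP[/eqP ->|/hs ->]; last by rewrite comm1g.
  by rewrite ky ?inE // commg1.
have [n Rn] : exists n, contains_level C n (R [seq y <- enum 'I_p | y != z]).
  by apply: Rlevel; rewrite mem_filter eqxx.
exists n => u c un /(Rn u c un)[m [Mm m1 <- ms]].
rewrite /rigid /= -(emb_eq m1 erefl) // => y yz.
by apply: ms; rewrite mem_filter yz mem_enum.
Qed.

(** * Descent to the whole group *)

Definition powers g : set T := [set h | exists n, h = g ^+ n].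

Lemma powers_subgroup g : g ^+ p = 1 -> subgroup (powers g).
Proof.
move=> gp; split.
- by exists 0.
- by move=> _ _ [n ->] [k ->]; exists (n + k)%N; rewrite expgnDr.
- move=> _ [n ->]; exists (n * p.-1)%N; apply: (@mulgI _ (g ^+ n)); rewrite mulgV.
  by rewrite -expgnDr -mulnS prednK ?prime_gt0 // mulnC expgnA gp expg1n.
Qed.

Lemma expF g n : g ^+ p = 1 -> g ^+ n = g ^+ (n%:R : 'F_p)%R.
Proof.
move=> gp; rewrite val_Fp_nat // {1}(divn_eq n p).
by rewrite expgnDr mulnC expgnA gp expg1n mul1g.
Qed.

Lemma powers_F g n : g ^+ p = 1 -> (n%:R != 0 :> 'F_p)%R -> powers (g ^+ n) g.
Proof.
by move=> gp n0; exists (n%:R^-1 : 'F_p)%R; rewrite -expgnA expF // natrM natr_Zp divff //.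
Qed.

Local Notation A := (powers a).
Local Notation B := (powers b).
Definition last : 'I_p := letter (-1)%R.

Let sA : subgroup A. Proof. exact: powers_subgroup a_p. Qed.
Let sB : subgroup B. Proof. exact: powers_subgroup b_p. Qed.
Let Asec g x : A g -> sec g x = 1. Proof. by move=> [n ->]; apply: sec_aX. Qed.
Let AG : A `<=` G. Proof. by move=> _ [n ->]; apply: (subgroupX _ sG Ga). Qed.
Let BG : B `<=` G. Proof. by move=> _ [n ->]; apply: (subgroupX _ sG Gb). Qed.
Let Bfix g x : B g -> rt g x = x. Proof. by move=> [n ->]; apply: rtX_fix. Qed.
Let BsecA g x : B g -> x != last -> A (sec g x).
Proof.
move=> [n ->] xl; rewrite secX_fix //; apply: (subgroupX _ sA).
rewrite sec_b; case: eqP => _; first by exists 1%N.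
case: eqP => _; first by apply: (subgroupV sA); exists 1%N.
case: eqP => [e|_]; last by exists 0.
by case/eqP: xl; rewrite /last -e lvK.
Qed.
Let BsecB g : B g -> B (sec g last).
Proof. by move=> [n ->]; rewrite secX_fix // sec_bN1 ?letterK //; exists n. Qed.

Local Notation ball := (ball A B).

Lemma G_ball g : G g -> exists m, ball m g.
Proof.
apply: (ball_generated sA sB) => _ [->|->]; [left | right]; by exists 1%N.
Qed.
Lemma ball_G m g : ball m g -> G g.
Proof. exact: (ball_sub sG AG BG). Qed.

Lemma ball1_conj g : ball 1 g -> ea g = 0%R -> exists n j : nat, g = (b ^+ n) ^ (a ^+ j).
Proof.
move E: 1%N => m bg; case: bg E => // {}m {}g _ _ bg [n ->] [j ->] [E].
case: bg E => // _ [k ->] _ e.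
exists n, j; rewrite /conjg !mulgA; congr (_ * _ * _).
apply/esym/mulg1_eq; rewrite -expgnDr expF ?a_p // (_ : (_ + _)%:R = 0)%R // natrD.
have ek i : ea (a ^+ i) = (i%:R)%R by rewrite /ea lv_rt_aX letterK add0r.
have Gk i : G (a ^+ i) by apply: AG; exists i.
have Gn : G (b ^+ n) by apply: BG; exists n.
have eb_n : ea (b ^+ n) = 0%R by rewrite /ea Bfix ?letterK //; exists n.
move: e; rewrite !eaM ?ek ?eb_n ?addr0 //; last exact: (subgroupM sG).
by rewrite addrC.
Qed.

Lemma secX_sum (f : T -> 'F_p) g n x : G g -> f 1 = 0%R ->
  (forall h k, G h -> G k -> f (h * k) = (f h + f k)%R) ->
  f (sec (g ^+ n) x) = (\sum_(i < n) f (sec g (rt (g ^+ i)%g x)))%R.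
Proof.
move=> Gg f1 fM; elim: n => [|n IHn]; first by rewrite big_ord0 sec1.
have Gn : G (sec (g ^+ n) x) by apply: Gsec; exact: (subgroupX _ sG Gg).
have Gs : G (sec g (rt (g ^+ n) x)) by apply: Gsec.
rewrite expgS secM fM // IHn.
by rewrite big_ord_recr /= addrC.
Qed.

Lemma rt_pow_inj g x : G g -> ea g != 0%R ->
  injective (fun i : 'I_p => rt (g ^+ i) x).
Proof.
move=> Gg ag i j /(congr1 lv).
have e n : lv (rt (g ^+ n) x) = (lv x + ea g *+ n)%R.
  elim: n => [|n IHn]; first by rewrite addr0.
  by rewrite expgS rtM ea_spec // IHn mulrSr addrA.
rewrite !e => /addrI; rewrite -[LHS]mulr_natr -[RHS]mulr_natr => /(mulfI ag) ij.
exact: lv_inj ij.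
Qed.

Lemma dense_secs_GS M x : dense G M -> dense G (secs M x).
Proof. exact: (dense_secs p_pr X_inh sG Gsec Gpow Glift Gstab). Qed.

(** Some section [w] of [z] has a nonzero exponent of [b] and about half the length. If [w] fixes
    the letters, it replaces [z]. Otherwise it permutes them cyclically; the section of [w ^+ p] is
    not longer than [w] and multiplies all sections of [w] together, so its exponents are 0 for [a]
    and [eb w] for [b]. At length 1 a conjugate of a power of [b] remains. *)
Lemma reach_from_b_exponent m M z : (forall M', dense G M' -> M' b -> reach G M') ->
  dense G M -> M z -> ball m z -> ea z = 0%R -> eb z != 0%R -> reach G M.
Proof.
move=> final; elim/ltn_ind: m M z => m IHm M z dM Mz bz az bz0.
have [sM MG _] := dM; have Gz := MG _ Mz; have z1 := ea_stab Gz az.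
case: (leqP m 1) => [m1|m2].
  have [n [j zE]] := ball1_conj (ball_leq sA sB m1 bz) az.
  have Gn : G (b ^+ n) by apply: BG; exists n.
  have ebn : eb (b ^+ n) = (n%:R)%R.
    elim: (n) => [|k IHk]; first by rewrite eb1.
    by rewrite expgS ebM ?IHk ?eb_b ?nat1r //; [exact: Gb | exact: (subgroupX _ sG Gb)].
  have n0 : (n%:R != 0 :> 'F_p)%R.
    apply: contra_neq bz0 => n0; rewrite zE.
    by rewrite ebJ ?ebn //; apply: AG; exists j.
  pose x := rt (a ^- j) last; have xl : rt (a ^+ j) x = last by rewrite rtKV.
  have Mb : secs M x (b ^+ n).
    have <- : sec z x = b ^+ n; last by apply: mem_secs => //; apply: stab_rt1.
    rewrite zE secJ xl ?sec_aX ?conjg1 ?secX_fix ?rtX_fix ?rt_b //.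
    by rewrite sec_bN1 ?letterK.
  apply: (@ReachS _ G M x); apply: final; first exact: dense_secs_GS.
  have [k ->] := powers_F b_p n0.
  by apply: subgroupX => //; apply: secs_subgroup.
have [x ebx] : exists x, eb (sec z x) != 0%R.
  apply: contrapT => no; case/eqP: bz0; rewrite -sum_eb // big1 // => x _.
  by apply/eqP; apply: contrapT => /negP e; apply: no; exists x.
have mh : uphalf m < m by apply: ltn_uphalf.
have bw := ball_sec_half sA sB Asec Bfix BsecA BsecB x bz.
have dM1 := dense_secs_GS x dM.
have Mw : secs M x (sec z x) by apply: mem_secs => //; apply: stab_rt1.
have Gw := Gsec x Gz.
apply: (@ReachS _ G M x).
have [aw|aw] := eqVneq (ea (sec z x)) 0%R; first exact: IHm Mw bw aw ebx.
set w := sec z x in bw Mw Gw ebx aw *.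
have dM2 := dense_secs_GS x0 dM1; have [sM1 _ _] := dM1.
apply: (@ReachS _ G _ x0).
have sum_orbit (f : T -> 'F_p) : f 1 = 0%R ->
    (forall h k, G h -> G k -> f (h * k) = (f h + f k)%R) ->
    f (sec (w ^+ p) x0) = (\sum_x f (sec w x))%R.
  move=> f1 fM; rewrite (secX_sum p x0 Gw f1 fM).
  by rewrite [RHS](reindex_inj (rt_pow_inj (x := x0) Gw aw)).
apply: (IHm _ mh _ (sec (w ^+ p) x0) dM2).
- by apply: mem_secs; [exact: (subgroupX _ sM1) | exact: Gpow].
- apply: (@ball_secX _ _ _ _ sA sB Asec Bfix BsecA BsecB _ w p x0 bw) => i j.
  rewrite !mem_iota !add0n /= => ip jp e.
  exact: (congr1 val (@rt_pow_inj w x0 Gw aw (Ordinal ip) (Ordinal jp) e)).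
- by rewrite sum_orbit ?sum_ea ?ea1 //; exact: eaM.
- by rewrite sum_orbit ?sum_eb ?eb1 //; exact: ebM.
Qed.

(** A power of [a ^ y] carries [z] to [x]; conjugating [b] by it brings the section of [b] at [x] to
    the letter [z]. *)
Lemma secs_conj_b M (y : T) x z : subgroup M -> M b -> M (a ^ y) -> stab 1 y ->
  secs M z (sec b x ^ ((sec y x)^-1 * sec y z)).
Proof.
move=> sM Mb May y1; pose k : nat := (lv x - lv z)%R.
pose w := (a ^+ k) ^ y.
have Mw : M w by rewrite /w conjXg; apply: subgroupX.
have kz : rt (a ^+ k) z = x by apply: lv_inj; rewrite lv_rt_aX natr_Zp addrC subrK.
have yV1 : stab 1 y^-1 by apply: stabV.
have wz : rt w z = x by rewrite rtJ (stab_rt1 z y1) kz stab_rt1.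
have sw : sec w z = (sec y x)^-1 * sec y z.
  by rewrite /w /conjg !secM rtM (stab_rt1 z y1) kz sec_aX mul1g secV_fix ?(stab_rt1 x y1).
rewrite -sw -{1}wz -secJ ?rt_b //.
by apply: mem_secs; [apply: subgroupJ | apply: rtJ_fix].
Qed.

Lemma reach_from_ab M : dense G M -> M a -> M b -> reach G M.
Proof. by move=> [sM _ _] Ma Mb; apply: Reach0; apply: G_min. Qed.

(** At the letter [last], [b] persists and conjugates of [a] arise from both letters 0 and 1. If
    neither conjugator gets shorter, the count over all letters forces length 0 at the letter 0, and
    for m > 1 [ball_sec_half] shortens the section at [last]. *)
Lemma reach_from_b m M (h : T) : dense G M -> M b -> ball m h -> M (a ^ h) -> reach G M.
Proof.
elim/ltn_ind: m M h => m IHm M h dM Mb bh Mah.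
(* A power of [a] on the left of [h] does not affect [a ^ h]; it is chosen below so that [y] fixes
   the first level. *)
have [sM MG _] := dM; have Gh := ball_G bh.
pose t : nat := ea h; pose y : T := a ^- t * h.
have At : A (a ^- t) by apply: (subgroupV sA); exists t.
have y_h : a ^ h = a ^ y.
  have e : a ^ (a ^- t) = a by apply/conjg_fixP/commgP/commuteV/commuteX/commute_refl.
  by rewrite /y conjgM e.
have by_ : ball m y by rewrite -(add0n m); apply: (ballM sA _ bh); apply: Ball0.
have y1 : stab 1 y.
  apply: ea_stab; first exact: ball_G by_.
  rewrite eaM ?eaV //; try exact: AG; try by apply: AG; exists t.
  by rewrite {1}/ea lv_rt_aX letterK add0r natr_Zp addNr.
rewrite y_h in Mah.
pose l0 := letter 0%R; pose l1 := letter 1%R.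
pose k x := (sec y x)^-1 * sec y last.
have dM1 := dense_secs_GS last dM; have [sM1 _ _] := dM1.
have M1b : secs M last b.
  by rewrite -(sec_bN1 (letterK _ : lv last = _)); apply: mem_secs.
have M1a x : x = l0 \/ x = l1 -> secs M last (a ^ k x).
  have := secs_conj_b x last sM Mb Mah y1; rewrite -/(k x) => + [x0|x1].
    by rewrite sec_b0 // x0 letterK.
  rewrite sec_b1 ?x1 ?letterK // conjVg => /(subgroupV sM1).
  by rewrite invgK.
have step x m' : x = l0 \/ x = l1 -> m' < m -> ball m' (k x) -> reach G M.
  by move=> xl mm bk; apply: (@ReachS _ G M last); apply: (IHm _ mm _ (k x)) => //; apply: M1a.
have l01 : l0 != l1 by rewrite (inj_eq letter_inj) eq_sym oner_eq0.
have l0q : l0 != last by rewrite (inj_eq letter_inj) eq_sym oppr_eq0 oner_eq0.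
have l1q : l1 != last by rewrite (inj_eq letter_inj) F1_neqN1.
have kb x i j : ball i (sec y x) -> ball j (sec y last) -> ball (i + j) (k x).
  by move=> bi bj; apply: ballM => //; apply: ballV.
have [n [nm bn]] := ball_sec_sum sA Asec Bfix BsecA BsecB by_.
have [n0|n0] := ltnP (n l0 + n last) m; first by apply: step n0 _; [left | exact: kb].
have [n1|n1] := ltnP (n l1 + n last) m; first by apply: step n1 _; [right | exact: kb].
have n00 : n l0 = 0.
  have : n l0 + (n l1 + n last) <= m.
    apply: leq_trans nm; rewrite (bigD1 l0) //= leq_add2l (bigD1 l1) ?(eq_sym l1) //=.
    by rewrite leq_add2l (bigD1 last) ?leq_addr // !(eq_sym last) l0q l1q.
  move=> le; apply/eqP; rewrite -leqn0 -(leq_add2r m).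
  by apply: leq_trans le; rewrite leq_add2l.
have bl0 : ball 0 (sec y l0) by rewrite -n00.
clear bh; case: m => [|[|m]] in IHm by_ nm n0 n1 step *.
- apply: reach_from_ab => //; move: by_ Mah; move E: 0 => i bi; case: bi E => // c [j ->] _.
  by rewrite (_ : a ^ _ = a) //; apply/conjg_fixP/commgP/commuteX/commute_refl.
(* Now [y] is a conjugate of a power of [b], with at most one section outside [A]. Unless [y] is
   itself a power of [b], that section is not at [last], and it cannot be at both 0 and 1. *)
- have [e [j yE]] := ball1_conj by_ (stab_ea y1).
  have [j0|j0] := eqVneq (j%:R : 'F_p)%R 0%R.
    have yb : y = b ^+ e by rewrite yE (expF j a_p) j0 conjg1.
    apply: reach_from_ab => //; rewrite -[a](conjgK (b ^+ e)) -yb.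
    by apply: subgroupJ => //; rewrite yb; apply: subgroupV => //; apply: subgroupX.
  have sy x : rt (a ^+ j) x != last -> ball 0 (sec y x).
    move=> xj; apply: Ball0; rewrite yE secJ; last exact: rtX_fix.
    rewrite sec_aX conjg1.
    by apply: BsecA => //; exists e.
  have bq : ball 0 (sec y last).
    apply: sy; apply: contraNneq j0 => /(congr1 lv); rewrite lv_rt_aX -[in RHS](addr0 (lv last)).
    by move/addrI => ->.
  have [e0|e0] := eqVneq (rt (a ^+ j) l0) last; last first.
    by apply: (step l0 0) => //; [left | exact: (kb _ 0 0 (sy _ e0) bq)].
  have e1 : rt (a ^+ j) l1 != last.
    by rewrite -e0 (inj_eq (can_inj (rtVK _))) eq_sym.
  by apply: (step l1 0) => //; [right | exact: (kb _ 0 0 (sy _ e1) bq)].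
- have bq := ball_sec_half sA sB Asec Bfix BsecA BsecB last by_.
  apply: (step l0 (uphalf m.+2)); [by left | exact: ltn_uphalf |].
  exact: (kb _ 0 _ bl0 bq).
Qed.

Lemma dense_reach M : dense G M -> reach G M.
Proof.
move=> dM; have [m Mm mb] : exists2 m, M m & C (m^-1 * b) by case: dM => _ _; apply; exact: Gb.
have [sM MG _] := dM; have Gm := MG _ Mm; have Gm' := subgroupV sG Gm.
have [ea0 eb0] := C_ea_eb mb.
have am : ea m = 0%R.
  by move: ea0; rewrite eaM ?eaV ?ea_b ?addr0 //; [move/eqP; rewrite oppr_eq0 => /eqP | exact: Gb].
have bm : eb m != 0%R.
  move: eb0; rewrite ebM ?ebV ?eb_b //; last exact: Gb.
  by move/eqP; rewrite addrC subr_eq0 => /eqP <-; rewrite oner_eq0.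
have [k bk] := G_ball Gm.
apply: (reach_from_b_exponent _ dM Mm bk am bm) => {Mm mb m ea0 eb0 am bm bk k Gm Gm'} M' dM' Mb.
have [sM' MG' _] := dM'.
(* The section of [b] at 0 is [a]; an element of [M'] moving 0 to [last] transports it, up to
   conjugacy, next to the section [b]. *)
have [w Mw wx] := dense_trans p_pr X_inh sG Gsec Gpow Gtrans Gstab (letter 0%R) last dM'.
have [n bn] := G_ball (subgroupV sG (Gsec (letter 0%R) (MG' _ Mw))).
apply: (@ReachS _ G M' last); apply: (reach_from_b (m := n) (h := (sec w (letter 0%R))^-1)) => //.
- exact: dense_secs_GS.
- by rewrite -(sec_bN1 (letterK _ : lv last = _)); apply: mem_secs.
- rewrite -wx; apply: secs_transport => //.
  by rewrite -[X in secs _ _ X](sec_b0 (letterK 0%R)); apply: mem_secs.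
Qed.

Lemma gupta_sidki_frattini M : dense G M -> G `<=` M.
Proof.
move=> dM; apply: (reach_full p_pr X_inh sG Gsec Gpow Glift Gstab _ dM (dense_reach dM)).
exact: secs_full_dense.
Qed.

Lemma gupta_sidki_connected n : 2 < n -> graph_connected (nielsen_edge n G).
Proof.
move=> n3; apply: (nielsen_connected p_pr sG gens_generated gens_p _ n3).
exact: gupta_sidki_frattini.
Qed.

End GuptaSidkiFrattini.

End GuptaSidki.

(** * The Grigorchuk group *)

Module Grigorchuk.

Local Notation T := (tree_aut bool).
Local Notation G := grigorchuk_group.
Local Notation a := grig_a.
Local Notation b := grig_b.
Local Notation c := grig_c.
Local Notation d := grig_d.
Implicit Types (g h : T) (x y : bool).

Lemma aa : a * a = 1. Proof. by apply: taut_ext => w; apply: grig_a_funK. Qed.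
Lemma bb : b * b = 1. Proof. by apply: taut_ext => w; apply: grig_b_funK. Qed.
Lemma cc : c * c = 1. Proof. by apply: taut_ext => w; apply: grig_c_funK. Qed.
Lemma dd : d * d = 1. Proof. by apply: taut_ext => w; apply: grig_d_funK. Qed.
Lemma invK_eq g : g * g = 1 -> g^-1 = g.
Proof. by move=> /(canRL (mulKg g)); rewrite mulg1. Qed.
Lemma aV : a^-1 = a. Proof. exact: invK_eq aa. Qed.
Lemma bV : b^-1 = b. Proof. exact: invK_eq bb. Qed.
Lemma cV : c^-1 = c. Proof. exact: invK_eq cc. Qed.
Lemma dV : d^-1 = d. Proof. exact: invK_eq dd. Qed.

Lemma klein_relations : [/\ b * c = d, c * d = b & d * b = c].
Proof.
suff e w : [/\ (b * c) w = d w, (c * d) w = b w & (d * b) w = c w].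
  by split; apply: taut_ext => w; case: (e w).
rewrite !tautM /=; elim: w => [|[] v [Hb Hc Hd]] //=.
  by rewrite Hb Hc Hd.
by rewrite !grig_a_funK.
Qed.
Lemma bc : b * c = d. Proof. by case: klein_relations. Qed.
Lemma cd : c * d = b. Proof. by case: klein_relations. Qed.
Lemma db : d * b = c. Proof. by case: klein_relations. Qed.
Lemma cb : c * b = d. Proof. by rewrite -[c * b]invgK invgM bV cV bc dV. Qed.
Lemma dc : d * c = b. Proof. by rewrite -[d * c]invgK invgM dV cV cd bV. Qed.
Lemma bd : b * d = c. Proof. by rewrite -[b * d]invgK invgM dV bV db cV. Qed.

Lemma sec_a x : sec a x = 1. Proof. exact: taut_ext. Qed.
Lemma rt_a x : rt a x = ~~ x. Proof. by []. Qed.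
Lemma rt_b x : rt b x = x. Proof. by case: x. Qed.
Lemma rt_c x : rt c x = x. Proof. by case: x. Qed.
Lemma rt_d x : rt d x = x. Proof. by case: x. Qed.
Lemma sec_b x : sec b x = if x then c else a.
Proof. by case: x; apply: taut_ext. Qed.
Lemma sec_c x : sec c x = if x then d else a.
Proof. by case: x; apply: taut_ext. Qed.
Lemma sec_d x : sec d x = if x then b else 1.
Proof. by case: x; apply: taut_ext. Qed.

Definition secE :=
  (secM, rtM, sec_a, sec_b, sec_c, sec_d, rt_a, rt_b, rt_c, rt_d).

Lemma rt_addb g x : rt g x = x (+) rt g false.
Proof.
case: x => //; have := can_inj (rtVK g) : injective (rt g).
by move=> /(_ true false); case: (rt g true); case: (rt g false) => // /(_ erefl).
Qed.

Lemma sG : subgroup G. Proof. exact: generated_subgroup. Qed.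
Lemma Ga : G a. Proof. by apply: sub_generated; left; left; left. Qed.
Lemma Gb : G b. Proof. by apply: sub_generated; left; left; right. Qed.
Lemma Gc : G c. Proof. by apply: sub_generated; left; right. Qed.
Lemma Gd : G d. Proof. by apply: sub_generated; right. Qed.

Lemma G_min (H : set T) : subgroup H -> H a -> H b -> H c -> G `<=` H.
Proof.
move=> sH Ha Hb Hc; apply: generated_min => // _ [[[->|->]|->]|->] //.
by rewrite -bc; apply: subgroupM.
Qed.

Lemma Gsec g x : G g -> G (sec g x).
Proof.
move=> Gg; suff S : G `<=` [set g | forall x, G (sec g x)] by apply: S.
apply: G_min => [|y|y|y] /=; last 3 first.
- by rewrite sec_a; apply: (subgroup1 sG).
- by rewrite sec_b; case: y; [exact: Gc | exact: Ga].
- by rewrite sec_c; case: y; [exact: Gd | exact: Ga].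
split=> /= [y|u v Gu Gv y|u Gu y]; first by rewrite sec1; apply: (subgroup1 sG).
  by rewrite secM; apply: (subgroupM sG).
by rewrite secV; apply: (subgroupV sG).
Qed.

Lemma Gfree g x : G g -> rt g x = x -> stab 1 g.
Proof.
rewrite rt_addb => _ gx y; split=> //; rewrite rt_addb.
by move: gx; case: (rt g false) x => -[]; rewrite ?addbF.
Qed.

Lemma Gpow g x : G g -> rt (g ^+ 2) x = x.
Proof. by move=> _; rewrite expg2 rtM rt_addb [rt g x]rt_addb -addbA addbb addbF. Qed.

Lemma Gtrans x y : exists2 g, G g & rt g x = y.
Proof.
case: (eqVneq x y) => [->|xy]; first by exists 1; [exact: (subgroup1 sG) | exact: rt1].
by exists a; [exact: Ga | rewrite rt_a; case: x y xy => -[]].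
Qed.

Lemma stab_bcd : [/\ stab 1 b, stab 1 c & stab 1 d].
Proof. by split=> x; rewrite ?rt_b ?rt_c ?rt_d. Qed.

Lemma Glift g x : G g -> exists2 h, G h & stab 1 h /\ sec h x = g.
Proof.
have s1 := stab_subgroup bool 1; have [b1 c1 d1] := stab_bcd.
have lift_true : G `<=` [set g | exists2 h, G h & stab 1 h /\ sec h true = g].
  apply: G_min; last 3 first.
  - exists (b ^ a); first exact: (subgroupJ sG Gb Ga).
    by split; [exact: stabJ | rewrite (secJ (stab_rt1 _ b1)) sec_b sec_a conjg1].
  - by exists d; [exact: Gd | rewrite sec_d].
  - by exists b; [exact: Gb | rewrite sec_b].
  split.
  - by exists 1; [exact: (subgroup1 sG) | split; [exact: (subgroup1 s1) | exact: sec1]].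
  - move=> _ _ [h Gh [h1 <-]] [k Gk [k1 <-]]; exists (h * k); first exact: (subgroupM sG).
    by split; [exact: (subgroupM s1) | rewrite secM stab_rt1].
  - move=> _ [h Gh [h1 <-]]; exists h^-1; first exact: (subgroupV sG).
    by split; [exact: (subgroupV s1) | rewrite secV_fix // stab_rt1].
move=> /lift_true[h Gh [h1 <-]]; case: x; first by exists h.
exists (h ^ a); first exact: (subgroupJ sG Gh Ga).
by split; [exact: stabJ | rewrite (secJ (stab_rt1 _ h1)) sec_a conjg1].
Qed.

(** The parity of the number of vertices of level [k] below which [g] swaps the two subtrees. *)
Fixpoint eps k g : bool :=
  if k is k'.+1 then eps k' (sec g false) (+) eps k' (sec g true) else rt g false.

Arguments eps k g : simpl never.
Lemma eps0E g : eps 0 g = rt g false. Proof. by []. Qed.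
Lemma epsS k g : eps k.+1 g = eps k (sec g false) (+) eps k (sec g true).
Proof. by []. Qed.

Lemma epsM k g h : eps k (g * h) = eps k g (+) eps k h.
Proof.
elim: k g h => [|k IHk] g h; first by rewrite !eps0E rtM rt_addb addbC.
rewrite !epsS !secM !IHk [rt h true]rt_addb; case: (rt h false) => /=;
  move: (eps k _) (eps k _) (eps k _) (eps k _); by do 4!case.
Qed.
Lemma eps1 k : eps k 1 = false.
Proof. by have := epsM k 1 1; rewrite mulg1; case: (eps k 1). Qed.
Lemma epsV k g : eps k g^-1 = eps k g.
Proof. by have := epsM k g g^-1; rewrite mulgV eps1; do 2!case: (eps k _). Qed.
Lemma epsJ k g h : eps k (g ^ h) = eps k g.
Proof. by rewrite /conjg !epsM epsV addbC addbK. Qed.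
Lemma epsR k g h : eps k [~ g, h] = false.
Proof. by rewrite /commg epsM epsJ epsV addbb. Qed.

Lemma eps_stab k l g : stab k.+1 g -> l <= k -> eps l g = false.
Proof.
elim: l k g => [|l IHl] k g gk lk; first by have [] := gk false.
case: k => // k in gk lk *.
by rewrite epsS !(IHl k) //; [case: (gk true) | case: (gk false)].
Qed.
Lemma eps0_stab g : eps 0 g = false -> stab 1 g.
Proof. by rewrite eps0E => g0 x; rewrite rt_addb g0 addbF. Qed.

Lemma eps_aS k : eps k.+1 a = false.
Proof. by rewrite epsS !sec_a eps1. Qed.
Lemma eps_bS k : eps k.+1 b = eps k a (+) eps k c.
Proof. by rewrite epsS !sec_b. Qed.
Lemma eps_cS k : eps k.+1 c = eps k a (+) eps k d.
Proof. by rewrite epsS !sec_c. Qed.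
Lemma eps_dS k : eps k.+1 d = eps k b.
Proof. by rewrite epsS !sec_d eps1. Qed.
Lemma eps_a0 : eps 0 a = true. Proof. by []. Qed.
Lemma eps_b0 : eps 0 b = false. Proof. by []. Qed.
Lemma eps_c0 : eps 0 c = false. Proof. by []. Qed.
Lemma eps_d0 : eps 0 d = false. Proof. by []. Qed.
Definition epsE := (eps_a0, eps_b0, eps_c0, eps_d0, eps_aS, eps_bS, eps_cS, eps_dS).

(** Since [G] modulo its commutator subgroup has rank 3, the parities are dependent; this relation
    makes the classes of sections computable from [eps 1] and [eps 2] ([kap_sec]). *)
Lemma eps3 g : G g -> eps 3 g = eps 1 g (+) eps 2 g.
Proof.
move=> Gg; suff S : G `<=` [set g | eps 3 g = eps 1 g (+) eps 2 g] by apply: S.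
apply: G_min => [|||]; last 3 first; try by rewrite /= !epsE.
split=> /= [|u v|u]; rewrite ?eps1 ?epsV // !epsM => -> ->.
by rewrite addbACA.
Qed.

Definition gens (l : 'I_3) : T := nth a [:: a; b; c] l.
Lemma gens_generated : G = generated (range gens).
Proof.
have gensG : range gens `<=` G.
  by move=> _ [[[|[|[|]]] // li] _ <-]; [exact: Ga | exact: Gb | exact: Gc].
apply/seteqP; split; last exact: generated_min sG gensG.
apply: G_min; first exact: generated_subgroup.
- by apply: sub_generated; exists (@Ordinal 3 0 isT).
- by apply: sub_generated; exists (@Ordinal 3 1 isT).
- by apply: sub_generated; exists (@Ordinal 3 2 isT).
Qed.
Lemma gens_2 l : gens l ^+ 2 = 1.
Proof. by rewrite expg2; case: l => [[|[|[|?]]] ?] //=; [exact: aa | exact: bb | exact: cc]. Qed.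

Local Notation C := (commsub G G).

Definition F2 (x : bool) : 'F_2 := ((x : nat)%:R)%R.
Lemma F2_addb x y : F2 (x (+) y) = (F2 x + F2 y)%R.
Proof. by case: x; case: y; apply: val_inj. Qed.

Lemma mem_C g : G g -> eps 0 g = false -> eps 1 g = false -> eps 2 g = false -> C g.
Proof.
move=> Gg g0 g1 g2.
(* The combinations of parities dual to [a], [b], [c]. *)
pose e (l : 'I_3) g := F2 (nth false [:: eps 0 g; eps 2 g; eps 1 g (+) eps 2 g] l).
apply: (comm_of_trivial (e := e) (isT : prime 2) sG gens_generated gens_2) => //.
- move=> l u v _ _; rewrite /e -F2_addb; congr F2.
  by case: l => [[|[|[|?]]] ?] //=; rewrite ?epsM // addbACA.
- by move=> [[|[|[|]]] // li] [[|[|[|]]] // mi]; rewrite /e /gens !epsE.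
- by case=> [[|[|[|]]] // li]; rewrite /e /= ?g0 ?g1 ?g2.
Qed.

Lemma eps_C k g : C g -> eps k g = false.
Proof.
move=> Cg; suff S : C `<=` [set g | eps k g = false] by apply: S.
apply: commsub_min => [|u v _ _]; last exact: epsR.
by split=> /= [|u v|u]; rewrite ?eps1 ?epsV ?epsM // => -> ->.
Qed.

Lemma Gstab g : G g -> stab 3 g -> C g.
Proof. by move=> Gg g3; apply: mem_C => //; apply: eps_stab g3 _. Qed.

Lemma X_inh : inhabited bool. Proof. by apply: inhabits; exact: true. Qed.

Lemma nC : normal_in G C.
Proof. by apply: commsub_normal; [exact: sG|apply: normal_refl; exact: sG|apply: normal_refl; exact: sG]. Qed.

(** * The branching subgroup, normal closure of [a, b] *)

Local Notation t := [~ a, b].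
Definition K : set T := [set g | forall H, normal_in G H -> H t -> H g].

Lemma K_min H : normal_in G H -> H t -> K `<=` H.
Proof. by move=> nH Ht g; apply. Qed.
Lemma Kt : K t. Proof. by []. Qed.
Lemma Gt : G t. Proof. exact: (subgroupR sG Ga Gb). Qed.

Lemma nK : normal_in G K.
Proof.
split.
- split=> [H [sH _ _] _|u v Ku Kv H nH Ht|u Ku H nH Ht].
  + exact: subgroup1.
  + have [sH _ _] := nH; exact: (subgroupM sH (Ku _ nH Ht) (Kv _ nH Ht)).
  + have [sH _ _] := nH; exact: (subgroupV sH (Ku _ nH Ht)).
- by apply: K_min Gt; apply: normal_refl; exact: sG.
- move=> u v Ku Gv H nH Ht; have [_ _ nHG] := nH.
  exact: (nHG _ _ (Ku _ nH Ht) Gv).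
Qed.
Lemma sK : subgroup K. Proof. by case: nK. Qed.
Lemma KG : K `<=` G. Proof. by case: nK. Qed.

Lemma stab1_t : stab 1 t.
Proof. by apply: eps0_stab; rewrite epsR. Qed.
Lemma sec_t x : sec t x = if x then a * c else c * a.
Proof.
rewrite /commg /conjg aV bV !secM !sec_a !rtM !rt_a !rt_b !sec_b !mul1g.
by case: x.
Qed.

Lemma K_eps k g : K g -> eps k g = false.
Proof.
move=> Kg; apply: eps_C; move: g Kg; apply: K_min; first exact: nC.
by apply: mem_commsub; [exact: Ga | exact: Gb].
Qed.
Lemma K_eps_sec g : K g -> eps 2 (sec g false) = false.
Proof.
move=> Kg; suff S : K `<=` [set g | G g /\ forall x, [/\ eps 0 g = false, eps 1 g = false,
  eps 2 g = false & eps 2 (sec g x) = false]] by have [_ /(_ false)[]] := S _ Kg.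
apply: K_min => [|/=]; last first.
  split=> [|x]; first exact: Gt.
  by rewrite !epsR sec_t; split=> //; case: x; rewrite epsM !epsE.
split=> [|u []//|u v [Gu Hu] Gv]; last first.
  split=> [|x]; first exact: (subgroupJ sG Gu Gv).
  have [u0 u1 u2 _] := Hu x; have [_ _ _ us] := Hu (rt v x).
  by rewrite !epsJ (secJ (stab_rt1 _ (eps0_stab u0))) epsJ.
split=> /=.
- by split=> [|x]; [exact: (subgroup1 sG) | rewrite sec1 !eps1].
- move=> u v [Gu Hu] [Gv Hv]; split=> [|x]; first exact: (subgroupM sG Gu Gv).
  have [u0 u1 u2 us] := Hu x; have [v0 v1 v2 vs] := Hv x.
  by rewrite secM (stab_rt1 _ (eps0_stab v0)) !epsM u0 u1 u2 us v0 v1 v2 vs.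
- move=> u [Gu Hu]; split=> [|x]; first exact: (subgroupV sG Gu).
  have [u0 u1 u2 us] := Hu x.
  by rewrite (secV_fix (stab_rt1 _ (eps0_stab u0))) !epsV u0 u1 u2 us.
Qed.

Local Notation z := [~ a, d].
Lemma sec_z x : sec z x = b.
Proof.
rewrite /commg /conjg aV dV !secM !sec_a !rtM !rt_a !rt_d !sec_d !mul1g.
by case: x; rewrite ?mulg1 ?mul1g.
Qed.
Lemma zz : z * z = 1.
Proof.
have z1 x : rt z x = x by apply: stab_rt1; apply: eps0_stab; rewrite epsR.
by apply: tree_aut_eq => x; [rewrite rtM !z1 | rewrite secM z1 !sec_z bb sec1].
Qed.
Lemma adz : a * d = d * a * z.
Proof. by rewrite /commg /conjg aV dV !mulgA -[d * a * a]mulgA aa mulg1 dd mul1g. Qed.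
Lemma az : a * z = z * a.
Proof.
have zV : z^-1 = z by rewrite invK_eq ?zz.
by rewrite -{2}zV invgR /commg /conjg aV dV !mulgA aa !mul1g -!mulgA aa mulg1.
Qed.

(* Representatives of the 16 cosets of [K]. *)
Definition rep (i j k l : bool) : T := b ^+ i * (d ^+ j * (a ^+ k * z ^+ l)).

Definition covered : set T := [set g | exists i j k l, K (g * (rep i j k l)^-1)].

Lemma covered_left g h : G g -> covered h ->
  (forall i j k l, exists i' j' k' l', K (g * rep i j k l * (rep i' j' k' l')^-1)) ->
  covered (g * h).
Proof.
move=> Gg [i [j [k [l Kh]]]] /(_ i j k l)[i' [j' [k' [l' Kg]]]].
exists i', j', k', l'; have [sK' _ nKG] := nK.
have := subgroupM sK' (nKG _ _ Kh (subgroupV sG Gg)) Kg.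
by rewrite /conjg !gnorm.
Qed.

Lemma G_covered : G `<=` covered.
Proof.
(* The left multipliers preserving [covered] form a subgroup, so it suffices to let the generators
   act on the representatives. *)
pose H := [set g | forall h, covered h <-> covered (g * h)].
have sH : subgroup H.
  split=> [h|u v Hu Hv h|u Hu h]; first by rewrite mul1g.
    by rewrite -mulgA -Hu; apply: Hv.
  by have := Hu (u^-1 * h); rewrite mulKVg => ->.
have inv g : g * g = 1 -> (forall h, covered h -> covered (g * h)) -> H g.
  by move=> gg gH h; split=> [/gH //|/gH]; rewrite mulgA gg mul1g.
have K1 : K 1 := subgroup1 sK.
have Ha : H a.
  apply: inv aa _ => h Ch; apply: covered_left Ga Ch _ => i j k l.
  exists i, j, (~~ k), (l (+) j).
  have e : a * (d ^+ j * (a ^+ k * z ^+ l)) = d ^+ j * (a ^+ (~~ k) * z ^+ (l (+) j)).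
    case: j => /=; rewrite ?mul1g; last first.
      by rewrite addbF; case: k; rewrite /= ?mulgA ?aa ?mul1g ?mulg1.
    move: z adz az zz => z adz az zz.
    have aK w : w * a * a = w by rewrite -mulgA aa mulg1.
    have zK w : w * z * z = w by rewrite -mulgA zz mulg1.
    have zaC w : w * z * a = w * a * z by rewrite -mulgA -az mulgA.
    by rewrite !mulgA adz; case: k; case: l; rewrite /= ?expg0 ?expg1 ?mulg1 ?mulgA ?zaC ?aK ?zK.
  case: i; rewrite /rep /= ?mul1g ?e ?mulgV //.
  have tba : t * (b * a) = a * b.
    by rewrite /commg /conjg aV bV -!mulgA [b * (b * _)]mulgA bb mul1g aa mulg1.
  rewrite (mulgA a b) -tba -(mulgA t) -(mulgA b) e.
  by rewrite mulgK.
have Hb : H b.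
  apply: inv bb _ => h Ch; apply: covered_left Gb Ch _ => i j k l.
  by exists (~~ i), j, k, l; case: i; rewrite /rep /= ?mul1g ?mulgV // mulgA bb mul1g mulgV.
have Hd : H d.
  apply: inv dd _ => h Ch; apply: covered_left Gd Ch _ => i j k l.
  exists i, (~~ j), k, l; suff <- : d * rep i j k l = rep i (~~ j) k l by rewrite mulgV.
  rewrite /rep !mulgA (_ : d * b ^+ i = b ^+ i * d); last first.
    by case: i; rewrite /= ?mulg1 ?mul1g // db bd.
  by case: j; rewrite /= ?mulg1 // -[_ * d * d]mulgA dd mulg1.
have Hc : H c by rewrite -bd; exact: (subgroupM sH Hb Hd).
move=> g /(G_min sH Ha Hb Hc)/(_ 1); rewrite mulg1 => -[+ _]; apply.
by exists false, false, false, false; rewrite /rep /= !expg0 !mulg1 invg1 mulg1.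
Qed.

(** The parities kill the exponents of [b], [d] and [a] in the coset representative, and [K_eps_sec]
    kills that of [z]; the latter needs level 3 of a first-level section, hence level 4. *)
Lemma K_stab4 g : G g -> stab 4 g -> K g.
Proof.
move=> Gg g4; have [i [j [k [l Kg]]]] := G_covered Gg.
have [e0 e1 e2] : [/\ eps 0 g = false, eps 1 g = false & eps 2 g = false].
  by split; apply: (eps_stab (k := 3) g4).
have es : eps 2 (sec g false) = false.
  by apply: (@eps_stab 2) => //; case: (g4 false).
have eX q h (m : bool) : eps q (h ^+ m) = m && eps q h.
  by case: m => //=; rewrite expg0 eps1.
have z1 : stab 1 z by apply: eps0_stab; rewrite epsR.
have := K_eps 0 Kg; have := K_eps 1 Kg; have := K_eps 2 Kg.
rewrite /rep !epsM !epsV !epsM !eX !epsE !epsR e0 e1 e2 /= !andbF !andbT !addbF !addFb.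
move=> ij i0 k0; move: ij Kg; rewrite i0 k0 addFb => ->; rewrite /rep !expg0 !mul1g.
case: l => [/K_eps_sec|]; last by rewrite invg1 mulg1.
by rewrite expg1 secM (secV_fix (stab_rt1 _ z1)) (rtV_fix (stab_rt1 _ z1)) epsM epsV sec_z es !epsE.
Qed.

Lemma nKG : normal_in G (commsub K G).
Proof. by apply: commsub_normal; [exact: sG | exact: nK | apply: normal_refl; exact: sG]. Qed.

Lemma emb_true_t : [~ t, d] = emb true (t ^ c).
Proof.
have [b1 c1 d1] := stab_bcd; have t1 := stab1_t.
apply: tree_aut_eq => y.
  by apply: stab_rt1; exact: (subgroupR (stab_subgroup _ 1) t1 d1).
rewrite (secR_fix (stab_rt1 _ t1) (stab_rt1 _ d1)) sec_emb sec_t sec_d.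
case: y; last by rewrite commg1.
by rewrite /commg /conjg !invgM aV bV cV !mulgA -(mulgA _ c b) cb -[in RHS](mulgA _ b c) bc.
Qed.

Lemma emb_comm x k : K k -> commsub K G (emb x k).
Proof.
have e_t : K `<=` rigid (commsub K G) true.
  have nR := rigid_G_normal Gsec Glift true nKG; apply: K_min => //.
  have [_ _ nRR] := nR; rewrite -[t](conjgK c); apply: nRR; last exact: (subgroupV sG Gc).
  by rewrite /rigid /= -emb_true_t; apply: mem_commsub; [exact: Kt | exact: Gd].
move=> Kk; case: x; first exact: e_t.
have [_ _ nKGG] := nKG.
rewrite -(_ : emb true k ^ a = emb false k); last by rewrite embJ aV /= sec_a conjg1.
by apply: nKGG; [exact: e_t | exact: Ga].
Qed.

Lemma commKG_sub : commsub K G `<=` K.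
Proof. by apply: commsub_min; [exact: sK | move=> u v Ku Gv; apply: (subgroupRl nK)]. Qed.

Lemma K_emb x k : K k -> K (emb x k).
Proof. by move=> /(emb_comm x)/commKG_sub. Qed.

(** * Centralisers of [K] modulo a normal subgroup *)

Definition centr L : set T := [set g | G g /\ forall h, K h -> L [~ h, g]].

Lemma centr_normal L : normal_in G L -> normal_in G (centr L).
Proof.
move=> nL; have [sL LG nLG] := nL; split; first split.
- split; first exact: (subgroup1 sG).
  by move=> h _; rewrite commg1; apply: subgroup1.
- move=> u v [Gu Lu] [Gv Lv]; split=> [|h Kh]; first exact: (subgroupM sG).
  have [_] := subgroupM (commutant_subgroup sG nL (KG Kh)) (conj Gu (Lu _ Kh)) (conj Gv (Lv _ Kh)).
  by [].
- move=> u [Gu Lu]; split=> [|h Kh]; first exact: (subgroupV sG).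
  have [_] := subgroupV (commutant_subgroup sG nL (KG Kh)) (conj Gu (Lu _ Kh)).
  by [].
- by move=> u [].
move=> u v [Gu Lu] Gv; split=> [|h Kh]; first exact: (subgroupJ sG).
have [_ _ nKG'] := nK; have GvV := subgroupV sG Gv.
rewrite -[h](conjgKV v) -conjRg; apply: nLG => //; apply: Lu; exact: nKG'.
Qed.

Lemma rigid_normal_G L y : normal_in G L -> normal_in G (rigid L y).
Proof. exact: (rigid_G_normal Gsec Glift). Qed.

Lemma centr_sec L g y : centr L g -> stab 1 g -> centr (rigid L y) (sec g y).
Proof.
move=> [Gg Lg] g1; split=> [|h Kh]; first exact: Gsec.
by rewrite /rigid /= -(embR_fix _ (stab_rt1 _ g1)); apply: Lg; apply: K_emb.
Qed.

(* Going down one level at a time, the centralisers of [K] contain [K], then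
   [a * c], then [b] and [a * d], then everything. *)
Lemma centr_ac L y : normal_in G L -> K `<=` centr L -> centr (rigid L y) (a * c).
Proof.
move=> nL /(_ _ Kt)/(centr_sec y)/(_ stab1_t); rewrite sec_t; case: y => //.
have [sZ _ _] := centr_normal (rigid_normal_G false nL).
by move=> /(subgroupV sZ); rewrite invgM aV cV.
Qed.

Lemma centr_b_ad L y : normal_in G L -> centr L (a * c) ->
  centr (rigid L y) b /\ centr (rigid L y) (a * d).
Proof.
move=> nL Lac; have [sZ _ nZ] := centr_normal nL.
have [sZ' _ nZ'] := centr_normal (rigid_normal_G y nL).
split.
  (* The commutator with [d] and the square of [a * c] stay in [centr L] and fix the first level;
     their sections are [b] or [b ^ a], and [a * d] or its inverse. *)
  have := subgroupM sZ (subgroupV sZ Lac) (nZ _ _ Lac Gd); rewrite -commgEl.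
  have s1 : stab 1 [~ a * c, d] by apply: eps0_stab; rewrite epsR.
  move=> /(centr_sec y)/(_ s1).
  have -> : sec [~ a * c, d] y = if y then b else b ^ a.
    rewrite /commg /conjg invgM aV cV dV.
    by case: (y); do !rewrite !secE /=; rewrite ?mul1g ?mulg1 // !mulgA dd mul1g.
  case: (y) nZ' => // nZ' Zb; rewrite -[b](conjgK a); apply: nZ' => //.
  exact: (subgroupV sG Ga).
have s1 : stab 1 ((a * c) * (a * c)) by apply: eps0_stab; rewrite !epsM !epsE.
have := centr_sec y (subgroupM sZ Lac Lac) s1.
case: (y) sZ' => sZ'; do !rewrite !secE /=; rewrite ?mul1g ?mulg1 //.
by move=> /(subgroupV sZ'); rewrite invgM aV dV.
Qed.

Lemma centr_all L y : normal_in G L -> centr L b -> centr L (a * d) ->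
  G `<=` centr (rigid L y).
Proof.
move=> nL Lb Lad; have [sZ _ nZ] := centr_normal nL; have [b1 _ _] := stab_bcd.
have [sZ' _ _] := centr_normal (rigid_normal_G y nL).
have s1 : stab 1 ((a * d) * (a * d)) by apply: eps0_stab; rewrite !epsM !epsE.
have Zb : centr (rigid L y) b.
  have := centr_sec y (subgroupM sZ Lad Lad) s1.
  by case: (y); do !rewrite !secE /=; rewrite ?mul1g ?mulg1.
have Zx x : centr (rigid L y) (sec b x).
  have [<-|xy] := eqVneq y x; first exact: centr_sec.
  have := centr_sec y (nZ _ _ Lb Ga) (stabJ a b1).
  rewrite (secJ (stab_rt1 _ b1)) sec_a conjg1 rt_a.
  by have -> : ~~ y = x by case: (x) (y) xy => -[].
apply: (G_min sZ') => //.
- by have := Zx false; rewrite sec_b.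
- by have := Zx true; rewrite sec_b.
Qed.

(** One factor of [[~ emb x h^-1, g]] sits at the other letter and commutes with [emb x k]. Only
    commutators with [g] are assumed in [N], because [g] will be a section of an element of a rigid
    stabiliser. *)
Lemma moving_comm N g x h k : normal_in G N -> eps 0 g ->
  (forall h, K h -> N [~ emb x h, g]) -> K h -> K k -> N (emb x [~ h, k]).
Proof.
move=> nN g0 Ng Kh Kk.
have := subgroupRl nN (Ng _ (subgroupV sK Kh)) (KG (K_emb x Kk)).
suff -> : [~ [~ emb x h^-1, g], emb x k] = emb x [~ h, k] by [].
have rE y : rt [~ emb x h^-1, g] y = y.
  by apply: stab_rt1; apply: eps0_stab; rewrite epsR.
have sEx : sec [~ emb x h^-1, g] x = h.
  rewrite commgEl -embV invgK embJ secM rt_emb sec_embE sec_emb.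
  have -> : rt g^-1 x = ~~ x by rewrite rt_addb -eps0E epsV g0 addbT.
  by case: (x); rewrite /= mulg1.
apply: tree_aut_eq => y; first by apply: stab_rt1; apply: eps0_stab; rewrite epsR.
rewrite secR_fix // !sec_emb; case: eqP => [->|_]; last by rewrite commg1.
by rewrite sEx.
Qed.

(** By [K_eps_sec] the sections of [K] do not exhaust [G], so elements of [G] cannot be lifted into
    [K], and the descent through centralisers takes the place of lifting. It uses [x], one level for
    each of [centr_ac], [centr_b_ad] and [centr_all], and a last one for [emb_comm]. *)
Lemma moving_contains N g : normal_in G N -> eps 0 g ->
  (forall x h, K h -> N [~ emb x h, g]) -> contains_level K 5 N.
Proof.
move=> nN g0 Ng [|x [|y1 [|y2 [|y3 [|w []]]]]] // k _ Kk /=.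
have nx := rigid_normal_G x nN; have n1 := rigid_normal_G y1 nx.
have n2 := rigid_normal_G y2 n1; have n3 := rigid_normal_G y3 n2.
have Kx : K `<=` centr (rigid N x).
  move=> u Ku; split=> [|h Kh]; first exact: KG.
  exact: (moving_comm nN g0 (Ng x)).
have [Zb Zad] := centr_b_ad y2 n1 (centr_ac y1 nx Kx).
have Zall := centr_all y3 n2 Zb Zad.
suff : commsub K G `<=` rigid (rigid (rigid (rigid N x) y1) y2) y3.
  by move=> /(_ _ (emb_comm w Kk)).
by apply: commsub_min; [case: n3 | move=> h u Kh /Zall[_]; apply].
Qed.

Lemma secs_full_dense M x : dense G M -> G `<=` secs M x -> G `<=` M.
Proof.
move=> dM fMx; have [sM MG dMG] := dM.
apply: (dense_full (isT : prime 2) X_inh sG Gsec Gpow K_stab4 K_emb dM) => q.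
have fM y : G `<=` secs M y.
  exact: (secs_full (isT : prime 2) X_inh sG Gsec Gpow Gtrans Gstab _ dM fMx).
have nR := rigid_normal Gsec dM (fM q).
have [b1 c1 d1] := stab_bcd.
(* With two letters, one use of [dense_kill] gives an element of [M] supported below [q], whose
   section is congruent to [b]. *)
pose g := if q then d else d ^ a.
have [Gg g1 [gz gnz]] : [/\ G g, stab 1 g & sec g q = b /\ sec g (~~ q) = 1].
  rewrite /g; case: (q); first by split; [exact: Gd | exact: d1 | rewrite !sec_d].
  split; [exact: (subgroupJ sG Gd Ga) | exact: stabJ |].
  by rewrite !(secJ (stab_rt1 _ d1)) !rt_a !sec_d !sec_a conj1g conjg1.
have [m [Mm m1 mnz mC]] := dense_kill (isT : prime 2) X_inh sG Gsec Gpow Gfree Gstab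
  dM (fM (~~ q)) Gg g1 gnz.
have Rr : rigid M q (sec m q).
  rewrite /rigid /= (_ : emb q (sec m q) = m) //; apply/esym/tree_aut_eq => y.
    exact: stab_rt1.
  rewrite sec_emb; case: eqP => [->//|/eqP yz].
  by rewrite -mnz; congr (sec m _); case: y q yz {nR g Gg g1 gz gnz mnz mC} => -[].
move: (sec m q) Rr (mC q) => r Rr /eps_C rb; rewrite gz in rb.
have er k : eps k r = eps k b by have := rb k; rewrite epsM epsV; case: (eps k r); case: (eps k b).
have [sR RG nRG] := nR; have Gr := RG _ Rr.
have r1 : stab 1 r by apply: eps0_stab; rewrite er.
(* As [eps 1 r] is odd, exactly one section of [r] moves the letters, and conjugation by [a] puts it
   at [v] if needed. The levels are one for [v] and five for [moving_contains]. *)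
exists 6 => -[|v u] // k [un] Kk.
have [r' [Rr' r'1 mv]] : exists r', [/\ rigid M q r', stab 1 r' & eps 0 (sec r' v)].
  have : eps 1 r = true by rewrite er !epsE.
  rewrite epsS => e1; case rv : (eps 0 (sec r v)); first by exists r.
  exists (r ^ a); split; [exact: nRG Rr Ga | exact: stabJ |].
  rewrite (secJ (stab_rt1 _ r1)) sec_a conjg1 rt_a.
  by case: (v) rv e1 => /= ->; rewrite ?addbF ?addFb => ->.
apply: (moving_contains (rigid_normal_G v nR) mv) un Kk => y h Kh.
rewrite /rigid /= -(embR_fix _ (stab_rt1 _ r'1)) -/(rigid M q _).
exact: (subgroupRr nR (KG (K_emb v (K_emb y Kh))) Rr').
Qed.

Lemma dense_secs_grig M x : dense G M -> dense G (secs M x).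
Proof. exact: (dense_secs (isT : prime 2) X_inh sG Gsec Gpow Glift Gstab). Qed.

(** * Locating conjugates of two of b, c, d *)

Definition located M g := exists2 f, G f & M (g ^ f).

Lemma located_mem M g : M g -> located M g.
Proof. by move=> Mg; exists 1; [exact: (subgroup1 sG) | rewrite conjg1]. Qed.

Lemma located_X M g n : subgroup M -> located M g -> located M (g ^+ n).
Proof. by move=> sM [f Gf Mg]; exists f => //; rewrite conjXg; apply: subgroupX. Qed.

Lemma locatedJ M g h : G h -> located M (g ^ h) -> located M g.
Proof. by move=> Gh [f Gf Mg]; exists (h * f); [exact: (subgroupM sG) | rewrite conjgM]. Qed.

Lemma located_sec M g x y : dense G M -> located M g -> rt g x = x ->
  located (secs M y) (sec g x).
Proof.
move=> dM [f Gf Mg] gx; have [sM MG _] := dM.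
have [w Mw wy] := dense_trans (isT : prime 2) X_inh sG Gsec Gpow Gtrans Gstab
  (rt f^-1 x) y dM.
have fx : rt f (rt f^-1 x) = x by rewrite rtKV.
exists (sec f (rt f^-1 x) * (sec w (rt f^-1 x))^-1).
  by apply: (subgroupM sG); [apply: Gsec | apply: (subgroupV sG); apply: Gsec; apply: MG].
rewrite -wy conjgM; apply: secs_transport => //.
rewrite -[X in sec g X]fx -secJ ?fx //; apply: mem_secs => //.
by apply: rtJ_fix; rewrite fx.
Qed.

(* [vel] parametrises the Klein four-group {1, b, c, d}; in these coordinates
   its section at the letter 1 is the linear map [sg]. *)
Definition vel (i : bool * bool) : T :=
  if i.1 then if i.2 then b else c else if i.2 then d else 1.
Definition sg (i : bool * bool) : bool * bool := (i.2, i.1 (+) i.2).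
Definition vadd (i j : bool * bool) : bool * bool := (i.1 (+) j.1, i.2 (+) j.2).
(** The class of [g] modulo the commutator subgroup and [a], as an element of the Klein
    four-group. *)
Definition kap g : bool * bool := (eps 1 g, eps 2 g).
Local Notation v0 := (false, false).

Lemma velM i j : vel i * vel j = vel (vadd i j).
Proof.
by case: i j => [[] []] [[] []]; rewrite /vel /= ?mul1g ?mulg1 //
  ?bb ?cc ?dd ?bc ?cd ?db ?cb ?dc ?bd.
Qed.
Lemma velV i : (vel i)^-1 = vel i.
Proof. by apply: invK_eq; rewrite velM; case: i => [[] []]. Qed.
Lemma G_vel i : G (vel i).
Proof. by case: i => [[] []]; [exact: Gb | exact: Gc | exact: Gd | exact: (subgroup1 sG)]. Qed.
Lemma kap_vel i : kap (vel i) = i.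
Proof. by case: i => [[] []]; rewrite /kap /vel /= ?eps1 ?epsE. Qed.
Lemma eps0_vel i : eps 0 (vel i) = false.
Proof. by case: i => [[] []]; rewrite /vel /= ?eps1 ?epsE. Qed.
Lemma rt_vel i x : rt (vel i) x = x.
Proof. by apply: stab_rt1; apply: eps0_stab; apply: eps0_vel. Qed.
Lemma sec_vel1 i : sec (vel i) true = vel (sg i).
Proof. by case: i => [[] []]; rewrite /vel /= ?sec1 ?secE. Qed.
Lemma sec_vel0 i : sec (vel i) false = if i.1 then a else 1.
Proof. by case: i => [[] []]; rewrite /vel /= ?sec1 ?secE. Qed.
Lemma sg_eq i j : (sg i == sg j) = (i == j).
Proof. by case: i j => [[] []] [[] []]. Qed.
Lemma sg_eq0 i : (sg i == v0) = (i == v0).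
Proof. by case: i => [[] []]. Qed.

Definition A : set T := [set g | g = 1 \/ g = a].
Definition B : set T := range vel.

Lemma sA : subgroup A.
Proof.
split; first by left.
  by move=> _ _ [->|->] [->|->]; rewrite ?mul1g ?mulg1 ?aa; [left|right|right|left].
by move=> _ [->|->]; rewrite ?invg1 ?aV; [left | right].
Qed.
Lemma sB : subgroup B.
Proof.
split; first by exists v0.
  by move=> _ _ [i _ <-] [j _ <-]; rewrite velM; exists (vadd i j).
by move=> _ [i _ <-]; rewrite velV; exists i.
Qed.
Lemma Asec g x : A g -> sec g x = 1.
Proof. by move=> [->|->]; rewrite ?sec1 ?sec_a. Qed.
Lemma Bfix g x : B g -> rt g x = x.
Proof. by move=> [i _ <-]; apply: rt_vel. Qed.
Lemma BsecA g x : B g -> x != true -> A (sec g x).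
Proof.
move=> [i _ <-]; case: x => // _; rewrite sec_vel0.
by case: ifP => _; [right | left].
Qed.
Lemma BsecB g : B g -> B (sec g true).
Proof. by move=> [i _ <-]; rewrite sec_vel1; exists (sg i). Qed.
Lemma AG : A `<=` G.
Proof. by move=> _ [->|->]; [exact: (subgroup1 sG) | exact: Ga]. Qed.
Lemma BG : B `<=` G. Proof. by move=> _ [i _ <-]; apply: G_vel. Qed.

Local Notation ball := (ball A B).

Lemma G_ball g : G g -> exists m, ball m g.
Proof.
apply: (ball_generated sA sB) => _ [[[->|->]|->]|->]; [by left; right| | |]; right.
- by exists (true, true).
- by exists (true, false).
- by exists (false, true).
Qed.
Lemma ball_G m g : ball m g -> G g.
Proof. exact: (ball_sub sG AG BG). Qed.

Lemma ball1_conj g : ball 1 g -> eps 0 g = false -> exists i h, G h /\ g = vel i ^ h.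
Proof.
move E: 1%N => m bg; case: bg E => // {}m {}g _ a1 bg [i _ <-] Aa1 [E].
case: bg E => // a2 Aa2 _; rewrite !epsM eps0_vel addbF => e.
exists i, a1; split; first exact: AG.
rewrite /conjg mulgA; congr (_ * _ * _).
by case: Aa1 Aa2 e => [->|->] [->|->]; rewrite ?invg1 ?aV ?eps1 ?epsE.
Qed.

Lemma kapJ g h : kap (g ^ h) = kap g. Proof. by rewrite /kap !epsJ. Qed.

Lemma kap_sec g : G g -> vadd (kap (sec g false)) (kap (sec g true)) = sg (kap g).
Proof. by move=> Gg; rewrite /sg /kap /= -eps3 // !epsS. Qed.

Lemma eps_sec_sq k g : eps 0 g -> eps k (sec (g ^+ 2) false) = eps k.+1 g.
Proof.
by rewrite eps0E expg2 secM epsM => ->; rewrite epsS addbC.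
Qed.

Lemma kap_sec_sq g : G g -> eps 0 g -> kap (sec (g ^+ 2) false) = sg (kap g).
Proof. by move=> Gg g0; rewrite /kap !eps_sec_sq // eps3. Qed.

Section Phase1.
Variable nz : bool.
Hypothesis final : forall M i j, dense G M -> (i != v0) = nz -> j != v0 -> j != i ->
  located M (vel i) -> located M (vel j) -> reach G M.

(** The phase is run twice: with [nz] false only the trivial element is located beforehand; with
    [nz] true one of b, c, d is, and a different one is sought. *)
Definition ready M i m g := [/\ dense G M, (i != v0) = nz, located M (vel i) &
  [/\ located M g, ball m g, kap g != v0 & kap g != i]].

Lemma ready_move M i m g : ready M i m g -> eps 0 g ->
  ready (secs M false) (sg i) m (sec (g ^+ 2) false).
Proof.
move=> [dM iz Li [Lg bg g0 gi]] mg; have Gg := ball_G bg; have [sM _ _] := dM.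
have gg2 x : rt (g ^+ 2) x = x by apply: Gpow.
split; rewrite ?kap_sec_sq ?sg_eq0 ?sg_eq //; first exact: dense_secs_grig.
  by rewrite -sec_vel1; apply: located_sec => //; apply: rt_vel.
split=> //; first by apply: located_sec => //; apply: located_X.
  apply: (ball_secX sA sB Asec Bfix BsecA BsecB bg) => k l.
  rewrite !mem_iota !add0n; move: mg; rewrite eps0E.
by case: k l => [|[|k]] [|[|l]] //; rewrite rt1 expg1 => ->.
Qed.

(* Both kinds of step apply [sg] to the classes of [g] and of [vel i], so the
   condition that the class of [g] avoids 0 and [i] is preserved; the classes of
   moving elements run through b, c, d and then stop moving. *)
Lemma ready_reach m M i g : ready M i m g -> reach G M.
Proof.
elim/ltn_ind: m M i g => m IHm.
have fixed M i g : ready M i m g -> eps 0 g = false -> reach G M.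
  move=> [dM iz Li [Lg bg g0 gi]] e0; have Gg := ball_G bg.
  have [m1|m2] := leqP m 1.
    have [j [h [Gh gE]]] := ball1_conj (ball_leq sA sB m1 bg) e0.
    rewrite gE kapJ kap_vel in g0 gi Lg.
    exact: (final dM iz g0 gi Li (locatedJ Gh Lg)).
  (* Otherwise both classes would lie in the subgroup formed by 0 and [sg i], and so would their sum
     [sg (kap g)]. *)
  have [x kx] : exists x, (kap (sec g x) != v0) && (kap (sec g x) != sg i).
    have := kap_sec Gg; rewrite -(sg_eq0 (kap g)) -(sg_eq (kap g)) in g0 gi.
    move: (sg (kap g)) (sg i) g0 gi => k l k0 kl e.
    case k1 : ((kap (sec g false) != v0) && (kap (sec g false) != l)); first by exists false.
    exists true; move: k1 k0 kl; rewrite -e.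
    by move: (kap _) (kap _) l => [[] []] [[] []] [[] []].
  have /andP[kx0 kxi] := kx; apply: (@ReachS _ G M x).
  apply: (IHm _ (ltn_uphalf m2) _ (sg i) (sec g x)); split; rewrite ?sg_eq0 //.
  - exact: dense_secs_grig.
  - by rewrite -sec_vel1; apply: located_sec => //; apply: rt_vel.
  - split=> //; last exact: (ball_sec_half sA sB Asec Bfix BsecA BsecB).
    by apply: located_sec => //; apply: stab_rt1; apply: eps0_stab.
move=> M i g r; have GR M' i' g' : ready M' i' m g' -> G g' by case=> _ _ _ [_ /ball_G].
case e0: (eps 0 g); last exact: fixed r e0.
(* The successive elements move the letters according to [eps 0], [eps 1], [eps 2], [eps 3] of [g];
   if the first three are odd, [eps3] makes the last one even. *)
have r1 := ready_move r e0; apply: ReachS; have G1 := GR _ _ _ r1.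
case e1: (eps 0 (sec (g ^+ 2) false)); last exact: fixed r1 e1.
have r2 := ready_move r1 e1; apply: ReachS.
case e2: (eps 0 (sec (sec (g ^+ 2) false ^+ 2) false)); last exact: fixed r2 e2.
have r3 := ready_move r2 e2; apply: ReachS; apply: fixed r3 _.
rewrite (eps_sec_sq 0 e2) (eps_sec_sq 1 e1) (eps_sec_sq 2 e0) (eps3 (GR _ _ _ r)).
move: e1 e2; rewrite (eps_sec_sq 0 e0) => e1; rewrite eps_sec_sq ?(eps_sec_sq _ e0) //.
by rewrite e1 => ->.
Qed.

End Phase1.

Lemma dense_vel M i : dense G M -> exists m g, [/\ M g, ball m g & kap g = i].
Proof.
move=> [sM MG /(_ _ (G_vel i))[g Mg gi]]; have [m bg] := G_ball (MG _ Mg).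
exists m, g; split=> //; rewrite -[in RHS](kap_vel i).
have e k : eps k g = eps k (vel i).
  by have := eps_C k gi; rewrite epsM epsV; case: (eps k g); case: (eps k _).
by rewrite /kap !e.
Qed.

Lemma reach_from_located :
  (forall M i j, dense G M -> i != v0 -> j != v0 -> j != i ->
    located M (vel i) -> located M (vel j) -> reach G M) ->
  forall M, dense G M -> reach G M.
Proof.
move=> final M dM; have [sM _ _] := dM.
have [m [g [Mg bg kg]]] := dense_vel (true, true) dM.
have L1 : located M (vel v0) by apply: located_mem; apply: (subgroup1 sM).
apply: (@ready_reach false _ m M v0 g); last first.
  by split=> //; split; rewrite ?kg //; apply: located_mem.
move=> {M dM sM m g Mg bg kg L1} M i j dM _ j0 _ _ Lj.
have [l /andP[l0 lj]] : exists l, (l != v0) && (l != j).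
  by case: (j) => [[] []]; [exists (true, false)|exists (true, true)|exists (true, true)|exists (true, true)].
have [m [g [Mg bg kg]]] := dense_vel l dM.
apply: (@ready_reach true _ m M j g); last by split=> //; split; rewrite ?kg //; apply: located_mem.
by move=> M' i' j' dM' i0; apply: final.
Qed.

(** * Words and weights of conjugators *)

Variant bcd := Vb | Vc | Vd.
Definition bcd_val (v : bcd) : bool * bool :=
  match v with Vb => (true, true) | Vc => (true, false) | Vd => (false, true) end.
Definition bcd_sg (v : bcd) : bcd := match v with Vb => Vc | Vc => Vd | Vd => Vb end.
Definition bcd_mul (v w : bcd) : option bcd :=
  match v, w with
  | Vb, Vc | Vc, Vb => Some Vd
  | Vc, Vd | Vd, Vc => Some Vb
  | Vb, Vd | Vd, Vb => Some Vc
  | _, _ => None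
  end.
Definition vden (v : bcd) : T := vel (bcd_val v).

(* In a word over {a, b, c, d} the letter a is [None]. *)
Local Notation letter := (option bcd).
Local Notation word := (seq letter).
Implicit Types (l : letter) (u w : word) (v : bcd) (P : word -> nat -> bool).

Definition lden l : T := if l is Some v then vden v else a.
Fixpoint den w : T := if w is l :: w' then lden l * den w' else 1.
Definition lrt l x : bool := if l is Some _ then x else ~~ x.
Fixpoint wrt w x : bool := if w is l :: w' then lrt l (wrt w' x) else x.
Definition lsec l x : word :=
  if l is Some v then
    if x then [:: Some (bcd_sg v)] else if (bcd_val v).1 then [:: None] else [::]
  else [::].
Fixpoint wsec w x : word := if w is l :: w' then lsec l (wrt w' x) ++ wsec w' x else [::].

Lemma vdenM v v' : vden v * vden v' = if bcd_mul v v' is Some v'' then vden v'' else 1.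
Proof. by rewrite /vden velM; case: v v' => [] []. Qed.
Lemma sec_vden v : sec (vden v) true = vden (bcd_sg v).
Proof. by rewrite /vden sec_vel1; case: v. Qed.
Lemma ldenV l : (lden l)^-1 = lden l.
Proof. by case: l => [v|]; [exact: velV | exact: aV]. Qed.
Lemma den_cat u w : den (u ++ w) = den u * den w.
Proof. by elim: u => [|l u IHu] /=; rewrite ?mul1g // IHu mulgA. Qed.
Lemma den_rev w : den (rev w) = (den w)^-1.
Proof.
elim: w => [|l w IHw]; first by rewrite invg1.
by rewrite rev_cons -cats1 den_cat IHw /= mulg1 invgM ldenV.
Qed.
Lemma rt_den w x : rt (den w) x = wrt w x.
Proof.
elim: w => [|l w IHw] //=; rewrite rtM IHw; case: l => [v|] //=.
exact: rt_vel.
Qed.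
Lemma sec_den w x : sec (den w) x = den (wsec w x).
Proof.
elim: w => [|l w IHw]; first exact: sec1.
rewrite /= secM IHw den_cat rt_den; congr (_ * _).
case: l => [v|] /=; last exact: sec_a.
case: (wrt w x); first by rewrite sec_vden /= mulg1.
by rewrite sec_vel0; case: ifP; rewrite //= mulg1.
Qed.

Lemma G_word g : G g -> exists w, g = den w.
Proof.
move=> Gg; suff S : G `<=` [set g | exists w, g = den w] by apply: S.
apply: G_min.
- split; first by exists [::].
  + by move=> _ _ [u ->] [w ->]; exists (u ++ w); rewrite den_cat.
  + by move=> _ [u ->]; exists (rev u); rewrite den_rev.
- by exists [:: None]; rewrite /= mulg1.
- by exists [:: Some Vb]; rewrite /= mulg1.
- by exists [:: Some Vc]; rewrite /= mulg1.
Qed.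

Lemma wrt_addb w x : wrt w x = x (+) wrt w false.
Proof. by rewrite -!rt_den rt_addb. Qed.
Lemma wrtK w : involutive (wrt w).
Proof. by move=> x; rewrite wrt_addb [wrt w x]wrt_addb -addbA addbb addbF. Qed.
Lemma wrtN w x : wrt w (~~ x) = ~~ wrt w x.
Proof. by rewrite wrt_addb [wrt w x]wrt_addb addNb. Qed.

Definition isV l : bool := if l is Some _ then true else false.
Definition push l w : word :=
  match l, w with
  | None, None :: w' => w'
  | Some v, Some v' :: w' => if bcd_mul v v' is Some v'' then Some v'' :: w' else w'
  | _, _ => l :: w
  end.
Definition reduce w : word := foldr push [::] w.
Fixpoint alternating w : bool :=
  if w is l :: w' then
    (if w' is m :: _ then isV l != isV m else true) && alternating w'
  else true.
Definition startsV w : bool := if w is l :: _ then isV l else false.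
Definition startsA w : bool := if w is l :: _ then ~~ isV l else false.
Definition stripA w : word := if w is None :: w' then w' else w.
Definition stripV w : word := if w is Some _ :: w' then w' else w.

Lemma den_push l w : den (push l w) = lden l * den w.
Proof.
case: l w => [v|] [|[v'|] w] //=; last by rewrite mulgA aa mul1g.
by rewrite mulgA vdenM; case: (bcd_mul v v') => [v''|] //=; rewrite mul1g.
Qed.
Lemma den_reduce w : den (reduce w) = den w.
Proof. by elim: w => //= l w IHw; rewrite den_push IHw. Qed.
Lemma conj_stripA w : a ^ den (stripA w) = a ^ den w.
Proof. by case: w => [|[v|] w] //=; rewrite conjgM /conjg mulKg. Qed.
Lemma conj_stripV v w : vden v ^ den (stripV w) = vden v ^ den w.
Proof.
case: w => [|[v'|] w] //=; rewrite conjgM; congr (_ ^ _).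
rewrite /conjg vdenM; apply: (canRL (mulKg _)); rewrite vdenM.
by case: v v' => [] [].
Qed.

Lemma alternating_cons l w : alternating (l :: w) =
  (if w is m :: _ then isV l != isV m else true) && alternating w.
Proof. by []. Qed.
Lemma alternating_push l w : alternating w -> alternating (push l w).
Proof.
case: l w => [v|] [|[v'|] w]; rewrite ?alternating_cons //=; last by case/andP.
by case: (bcd_mul v v') => [v''|] //= /andP[].
Qed.
Lemma alternating_reduce w : alternating (reduce w).
Proof. by elim: w => //= l w; apply: alternating_push. Qed.
Lemma alternating_stripA w : alternating w -> alternating (stripA w).
Proof. by case: w => [|[v|] w] //= /andP[]. Qed.
Lemma alternating_stripV w : alternating w -> alternating (stripV w).
Proof. by case: w => [|[v|] w] //= /andP[]. Qed.
Lemma startsA_stripA w : alternating w -> ~~ startsA (stripA w).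
Proof. by case: w => [|[v|] [|[v'|] w]]. Qed.
Lemma startsV_stripV w : alternating w -> ~~ startsV (stripV w).
Proof. by case: w => [|[v|] [|[v'|] w]]. Qed.

Definition lwt l : nat :=
  match l with None => 3 | Some Vb => 3 | Some Vc => 2 | Some Vd => 1 end.
Fixpoint wt w : nat := if w is l :: w' then lwt l + wt w' else 0.
Fixpoint numV w : nat := if w is l :: w' then isV l + numV w' else 0.
Fixpoint numA w : nat := if w is l :: w' then ~~ isV l + numA w' else 0.

Lemma wt_cat u w : wt (u ++ w) = (wt u + wt w)%N.
Proof. by elim: u => //= l u ->; rewrite addnA. Qed.
Lemma wt_rev w : wt (rev w) = wt w.
Proof. by elim: w => //= l w IHw; rewrite rev_cons -cats1 wt_cat IHw /= addn0 addnC. Qed.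
(** The weights 3, 2, 1 of b, c, d satisfy the triangle inequality, so merging two of these letters
    adds no weight. *)
Lemma wt_push l w : wt (push l w) <= lwt l + wt w.
Proof.
case: l w => [v|] [|[v'|] w] //=; last by rewrite !addnA leq_addl.
rewrite addnA; case: v v' => [] [] //=; rewrite ?leq_addl ?leq_add2r //.
Qed.
Lemma wt_reduce w : wt (reduce w) <= wt w.
Proof.
elim: w => //= l w IHw; apply: leq_trans (wt_push _ _) _.
by rewrite leq_add2l.
Qed.
Lemma wt_stripA w : wt (stripA w) <= wt w.
Proof. by case: w => [|[v|] w] //=; apply: leq_addl. Qed.
Lemma wt_stripV w : wt (stripV w) <= wt w.
Proof. by case: w => [|[v|] w] //=; apply: leq_addl. Qed.

(* The weights are chosen so that the sections of a syllable [a v] weigh one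
   unit less than the syllable itself. *)
Lemma wt_sec w x : (wt (wsec w x) + wt (wsec w (~~ x)) + 3 * numA w = wt w + 2 * numV w)%N.
Proof.
elim: w => [|l w IHw] //=; rewrite wrtN !wt_cat.
have e : (wt (lsec l (wrt w x)) + wt (lsec l (~~ wrt w x)) + 3 * ~~ isV l = lwt l + 2 * isV l)%N.
  by case: (wrt w x); case: l => [[]|].
by move: e IHw; lia.
Qed.

Lemma numV_alternating w : alternating w -> numV w <= numA w + startsV w.
Proof.
elim: w => [|l w IHw] //=; case: w IHw => [|m w] IHw; first by case: l.
by move=> /andP[lm /IHw{IHw}] /=; case: l m lm => [v|] [v'|] //=; lia.
Qed.

(** Transport from the letter [j] to [i] by [a ^ den p], which swaps the two; the appended word
    spells the inverse of its section at [j]. *)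
Definition move_word (p : word) i j w : word :=
  if i (+) j then w ++ rev (wsec p j) ++ wsec p i else w.

Lemma secs_move_word M p i j w h : subgroup M -> M (a ^ den p) ->
  secs M j (h ^ den w) -> secs M i (h ^ den (move_word p i j w)).
Proof.
move=> sM Mp Mh; rewrite /move_word; case ij: (i (+) j); last first.
  by have -> : i = j by case: i j ij {Mh} => -[].
have -> : i = rt (a ^ den p) j.
  by rewrite rt_addb -eps0E epsJ addbT; case: i j ij {Mh} => -[].
have -> : den (w ++ rev (wsec p j) ++ wsec p (rt (a ^ den p) j)) =
    den w * (sec (a ^ den p) j)^-1.
  rewrite !den_cat den_rev -!sec_den /conjg !secM sec_a mul1g secV !rtM.
  by rewrite invgM invgK.
by rewrite conjgM; apply: secs_transport.
Qed.

(* A state stands for the subgroups containing [a ^ den p], [x ^ den f] and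
   [y ^ den g]. *)
Record state := State { s_x : bcd; s_y : bcd; s_p : word; s_f : word; s_g : word }.

Definition models M (s : state) := [/\ M (a ^ den (s_p s)),
  M (vden (s_x s) ^ den (s_f s)) & M (vden (s_y s) ^ den (s_g s))].

(* [pick] chooses which of the two conjugates provides the new conjugate of [a]
   (its section at the letter 0), [i] is the letter of the new subgroup. *)
Definition usable (pick : bool) (s : state) : bool :=
  (bcd_val (if pick then s_x s else s_y s)).1.
Definition step (pick i : bool) (s : state) : state :=
  let: State x y p f g := s in
  let q := if pick then f else g in
  State (bcd_sg x) (bcd_sg y)
    (move_word p i (wrt q false) (wsec q (wrt q false)))
    (move_word p i (wrt f true) (wsec f (wrt f true)))
    (move_word p i (wrt g true) (wsec g (wrt g true))).

Lemma secs_vden M (x : bcd) w : M (vden x ^ den w) ->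
  secs M (wrt w true) (vden (bcd_sg x) ^ den (wsec w (wrt w true))).
Proof.
move=> Mx; have e : rt (den w) (wrt w true) = true by rewrite rt_den wrtK.
rewrite -sec_vden -sec_den -[X in sec (vden x) X]e -secJ ?e ?rt_vel //.
by apply: mem_secs => //; apply: rtJ_fix; rewrite rt_vel.
Qed.
Lemma secs_vden_a M (x : bcd) w : M (vden x ^ den w) -> (bcd_val x).1 ->
  secs M (wrt w false) (a ^ den (wsec w (wrt w false))).
Proof.
move=> Mx xa; have e : rt (den w) (wrt w false) = false by rewrite rt_den wrtK.
have -> : a = sec (vden x) false by rewrite sec_vel0 xa.
rewrite -sec_den -[X in sec (vden x) X]e -secJ ?e ?rt_vel //.
by apply: mem_secs => //; apply: rtJ_fix; rewrite rt_vel.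
Qed.

Lemma models_step M s pick i : subgroup M -> usable pick s -> models M s ->
  models (secs M i) (step pick i s).
Proof.
case: s => x y p f g sM us [/= Ma Mx My]; split => /=; apply: secs_move_word => //.
- by case: pick us => /= us; apply: secs_vden_a us.
- exact: secs_vden.
- exact: secs_vden.
Qed.

Definition normalize (s : state) : state :=
  let: State x y p f g := s in
  State x y (stripA (reduce p)) (stripV (reduce f)) (stripV (reduce g)).
Definition normal (s : state) : bool :=
  [&& alternating (s_p s), ~~ startsA (s_p s), alternating (s_f s), ~~ startsV (s_f s),
      alternating (s_g s) & ~~ startsV (s_g s)].
Definition weight (s : state) : nat := wt (s_p s) + wt (s_f s) + wt (s_g s).
Definition totalV (s : state) : nat := numV (s_p s) + numV (s_f s) + numV (s_g s).
Definition totalA (s : state) : nat := numA (s_p s) + numA (s_f s) + numA (s_g s).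

Lemma models_normalize M s : models M s -> models M (normalize s).
Proof.
case: s => x y p f g [/= Ma Mx My].
by split; rewrite /= ?conj_stripA ?conj_stripV den_reduce.
Qed.
Lemma normal_normalize s : normal (normalize s).
Proof.
case: s => x y p f g; rewrite /normal /= startsA_stripA ?startsV_stripV ?alternating_reduce //.
by rewrite alternating_stripA ?alternating_stripV ?alternating_reduce.
Qed.
Lemma weight_normalize s : weight (normalize s) <= weight s.
Proof.
case: s => x y p f g; rewrite /weight /= !leq_add //.
- exact: leq_trans (wt_stripA _) (wt_reduce _).
- exact: leq_trans (wt_stripV _) (wt_reduce _).
- exact: leq_trans (wt_stripV _) (wt_reduce _).
Qed.

(** The two conjugators read from the picked word sit at opposite letters. With [i] the letter of
    the third one, exactly one transport occurs, so both sections of [p] and of the picked word are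
    used once, and one section of the other word. *)
Lemma weight_step pick s : exists i,
  weight (step pick i s) + 3 * totalA s <= weight s + 2 * totalV s.
Proof.
case: s => x y p f g; exists (wrt (if pick then g else f) true).
rewrite /weight /totalA /totalV /= /move_word.
have wE w : wrt w false = ~~ wrt w true by rewrite -wrtN.
have P := wt_sec p true; have F := wt_sec f (wrt f true); have Gg := wt_sec g (wrt g true).
by case: pick; rewrite !wE; case: (wrt g true) F Gg => F Gg; case: (wrt f true) F Gg => F Gg;
  rewrite /= ?wt_cat ?wt_rev /= in P F Gg *; lia.
Qed.

Definition distinct (s : state) : bool := isSome (bcd_mul (s_x s) (s_y s)).
Lemma distinct_step pick i s : distinct s -> distinct (normalize (step pick i s)).
Proof. by case: s => [[] [] p f g]. Qed.

Definition candidates (s : state) : seq state :=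
  [seq normalize (step pick i s) | pick <- [seq k <- [:: true; false] | usable k s],
                                   i <- [:: false; true]].
Definition lighter (s s' : state) : state := if weight s <= weight s' then s else s'.
(* The weight need not decrease along a greedy run starting from a short state,
   but eight steps suffice to reach weight 0. *)
Definition best (s : state) : state :=
  if candidates s is s' :: r then foldr lighter s' r else s.
Fixpoint solved n (s : state) : bool :=
  (weight s == 0) || (if n is n'.+1 then solved n' (best s) else false).

Arguments solved : simpl never.

Lemma best_ind (P : state -> Prop) s : P s ->
  (forall pick i, usable pick s -> P (normalize (step pick i s))) -> P (best s).
Proof.
move=> Ps Pstep; rewrite /best /candidates /=.
have Pl s1 s2 : P s1 -> P s2 -> P (lighter s1 s2) by rewrite /lighter; case: ifP.
case ut: (usable true s); case uf: (usable false s); rewrite //=; do ?apply: (Pl); exact: Pstep.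
Qed.

Lemma weight0 M s : subgroup M -> models M s -> distinct s -> weight s = 0 -> G `<=` M.
Proof.
case: s => x y p f g sM [/= Ma Mx My] xy /eqP; rewrite /weight /= !addn_eq0.
have w0 w : wt w == 0 -> w = [::] by case: w => [|[[]|] w].
case/andP=> [/andP[/w0 p0 /w0 f0] /w0 g0].
move: Ma Mx My; rewrite p0 f0 g0 !conjg1 => Ma Mx My.
have Mxy := subgroupM sM Mx My.
apply: G_min => //; move: Mx My Mxy; rewrite vdenM.
  by case: x y xy => [] [].
by case: x y xy => [] [].
Qed.

Lemma solved_reach n M s : dense G M -> models M s -> distinct s -> solved n s -> reach G M.
Proof.
elim: n M s => [|n IHn] M s dM Ms xy; rewrite /solved ?orbF -/solved; have [sM _ _] := dM.
  by move/eqP => s0; apply: Reach0; apply: weight0 Ms xy s0.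
case/orP=> [/eqP s0|]; first by apply: Reach0; apply: weight0 Ms xy s0.
apply: (best_ind (P := fun s' => solved n s' -> reach G M)); first exact: IHn.
move=> pick i us sol; apply: (ReachS (x := i)); apply: (IHn _ (normalize (step pick i s))) => //.
- exact: dense_secs_grig.
- by apply: models_normalize; apply: models_step.
- exact: distinct_step.
Qed.

(** * The finite computation *)

Definition bcds := [:: Vb; Vc; Vd].
(** Runs through alternating words that do not start with b, c or d and contain at most [n] of these
    letters. The number passed to [P] is the budget left, so that three words can share one
    bound. *)
Fixpoint all_wordsA n (P : word -> nat -> bool) : bool :=
  [&& P [::] n, P [:: None] n &
    if n is m.+1 then
      all (fun v => all_wordsA m (fun w => P [:: None, Some v & w])) bcds
    else true].
Definition all_wordsV n (P : word -> nat -> bool) : bool :=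
  P [::] n &&
    if n is m.+1 then all (fun v => all_wordsA m (fun w => P (Some v :: w))) bcds
    else true.

Definition small_solved : bool :=
  all_wordsV 3 (fun p k => all_wordsA k (fun f k' => all_wordsA k' (fun w _ =>
    all (fun v => all (fun v' => let s := State v v' p f w in
      if distinct s && (3 * totalA s <= 2 * totalV s) then solved 8 s else true)
      bcds) bcds))).

Lemma small_solvedE : small_solved.
Proof. by vm_compute. Qed.

Lemma all_bcds (P : bcd -> bool) v : all P bcds -> P v.
Proof. by case/and4P=> ? ? ? _; case: v. Qed.

Lemma all_wordsAP n P w : all_wordsA n P -> alternating w -> ~~ startsV w ->
  numV w <= n -> P w (n - numV w).
Proof.
elim: n P w => [|n IHn] P w; case/and3P=> P0 P1 Pr; case: w => [|[?|] [|[v|] w]] //; rewrite ?subn0 // => aw _ wn.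
move: aw wn; rewrite /= add0n add1n subSS ltnS => aw wn.
have := IHn (fun w => P [:: None, Some v & w]) w (all_bcds v Pr); apply=> //.
  by case: (w) aw => //= l w' /andP[].
by case: (w) aw => //= l w' /andP[]; case: l.
Qed.

Lemma all_wordsVP n P w : all_wordsV n P -> alternating w -> ~~ startsA w ->
  numV w <= n -> P w (n - numV w).
Proof.
move=> /andP[P0 Pr]; case: w => [|[v|] w] // aw _; first by rewrite subn0.
case: n P0 Pr => [|n] // P0 Pr; rewrite /= add1n subSS ltnS => wn.
have := all_wordsAP (all_bcds v Pr); apply=> //.
  by case: (w) aw => //= l w' /andP[].
by case: (w) aw => //= l w' /andP[]; case: l.
Qed.

(* [weight_step] makes the weight decrease for all other normal states. *)
Lemma small_states s : normal s -> distinct s -> 3 * totalA s <= 2 * totalV s -> solved 8 s.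
Proof.
case: s => x y p f w /and5P[/= ap np af nf /andP[aw nw]] xy small.
have Vp : numV p <= numA p + 1.
  by apply: leq_trans (numV_alternating ap) _; rewrite leq_add2l; case: (startsV p).
have Vf : numV f <= numA f by have := numV_alternating af; rewrite (negPf nf) addn0.
have Vw : numV w <= numA w by have := numV_alternating aw; rewrite (negPf nw) addn0.
(* Only [p] may start with b, c or d, so the totals satisfy V <= A + 1; together with 3 A <= 2 V
   this gives V <= 3. *)
have [n3 [n2 n1]] : numV p <= 3 /\ numV f <= 3 - numV p /\ numV w <= 3 - numV p - numV f.
  by move: small; rewrite /totalA /totalV /=; lia.
have := all_wordsVP small_solvedE ap np n3.
move=> /all_wordsAP/(_ af nf n2)/all_wordsAP/(_ aw nw n1)/all_bcds-/(_ x)/all_bcds-/(_ y) /=.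
by rewrite xy small.
Qed.

Lemma models_reach M s : dense G M -> models M s -> normal s -> distinct s -> reach G M.
Proof.
have [n] := ubnP (weight s); elim: n M s => // n IHn M s sn dM Ms ns xy.
have [small|large] := leqP (3 * totalA s) (2 * totalV s).
  exact: solved_reach dM Ms xy (small_states ns xy small).
have [pick us] : exists pick, usable pick s.
  by case: (s) xy => [[] [] p f g] // _; by [exists true | exists false].
have [i wi] := weight_step pick s; have [sM _ _] := dM.
apply: (ReachS (x := i)); apply: (IHn _ (normalize (step pick i s))).
- apply: leq_ltn_trans (weight_normalize _) _.
  by move: sn wi large; lia.
- exact: dense_secs_grig.
- by apply: models_normalize; apply: models_step.
- exact: normal_normalize.
- exact: distinct_step.
Qed.

Lemma dense_reach M : dense G M -> reach G M.
Proof.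
move: M; apply: reach_from_located => M i j dM i0 j0 ji Li Lj.
have vE k : k != (false, false) -> exists v, k = bcd_val v.
  by case: k => [[] []] //; [exists Vb | exists Vc | exists Vd].
have [x xE] := vE i i0; have [y yE] := vE j j0; rewrite xE yE in ji Li Lj.
have dM1 := dense_secs_grig true dM.
have Lx : located (secs M true) (vden (bcd_sg x)).
  by rewrite -sec_vden; apply: located_sec => //; apply: rt_vel.
have Ly : located (secs M true) (vden (bcd_sg y)).
  by rewrite -sec_vden; apply: located_sec => //; apply: rt_vel.
(* Two distinct elements among b, c, d are not both d, so one of them has section [a] at the letter
   0. *)
have La : located (secs M true) a.
  have [xa|xa] := boolP (bcd_val x).1.
    have -> : a = sec (vel (bcd_val x)) false by rewrite sec_vel0 xa.
    by apply: located_sec => //; apply: rt_vel.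
  have -> : a = sec (vel (bcd_val y)) false.
    by rewrite sec_vel0; case: x y xa ji {xE yE Li Lj Lx Ly} => [] [].
  by apply: located_sec => //; apply: rt_vel.
have [f /G_word[f' ->] Mf] := Lx; have [g /G_word[g' ->] Mg] := Ly.
have [q /G_word[q' ->] Mq] := La.
apply: (ReachS (x := true)).
have Ms : models (secs M true) (State (bcd_sg x) (bcd_sg y) q' f' g') by [].
apply: (models_reach dM1 (models_normalize Ms) (normal_normalize _)).
by case: x y ji {xE yE Li Lj Lx Ly La Mf Mg Ms} => [] [].
Qed.

Lemma grigorchuk_frattini M : dense G M -> G `<=` M.
Proof.
move=> dM; apply: (reach_full (isT : prime 2) X_inh sG Gsec Gpow Glift Gstab _ dM (dense_reach dM)).
exact: secs_full_dense.
Qed.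

Lemma grigorchuk_connected n : 3 < n -> graph_connected (nielsen_edge n G).
Proof.
move=> n4; apply: (nielsen_connected (isT : prime 2) sG gens_generated gens_2 _ n4).
exact: grigorchuk_frattini.
Qed.

End Grigorchuk.

Theorem corollary1p4 :
  (forall n : nat, (4 <= n)%N ->
     graph_connected (nielsen_edge n grigorchuk_group)) /\
  (forall p : nat, prime p -> odd p ->
     forall n : nat, (3 <= n)%N ->
       graph_connected (nielsen_edge n (gupta_sidki_group p))).
Proof.
split=> [n n4|p p_pr p_odd n n3]; first exact: Grigorchuk.grigorchuk_connected.
exact: (GuptaSidki.gupta_sidki_connected p_pr p_odd n3).
Qed.
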